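(* Let $\sigma\equiv\sigma_0>0$ be constant on $D$. Let $\gamma_1\ge1$, $\gamma_2\ge1$, $Q_1^{1/2}\in HS(L^2(D),H^{\gamma_1}(D))$, $Q_2^{1/2}\in HS(L^2(D),H_0^{\gamma_2}(D))$, and $u_0\in L^2(\Omega,\mathbb{H})$. Then there exists a constant $C_{11}$ independent of time and of $h$ such that for sufficiently small $\Delta t>0$ the solution $\{u_h^n\}$ of the discontinuous Galerkin full discretization (described in the context) satisfies $$\sup_{n\ge0}\mathbb{E}\big[\|u_h^n\|_{\mathbb{H}}^2\big]\le C_{11},$$ where the positive constant $C_{11}$ depends on $\sigma_0$, $\|Q_1^{1/2}\|_{HS(L^2(D),H^{\gamma_1}(D))}$, $\|Q_2^{1/2}\|_{HS(L^2(D),H^{\gamma_2}(D))}$, $\mathbb{E}[\|u_0\|_{\mathbb{H}}^2]$, $\lambda_1$ and $\widetilde{\boldsymbol\lambda}_2$.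
   Context: $D=(x_L,x_R)\times(y_L,y_R)\times(z_L,z_R)\subset\mathbb{R}^3$ is a cuboid; $\mathbb{H}:=L^2(D)^3\times L^2(D)^3$; $H^k(D)=W^{k,2}(D)$; $\lambda_1\in\mathbb{R}$, $\boldsymbol\lambda_2\in\mathbb{R}^3$, $\widetilde{\boldsymbol\lambda}_2=(\boldsymbol\lambda_2^\top,\boldsymbol\lambda_2^\top)^\top\in\mathbb{R}^6$; $J(\mathbf E,\mathbf H)=(-\mathbf H,\mathbf E)$. Noise: $W_1,W_2$ are independent $Q_1$- resp. $Q_2$-Wiener processes on a filtered probability space $(\Omega,\mathcal F,\{\mathcal F_t\}_{t\ge0},\mathbb P)$, $W_i(t)=\sum_{k\ge1}\sqrt{\eta_k^{(i)}}q_k\beta_k^{(i)}(t)$, where $\{q_k\}$ is an orthonormal basis of $L^2(D)$, $Q_iq_k=\eta_k^{(i)}q_k$ with $\eta_k^{(i)}\ge0$, and $\beta_k^{(i)}$ are independent Brownian motions. $HS(U,H)$ denotes the Hilbert–Schmidt operators from $U$ to $H$. With $t_n=n\Delta t$: $\Delta W_2^n=W_2(t_{n+1})-W_2(t_n)$, and $\Delta\overline W_1^n=\sqrt{\Delta t}\sum_{i\ge1}\zeta_i^{(1),n}Q_1^{1/2}q_i$ with $\zeta_i^{(1),n}=\max(-A_{\Delta t},\min(\xi_i^{(1),n},A_{\Delta t}))$, $\xi_i^{(1),n}=(\beta_i^{(1)}(t_{n+1})-\beta_i^{(1)}(t_n))/\sqrt{\Delta t}$, $A_{\Delta t}=\sqrt{2b|\ln\Delta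 t|}$, $b\ge4$ fixed. Mesh and dG space: $\mathcal T_h=\{K\}$ is a simplicial, shape- and contact-regular mesh of $D$, $h$ the maximal element diameter. $\mathbb{H}_h:=\{v_h\in L^2(D):v_h|_K\in\mathbb{P}_1(K)\ \forall K\}^6$ (piecewise polynomials of degree at most $1$), and $\pi_h:\mathbb{H}\to\mathbb{H}_h$ is the $L^2$-orthogonal projection. $\mathcal G_h^{\rm int},\mathcal G_h^{\rm ext}$ are the sets of interior/exterior faces. Each interior face $F$ has a fixed unit normal $\mathbf n_F$ pointing from $K$ to $K_F$, and $[[v_h]]_F:=(v_{K_F})|_F-(v_K)|_F$ with $v_K=v|_K$; on exterior faces $\mathbf n_F$ is the outward normal. Discrete Maxwell operator $M_h:\mathbb{H}_h\to\mathbb{H}_h$: for $u_h=(\mathbf E_h,\mathbf H_h)$, $v_h=(\psi_h,\phi_h)\in\mathbb{H}_h$, $$\begin{aligned}\langle M_hu_h,v_h\rangle_{\mathbb{H}}:=&\sum_{K}\big(\langle\nabla\times\mathbf H_h,\psi_h\rangle_{L^2(K)^3}-\langle\nabla\times\mathbf E_h,\phi_h\rangle_{L^2(K)^3}\big)\\&+\tfrac12\sum_{F\in\mathcal G_h^{\rm int}}\big(\langle\mathbf n_F\times[[\mathbf H_h]]_F,\psi_K+\psi_{K_F}\rangle_{L^2(F)^3}-\langle\mathbf n_F\times[[\mathbf E_h]]_F,\phi_K+\phi_{K_F}\rangle_{L^2(F)^3}\\&\qquad-\langle\mathbf n_F\times[[\mathbf E_h]]_F,\mathbf n_F\times[[\psi_h]]_F\rangle_{L^2(F)^3}-\langle\mathbf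 n_F\times[[\mathbf H_h]]_F,\mathbf n_F\times[[\phi_h]]_F\rangle_{L^2(F)^3}\big)\\&+\sum_{F\in\mathcal G_h^{\rm ext}}\big(\langle\mathbf n_F\times\mathbf E_h,\phi_h\rangle_{L^2(F)^3}-\langle\mathbf n_F\times\mathbf E_h,\mathbf n_F\times\psi_h\rangle_{L^2(F)^3}\big).\end{aligned}$$ dG full discretization: $u_h^0=\pi_hu_0$ and, for $n\in\mathbb{N}$, $$u_h^{n+1}-e^{-\sigma_0\Delta t}u_h^n=\tfrac{\Delta t}{2}\big(M_hu_h^{n+1}+e^{-\sigma_0\Delta t}M_hu_h^n\big)+\tfrac{\lambda_1}{2}\pi_h\big[J(u_h^{n+1}+e^{-\sigma_0\Delta t}u_h^n)\Delta\overline W_1^n\big]+\pi_h(\widetilde{\boldsymbol\lambda}_2\Delta W_2^n).$$ *)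

(* Defs.v *)
From HB Require Import structures.
From mathcomp Require Import all_boot all_order all_algebra.
From mathcomp Require Import all_classical all_reals all_analysis.

Set Implicit Arguments.
Unset Strict Implicit.
Unset Printing Implicit Defensive.

Import Order.TTheory GRing.Theory Num.Theory.
Import numFieldNormedType.Exports.

Local Open Scope classical_set_scope.
Local Open Scope ring_scope.

(** * Vectors and points of R^3 *)

Definition dot (R : realType) n (u v : 'rV[R]_n) : R := \sum_i u 0 i * v 0 i.

Definition enorm (R : realType) n (u : 'rV[R]_n) : R := Num.sqrt (dot u u).

(* Indices live in 'I_3 = Z/3Z, so k + 1 and k + 2 are taken cyclically. *)
Definition cross (R : realType) (u v : 'rV[R]_3) : 'rV[R]_3 :=
  \row_k (u 0 (k + 1) * v 0 (k + 2) - u 0 (k + 2) * v 0 (k + 1)).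

(* Points of R^3 are triples, the type on which the threefold product of the
   Lebesgue measure is defined; [vec] and [pt] convert to and from row
   vectors. *)
Notation R3 R := (measurableTypeR R * measurableTypeR R * measurableTypeR R)%type.

Definition vec (R : realType) (x : R3 R) : 'rV[R]_3 :=
  \row_i nth 0 [:: (x.1.1 : R); (x.1.2 : R); (x.2 : R)] i.

Definition pt (R : realType) (v : 'rV[R]_3) : R3 R :=
  ((v 0 0, v 0 1), v 0 2).

Definition leb2 (R : realType) :=
  ((@lebesgue_measure R) \x (@lebesgue_measure R))%E.
Definition leb3 (R : realType) :=
  ((@lebesgue_measure R) \x (@lebesgue_measure R) \x (@lebesgue_measure R))%E.

Definition dirv (R : realType) (i : 'I_3) : R3 R := pt (delta_mx 0 i).

(* i-th partial derivative *)
Definition pd (R : realType) (i : 'I_3) (f : R3 R -> R) (x : R3 R) : R :=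
  'D_(dirv R i) (f : R * R * R -> R^o) x.

Definition curl (R : realType) (F : R3 R -> 'rV[R]_3) (x : R3 R) : 'rV[R]_3 :=
  \row_k (pd (k + 1) (fun y => F y 0 (k + 2)) x - pd (k + 2) (fun y => F y 0 (k + 1)) x).

(** * The cuboid D and the spaces L^2(D), W^{s,2}(D) *)

Record cuboid (R : realType) := Cuboid {
  xL : R; xR : R; yL : R; yR : R; zL : R; zR : R;
  xLR : xL < xR; yLR : yL < yR; zLR : zL < zR }.

Definition dom (R : realType) (D : cuboid R) : set (R3 R) :=
  (`]xL D, xR D[%classic `*` `]yL D, yR D[%classic) `*` `]zL D, zR D[%classic.

Lemma measurable_dom (R : realType) (D : cuboid R) : measurable (dom D).
Proof. by apply: measurableX; [apply: measurableX|]; exact: measurable_itv. Qed.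

(* closure of D *)
Definition dombar (R : realType) (D : cuboid R) : set (R3 R) :=
  (`[xL D, xR D]%classic `*` `[yL D, yR D]%classic) `*` `[zL D, zR D]%classic.

(* Lebesgue measure restricted to D: integrals and almost-everywhere statements
   with respect to [lebD D] only see D. *)
Definition lebD (R : realType) (D : cuboid R) := mrestr (@leb3 R) (measurable_dom D).

Section FunctionSpaces.
Context (R : realType) (D : cuboid R).
Implicit Types (f g : R3 R -> R) (s : R).

Definition L2 : set (R3 R -> R) := [set f | f \in Lfun (lebD D) 2%:E].

Definition ipL2 f g : R := \int[lebD D]_x (f x * g x).

(* squared norm *)
Definition nsqL2 f : \bar R := (\int[lebD D]_x ((f x) ^+ 2)%:E)%E.

Definition eqD f g : Prop := {ae lebD D, forall x, f x = g x}.

Definition smooth f : Prop := forall s : seq 'I_3,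
  continuous (foldr (@pd R) f s : R * R * R -> R^o) /\
  forall (i : 'I_3) (x : R * R * R),
    derivable (foldr (@pd R) f s : R * R * R -> R^o) x (dirv R i).

(* C_c^oo(D) *)
Definition testfun f : Prop := smooth f /\
  exists K : set (R * R * R), [/\ compact K, K `<=` dom D & forall x, ~ K x -> f x = 0].

(* the partial derivative with multi-index (a 0, a 1, a 2) *)
Definition dmulti (a : 'I_3 -> nat) f : R3 R -> R :=
  iter (a 0) (pd 0) (iter (a 1) (pd 1) (iter (a 2) (pd 2) f)).

Definition is_weakD (a : 'I_3 -> nat) f g : Prop := L2 g /\
  forall phi, testfun phi ->
    ipL2 f (dmulti a phi) = (- 1) ^+ (\sum_i a i)%N * ipL2 g phi.

(* weak derivatives in L^2(D) are unique up to null sets *)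
Definition weakD (a : 'I_3 -> nat) f : R3 R -> R :=
  xget (cst 0) [set g | is_weakD a f g].

(* squared Gagliardo seminorm of order theta in ]0, 1[ *)
Definition gagliardo (theta : R) g : \bar R :=
  (\int[lebD D]_x \int[lebD D]_y
    ((g x - g y) ^+ 2 / (enorm (vec x - vec y)) `^ (3 + 2 * theta))%:E)%E.

Definition sobolev_order s : nat := Num.truncn s.
Definition fracpart s : R := s - (sobolev_order s)%:R.

(* Squared norm of H^s(D) = W^{s,2}(D); for integer s this is the sum of the
   squared L^2 norms of the weak derivatives of order at most s, and for
   fractional s the Sobolev-Slobodeckij norm. *)
Definition nsqH s f : \bar R :=
  (\sum_(a : {ffun 'I_3 -> 'I_(sobolev_order s).+1} | (\sum_i a i <= sobolev_order s)%N)
      nsqL2 (weakD (fun i => a i : nat) f) +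
   (if fracpart s == 0%R then 0 else
    \sum_(a : {ffun 'I_3 -> 'I_(sobolev_order s).+1} | (\sum_i a i == sobolev_order s)%N)
      gagliardo (fracpart s) (weakD (fun i => a i : nat) f)))%E.

Definition Hs s : set (R3 R -> R) := [set f | [/\ L2 f,
  forall a : 'I_3 -> nat, (\sum_i a i <= sobolev_order s)%N -> exists g, is_weakD a f g &
  (nsqH s f < +oo)%E]].

(* H^s_0(D): the closure of C_c^oo(D) in H^s(D) *)
Definition Hs0 s : set (R3 R -> R) := [set f | Hs s f /\
  forall e : R, 0 < e -> exists2 phi, testfun phi &
    (nsqH s (fun x => f x - phi x)%R < e%:E)%E].

(** Operators on L^2(D), acting on representatives *)

Implicit Types (T S : (R3 R -> R) -> R3 R -> R).

Definition linear_L2 T : Prop := forall (c : R) f g, L2 f -> L2 g ->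
  eqD (T (fun x => c * f x + g x)) (fun x => c * T f x + T g x).

Definition bounded_op T : Prop := [/\ forall f, L2 f -> L2 (T f), linear_L2 T &
  exists C : R, forall f, L2 f -> (nsqL2 (T f) <= C%:E * nsqL2 f)%E].

Definition nonneg_selfadjoint T : Prop := [/\ bounded_op T,
  forall f g, L2 f -> L2 g -> ipL2 (T f) g = ipL2 f (T g) &
  forall f, L2 f -> 0 <= ipL2 (T f) f].

(* S = T^{1/2} *)
Definition is_sqrt_op S T : Prop :=
  nonneg_selfadjoint S /\ forall f, L2 f -> eqD (S (S f)) (T f).

Definition onb (q : nat -> R3 R -> R) : Prop := [/\ forall k, L2 (q k),
  forall j k, ipL2 (q j) (q k) = (j == k)%:R &
  forall f, L2 f ->
    (fun n => nsqL2 (fun x => f x - \sum_(k < n) ipL2 f (q k) * q k x)) @ \oo --> 0%E].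

(* Hilbert-Schmidt norm of T : L^2(D) -> H^s(D); it does not depend on the
   orthonormal basis q of L^2(D). *)
Definition normHS (q : nat -> R3 R -> R) s T : \bar R :=
  sqrte (\sum_(k <oo) nsqH s (T (q k)))%E.

(* T in HS(L^2(D), V), where V is H^s(D) or H^s_0(D) with the norm of H^s(D) *)
Definition HS (q : nat -> R3 R -> R) s (V : set (R3 R -> R)) T : Prop :=
  [/\ forall f, L2 f -> V (T f), linear_L2 T,
   exists C : R, forall f, L2 f -> (nsqH s (T f) <= C%:E * nsqL2 f)%E &
   (normHS q s T < +oo)%E].

(** The space H = L^2(D)^3 x L^2(D)^3 *)

Definition vfield := R3 R -> 'rV[R]_(3 + 3).
Implicit Types (u v : vfield).

Definition HH : set vfield := [set u | forall i, L2 (fun x => u x 0 i)].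
Definition ipHH u v : R := \int[lebD D]_x dot (u x) (v x).
Definition nsqHH u : \bar R := (\int[lebD D]_x (dot (u x) (u x))%:E)%E.

(* J (E, H) = (- H, E) *)
Definition Jmap (w : 'rV[R]_(3 + 3)) : 'rV[R]_(3 + 3) :=
  row_mx (- rsubmx w) (lsubmx w).

End FunctionSpaces.

(** * Meshes *)

Definition edist (R : realType) (x y : R3 R) : R := enorm (vec x - vec y).

(* Convex hull of the points p i with i in A; a simplex is the convex hull of
   its four vertices. *)
Definition hull (R : realType) (p : 'I_4 -> 'rV[R]_3) (A : {set 'I_4}) :
    set (R3 R) :=
  [set x | exists l : 'I_4 -> R, [/\ forall i, 0 <= l i,
    forall i, i \notin A -> l i = 0, \sum_i l i = 1 & vec x = \sum_i l i *: p i]].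

Definition simplex (R : realType) (p : 'I_4 -> 'rV[R]_3) := hull p [set: 'I_4].

Definition osimplex (R : realType) (p : 'I_4 -> 'rV[R]_3) : set (R3 R) :=
  [set x | exists l : 'I_4 -> R, [/\ forall i, 0 < l i,
    \sum_i l i = 1 & vec x = \sum_i l i *: p i]].

Definition diam (R : realType) (A : set (R3 R)) : R :=
  sup [set r | exists x y, [/\ A x, A y & r = edist x y]].

(* radius of the largest ball inscribed in A *)
Definition inradius (R : realType) (A : set (R3 R)) : R :=
  sup [set r | 0 <= r /\ exists c, [set x | edist c x < r] `<=` A].

(* Simplicial meshes, possibly with hanging nodes: nondegenerate tetrahedra
   with disjoint interiors that cover the closure of D. *)
Record mesh (R : realType) (D : cuboid R) := Mesh {
  nel : nat;
  vtx : 'I_nel -> 'I_4 -> 'rV[R]_3;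
  vtx_nondeg : forall K,
    \det (\matrix_(i < 3) (vtx K (lift ord0 i) - vtx K ord0)) != 0;
  vtx_disj : forall K L, K != L -> osimplex (vtx K) `&` osimplex (vtx L) = set0;
  vtx_cover : \bigcup_K simplex (vtx K) = dombar D }.

Arguments vtx {R D} m _ _.

Section Meshes.
Context (R : realType) (D : cuboid R).
Implicit Types T S : mesh D.

(* any two elements meet in a common (possibly empty) face *)
Definition matching T : Prop := forall K L : 'I_(nel T), K != L ->
  exists A B : {set 'I_4},
    simplex (vtx T K) `&` simplex (vtx T L) = hull (vtx T K) A /\
    hull (vtx T K) A = hull (vtx T L) B.

(* Shape- and contact-regularity in the sense of Di Pietro and Ern: T has a
   matching simplicial submesh S that is shape-regular with parameter rho1 and
   whose elements are not smaller, up to the factor rho2, than the elements of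
   T containing them. *)
Definition shape_contact_regular (rho1 rho2 : R) T : Prop := exists S, [/\
  matching S,
  forall K', exists K, simplex (vtx S K') `<=` simplex (vtx T K),
  forall K', rho1 * diam (simplex (vtx S K')) <= inradius (simplex (vtx S K')) &
  forall K K', simplex (vtx S K') `<=` simplex (vtx T K) ->
    rho2 * diam (simplex (vtx T K)) <= diam (simplex (vtx S K'))].

(** Faces of a tetrahedron p: the i-th face is opposite to the vertex p i *)

Definition facevtx (p : 'I_4 -> 'rV[R]_3) (i : 'I_4) (j : 'I_3) := p (lift i j).

Definition areavec (p : 'I_4 -> 'rV[R]_3) i : 'rV[R]_3 :=
  cross (facevtx p i 1 - facevtx p i 0) (facevtx p i 2 - facevtx p i 0).

(* outward unit normal *)
Definition outnormal (p : 'I_4 -> 'rV[R]_3) i : 'rV[R]_3 :=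
  - (Num.sg (dot (areavec p i) (p i - facevtx p i 0)) / enorm (areavec p i))
    *: areavec p i.

Definition reftri : set (measurableTypeR R * measurableTypeR R) :=
  [set st | [/\ 0 <= (st.1 : R), 0 <= (st.2 : R) & (st.1 : R) + st.2 <= 1]].

(* surface integral of g over the intersection of the i-th face of p with B *)
Definition surfint (p : 'I_4 -> 'rV[R]_3) i (B : set (R3 R)) (g : R3 R -> R) : R :=
  enorm (areavec p i) * \int[@leb2 R]_(st in reftri)
    (let x := pt (facevtx p i 0 + (st.1 : R) *: (facevtx p i 1 - facevtx p i 0) +
                  (st.2 : R) *: (facevtx p i 2 - facevtx p i 0)) in
     \1_B x * g x).

(** * The dG space and the discrete operators *)

(* An element of H_h is given by one affine map R^3 -> R^6 per element K: the
   row of v K with index 0 is the value at the origin, the remaining three rows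
   are the gradient. *)
Definition dG T := {ffun 'I_(nel T) -> 'M[R]_(1 + 3, 3 + 3)}.

Definition polyval (c : 'M[R]_(1 + 3, 3 + 3)) (x : R3 R) : 'rV[R]_(3 + 3) :=
  row_mx 1%:M (vec x) *m c.

Definition Epart (c : 'M[R]_(1 + 3, 3 + 3)) (x : R3 R) : 'rV[R]_3 :=
  lsubmx (polyval c x).
Definition Hpart (c : 'M[R]_(1 + 3, 3 + 3)) (x : R3 R) : 'rV[R]_3 :=
  rsubmx (polyval c x).

(* v as a function on D (zero on the skeleton, a null set) *)
Definition embed T (v : dG T) : vfield R := fun x =>
  \sum_K \1_(osimplex (vtx T K)) x *: polyval (v K) x.

(* L^2-orthogonal projection H -> H_h *)
Definition pih T (f : vfield R) : dG T :=
  xget 0 [set w | forall v : dG T, ipHH D (embed w) (embed v) = ipHH D f (embed v)].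

(* integral over the interior face between K and L of the integrand of M_h;
   the unit normal points from K to L *)
Definition intface T (u v : dG T) (K L : 'I_(nel T)) : R :=
  \sum_(i < 4) surfint (vtx T K) i (simplex (vtx T L)) (fun x =>
    let n := outnormal (vtx T K) i in
    let jump (F : 'M[R]_(1 + 3, 3 + 3) -> R3 R -> 'rV[R]_3) (w : dG T) :=
      F (w L) x - F (w K) x in
    dot (cross n (jump Hpart u)) (Epart (v K) x + Epart (v L) x)
    - dot (cross n (jump Epart u)) (Hpart (v K) x + Hpart (v L) x)
    - dot (cross n (jump Epart u)) (cross n (jump Epart v))
    - dot (cross n (jump Hpart u)) (cross n (jump Hpart v))).

Definition extface T (u v : dG T) (K : 'I_(nel T)) : R :=
  \sum_(i < 4) surfint (vtx T K) i (dombar D `\` dom D) (fun x =>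
    let n := outnormal (vtx T K) i in
    dot (cross n (Epart (u K) x)) (Hpart (v K) x)
    - dot (cross n (Epart (u K) x)) (cross n (Epart (v K) x))).

(* Each interior face is taken once, oriented from the smaller to the larger
   element index; this choice is immaterial, since reversing a face changes the
   sign of both its normal and the jumps. In [intface], the intersection of L
   with the i-th face of K is a null set of that face unless K and L share a
   face lying in it; likewise for the boundary of D in [extface]. *)
Definition Mform T (u v : dG T) : R :=
  \sum_K (\int[@leb3 R]_(x in osimplex (vtx T K)) dot (curl (Hpart (u K)) x) (Epart (v K) x)
          - \int[@leb3 R]_(x in osimplex (vtx T K)) dot (curl (Epart (u K)) x) (Hpart (v K) x))
  + 2^-1 * (\sum_(K < nel T) \sum_(L < nel T | (K < L)%N) intface u v K L)
  + \sum_K extface u v K.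

(* discrete Maxwell operator *)
Definition Mh T (u : dG T) : dG T :=
  xget 0 [set w | forall v : dG T, ipHH D (embed w) (embed v) = Mform u v].

End Meshes.

(** * Probability *)

Section Stochastic.
Context (R : realType) (d : measure_display) (Omega : measurableType d).
Context (P : probability Omega R).

Definition is_filtration (F : R -> set (set Omega)) : Prop :=
  (forall t, 0 <= t -> sigma_algebra setT (F t) /\ F t `<=` measurable) /\
  (forall s t, 0 <= s -> s <= t -> F s `<=` F t).

(* standard Brownian motion with respect to the filtration F *)
Definition is_BM (F : R -> set (set Omega)) (B : R -> Omega -> R) : Prop := [/\
  {ae P, forall w, B 0 w = 0},
  {ae P, forall w, {within `[0, +oo[, continuous (fun t : R => B t w : R)}},
  forall t, 0 <= t -> forall A : set (measurableTypeR R), measurable A ->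
    F t (B t @^-1` A),
  forall s t, 0 <= s -> s < t -> forall A : set (measurableTypeR R), measurable A ->
    P ((fun w => B t w - B s w) @^-1` A) = normal_prob 0 (Num.sqrt (t - s)) A &
  forall s t, 0 <= s -> s < t -> forall (A : set (measurableTypeR R)) G,
    measurable A -> F s G ->
    let E := (fun w => B t w - B s w) @^-1` A in
    P (G `&` E) = (P G * P E)%E].

(* sigma-algebra generated by the process B *)
Definition sigma_process (B : R -> Omega -> R) : set (set Omega) :=
  <<s [set G | exists t (A : set (measurableTypeR R)),
         [/\ 0 <= t, measurable A & G = B t @^-1` A]] >>.

(* mutual independence of a family of processes *)
Definition independent_processes (I : choiceType) (B : I -> R -> Omega -> R) : Prop :=
  forall (s : seq I) (A : I -> set Omega), uniq s ->
    (forall j, j \in s -> sigma_process (B j) (A j)) ->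
    P (\bigcap_(j in [set` s]) A j) = (\prod_(j <- s) P (A j))%E.

Context (D : cuboid R).

(* Random variables with values in L^2(D), resp. H: the Borel sigma-algebra of
   these separable spaces is generated by the open balls. *)
Definition L2_rv (X : Omega -> R3 R -> R) : Prop := (forall w, L2 D (X w)) /\
  forall f, L2 D f -> forall r : R,
    measurable [set w | (nsqL2 D (fun x => X w x - f x)%R < r%:E)%E].

Definition HH_rv (X : Omega -> vfield R) : Prop := (forall w, HH D (X w)) /\
  forall f, HH D f -> forall r : R,
    measurable [set w | (nsqHH D (fun x => X w x - f x)%R < r%:E)%E].

(* X = \sum_k c k * f k in L^2(Omega; L^2(D)) *)
Definition L2_sum (X : Omega -> R3 R -> R) (c : nat -> Omega -> R)
    (f : nat -> R3 R -> R) : Prop := L2_rv X /\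
  (fun n => \int[P]_w nsqL2 D (fun x => X w x - \sum_(k < n) c k w * f k x)%R)%E
    @ \oo --> 0%E.

(* W (t) = \sum_k sqrt (eta k) q_k beta_k (t) *)
Definition wiener_expansion (W : R -> Omega -> R3 R -> R) (eta : nat -> R)
    (q : nat -> R3 R -> R) (beta : nat -> R -> Omega -> R) : Prop :=
  forall t, 0 <= t -> L2_sum (W t) (fun k w => Num.sqrt (eta k) * beta k t w) q.

(* A_dt and the truncated normalized increments zeta_k^n *)
Definition trunc_level (b dt : R) : R := Num.sqrt (2 * b * `|ln dt|).

Definition zeta (b dt : R) (beta : nat -> R -> Omega -> R) (n k : nat) (w : Omega) : R :=
  Num.max (- trunc_level b dt)
    (Num.min ((beta k (n.+1%:R * dt) w - beta k (n%:R * dt) w) / Num.sqrt dt)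
             (trunc_level b dt)).

(* dW = \sqrt dt * \sum_k zeta_k^n Qh q_k *)
Definition truncated_increment (b dt : R) (beta : nat -> R -> Omega -> R)
    (Qh : (R3 R -> R) -> R3 R -> R) (q : nat -> R3 R -> R) (n : nat)
    (dW : Omega -> R3 R -> R) : Prop :=
  L2_sum dW (fun k w => Num.sqrt dt * zeta b dt beta n k w) (fun k => Qh (q k)).

Context (T : mesh D).

Definition dG_rv (u : Omega -> dG T) : Prop :=
  forall K i j, measurable_fun setT (fun w => u w K i j).

(* The dG full discretization, with dW1 n = \Delta\bar W_1^n and dW2 n =
   \Delta W_2^n. *)
Definition dG_scheme (sigma0 dt lambda1 : R) (lambda2 : 'rV[R]_3)
    (dW1 dW2 : nat -> Omega -> R3 R -> R) (u0 : Omega -> vfield R)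
    (u : nat -> Omega -> dG T) : Prop := [/\
  forall n, dG_rv (u n),
  {ae P, forall w, u 0%N w = pih T (u0 w)} &
  forall n, {ae P, forall w,
    let e := expR (- sigma0 * dt) in
    u n.+1 w - e *: u n w =
      (dt / 2) *: (Mh (u n.+1 w) + e *: Mh (u n w))
      + (lambda1 / 2) *: pih T (fun x =>
          dW1 n w x *: Jmap (embed (u n.+1 w + e *: u n w) x))
      + pih T (fun x => dW2 n w x *: row_mx lambda2 lambda2)}].

End Stochastic.

(* Main.v *)
(** In coordinates the scheme reads x_(n+1) (G - L_n) = e x_n (G + L_n) + g_n, where
    e = exp (- sigma0 dt), G is the Gram matrix of a basis of H_h, L_n is the matrix of
    the form dt/2 <M_h u, v> + lambda1/2 <dW1_n J u, v>, and g_n is the load of dW2_n.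
    On every element the divergence theorem turns <M_h v, v> into integrals over faces;
    the two sides of an interior face carry opposite normals, so only the jump penalties
    survive and <M_h v, v> <= 0.  Since J is skew, L_n is dissipative: (G - L_n)^(-1)
    (G + L_n) is a contraction and (G - L_n)^(-1) maps a load to a vector of smaller norm.

    Let z_n solve the scheme with z_0 = 0.  By contraction |u_n - z_n| <= |u_0| almost
    surely; splitting off u_0 is necessary because u_0 need not be independent of the
    noise.  The increment of beta2_k after time t_n is centred and independent of all
    other Brownian motions and of its own past, on which z_n and L_n depend.  Hence the
    load is orthogonal to the propagated part of z_(n+1), and
      E |z_(n+1)|^2 <= e^2 E |z_n|^2 + 8 dt |l|^2 tr Q2,   l = (lambda2, lambda2)
    (8 is a crude bound for the second moment of a standard Gaussian variable).  As
    dt / (1 - e^2) is bounded for dt < 1, E |z_n|^2 is bounded uniformly in n and h.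
    Finally tr Q2 = sum_k |Q2^(1/2) q_k|^2 is at most the squared Hilbert-Schmidt norm,
    because the weak derivative of order 0 of f is f, test functions separating L^2(D). *)

Require Import Defs.
From HB Require Import structures.
From mathcomp Require Import all_boot all_order all_algebra.
From mathcomp Require Import all_classical all_reals all_analysis.
From mathcomp Require Import measurable_realfun ring lra.

Set Implicit Arguments.
Unset Strict Implicit.
Unset Printing Implicit Defensive.

Import Order.TTheory GRing.Theory Num.Theory.
Import numFieldNormedType.Exports.

Local Open Scope classical_set_scope.
Local Open Scope ring_scope.

(** * Affine changes of variables for the Lebesgue measure *)

(** Two obstacles shape the development. Meshes may have hanging nodes, so interior faces are not
    listed: which elements meet at a face is decided at almost every point of it. At a generic
    point, each barycentric coordinate of the mesh and each plane bounding [D] that vanishes there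
    vanishes on the whole plane of the face. Disjointness and covering then force exactly one
    neighbour, whose barycentric coordinate is a negative multiple, or none on the boundary of [D].
    The second obstacle is adaptedness. L_n contains increments of the beta1 after t_n, so one
    cannot condition on F t_n. For each mode k the sigma-algebra [past] is used instead: it knows
    all other Brownian motions at all times, and of beta2_k the events that lie in F t_n.
    Independence of the processes and independence of increments together make it independent of
    later increments of beta2_k. It contains the null sets, as the noise is determined by its modes
    only almost surely. Since [past] depends on k, orthogonality is proved mode by mode for
    truncated loads, and Fatou's lemma lets the number of modes tend to infinity. *)

Lemma sigma_finite_prod d1 d2 (T1 : measurableType d1) (T2 : measurableType d2) (R : realType)
    (m1 : {sigma_finite_measure set T1 -> \bar R}) (m2 : {sigma_finite_measure set T2 -> \bar R}) :
  sigma_finite setT (m1 \x m2)%E.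
Proof.
have /sigma_finiteP[A [AT Amono Afin]] := sigma_finiteT m1.
have /sigma_finiteP[B [BT Bmono Bfin]] := sigma_finiteT m2.
exists (fun n => A n `*` B n) => [|n].
  apply/seteqP; split => // -[x y] _.
  have [i _ Aix] : (\bigcup_i A i) x by rewrite -AT.
  have [j _ Bjy] : (\bigcup_j B j) y by rewrite -BT.
  exists (maxn i j) => //; split => /=.
    by have /subsetPset := Amono _ _ (leq_maxl i j); exact.
  by have /subsetPset := Bmono _ _ (leq_maxr i j); exact.
have [[mA finA] [mB finB]] := (Afin n, Bfin n).
split; first exact: measurableX.
by rewrite product_measure1E// lte_mul_pinfty// ge0_fin_numE.
Qed.

HB.instance Definition _ (R : realType) := Measure.on (@leb2 R).
HB.instance Definition _ (R : realType) :=
  Measure_isSigmaFinite.Build _ _ _ (@leb2 R) (sigma_finite_prod (@lebesgue_measure R) (@lebesgue_measure R)).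
HB.instance Definition _ (R : realType) := Measure.on (@leb3 R).
HB.instance Definition _ (R : realType) :=
  Measure_isSigmaFinite.Build _ _ _ (@leb3 R) (sigma_finite_prod (@leb2 R) (@lebesgue_measure R)).

Section ChangeOfVariables.
Context (R : realType).
Implicit Types c k : R.

(** Change of variables with constant Jacobian [c], demanded only for nonnegative functions so that
    no integrability has to be carried along. The relation composes, hence affine maps can be
    assembled from one-dimensional ones. *)
Definition cov d (X : measurableType d) (mu : {measure set X -> \bar R}) c (phi : X -> X) :=
  [/\ 0 <= c, measurable_fun setT phi &
  forall f : X -> \bar R, measurable_fun setT f -> (forall x, 0 <= f x)%E ->
    (\int[mu]_x f x = c%:E * \int[mu]_x f (phi x))%E].

Lemma cov_comp d (X : measurableType d) (mu : {measure set X -> \bar R}) c1 c2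
    (phi psi : X -> X) :
  cov mu c1 phi -> cov mu c2 psi -> cov mu (c1 * c2) (phi \o psi).
Proof.
move=> [c10 mphi Hphi] [c20 mpsi Hpsi]; split; [exact: mulr_ge0|exact: measurableT_comp|move=> f mf f0].
rewrite Hphi// (Hpsi (fun x => f (phi x)))//; last exact: (measurableT_comp mf mphi).
by rewrite EFinM muleA.
Qed.

Lemma cov_eq d (X : measurableType d) (mu : {measure set X -> \bar R}) c
    (phi psi : X -> X) : phi =1 psi -> cov mu c phi -> cov mu c psi.
Proof. by move=> /funext ->. Qed.

(** The pushforward of the Lebesgue measure, scaled by the absolute value of [a], agrees with it on
    half-open intervals, and these determine the measure. For positive [a] the preimage is half-open
    at the same end, for negative [a] at the other one, which does not change its length. *)
Lemma cov_affine1 (a b : R) : a != 0 ->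
  cov (@lebesgue_measure R) `|a| (fun x => a * x + b : measurableTypeR R).
Proof.
move=> a0; set phi := (fun _ => _).
have mphi : measurable_fun setT phi.
  by apply: measurable_funD => //; apply: measurable_funM.
pose push := @measure_function_pushforward__canonical__measure_function_Measure _ _
  (measurableTypeR R) (measurableTypeR R) R (@lebesgue_measure R) _ mphi.
have aE A : measurable A -> lebesgue_measure A = mscale (NngNum (normr_ge0 a)) push A.
  apply: lebesgue_measure_unique => _ [[x y] _ <-] /=.
  rewrite /mscale /= /pushforward lebesgue_measure_itv/= lte_fin.
  have [a_gt0|a_lt0|/eqP] := ltgtP a 0; last by rewrite (negbTE a0).
  - have -> : phi @^-1` `]x, y]%classic = `[(y - b) / a, (x - b) / a[%classic.
      apply/seteqP; split=> z /=; rewrite !in_itv/= /phi => /andP[h1 h2]; apply/andP; split.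
      + by rewrite ler_ndivrMr// mulrC lerBrDr.
      + by rewrite ltr_ndivlMr// mulrC ltrBlDr.
      + by move: h2; rewrite ltr_ndivlMr// mulrC ltrBlDr.
      + by move: h1; rewrite ler_ndivrMr// mulrC lerBrDr.
    rewrite lebesgue_measure_itv/= lte_fin ltr_nM2r ?invr_lt0// ltrD2r.
    case: ifPn => _; last by rewrite mule0.
    rewrite -!EFinD -EFinM ltr0_norm//; congr EFin; field; exact: a0.
  - have -> : phi @^-1` `]x, y]%classic = `](x - b) / a, (y - b) / a]%classic.
      apply/seteqP; split=> z /=; rewrite !in_itv/= /phi => /andP[h1 h2]; apply/andP; split.
      + by rewrite ltr_pdivrMr// mulrC ltrBlDr.
      + by rewrite ler_pdivlMr// mulrC lerBrDr.
      + by move: h1; rewrite ltr_pdivrMr// mulrC ltrBlDr.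
      + by move: h2; rewrite ler_pdivlMr// mulrC lerBrDr.
    rewrite lebesgue_measure_itv/= lte_fin ltr_pM2r ?invr_gt0// ltrD2r.
    case: ifPn => _; last by rewrite mule0.
    rewrite -!EFinD -EFinM gtr0_norm//; congr EFin; field; exact: a0.
split => // f mf f0.
rewrite (eq_measure_integral (mscale (NngNum (normr_ge0 a)) push)); last by move=> A mA _; exact: aE.
rewrite ge0_integral_mscale// ge0_integral_pushforward//.
Qed.

Section Product.
Context d (X : measurableType d).
Context (mu : {sigma_finite_measure set X -> \bar R}).
Notation muL := (mu \x (@lebesgue_measure R))%E.

(** Tonelli's theorem: for fixed second coordinate the first one is transformed, with a Jacobian
    independent of the parameter. Together with [cov_snd] this covers the triangular factors of an
    affine map. *)
Lemma cov_fst k (phi : measurableTypeR R -> X -> X) :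
  measurable_fun setT (fun p : X * measurableTypeR R => phi p.2 p.1) ->
  (forall z, cov mu k (phi z)) ->
  cov muL k (fun p => (phi p.2 p.1, p.2)).
Proof.
move=> mphi Hphi.
have mP : measurable_fun setT (fun p : X * measurableTypeR R => (phi p.2 p.1, p.2)).
  by apply: measurable_fun_pair.
have k0 : 0 <= k by case: (Hphi point).
split => // f mf f0.
have mfP := measurableT_comp mf mP.
rewrite (@fubini_tonelli2 _ _ _ _ _ mu lebesgue_measure _ mf f0).
rewrite (@fubini_tonelli2 _ _ _ _ _ mu lebesgue_measure _ mfP); last by move=> x /=.
rewrite -ge0_integralZl//.
- apply: eq_integral => z _ /=; rewrite /fubini_G/=; case: (Hphi z) => _ _ -> //.
  exact: (measurableT_comp mf (pair2_measurable z)).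
- by apply: (@measurable_fun_fubini_tonelli_G _ _ _ _ _ mu _ mfP) => x /=.
- by move=> z _; apply: integral_ge0 => x _ /=.
Qed.

Lemma cov_snd k (phi : X -> measurableTypeR R -> measurableTypeR R) :
  measurable_fun setT (fun p : X * measurableTypeR R => phi p.1 p.2) ->
  (forall x, cov (@lebesgue_measure R) k (phi x)) ->
  cov muL k (fun p => (p.1, phi p.1 p.2)).
Proof.
move=> mphi Hphi.
have mP : measurable_fun setT (fun p : X * measurableTypeR R => (p.1, phi p.1 p.2)).
  by apply: measurable_fun_pair.
have k0 : 0 <= k by case: (Hphi point).
split => // f mf f0.
have mfP := measurableT_comp mf mP.
rewrite (@fubini_tonelli1 _ _ _ _ _ mu lebesgue_measure _ mf f0).
rewrite (@fubini_tonelli1 _ _ _ _ _ mu lebesgue_measure _ mfP); last by move=> x /=.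
rewrite -ge0_integralZl//.
- apply: eq_integral => x _ /=; rewrite /fubini_F/=; case: (Hphi x) => _ _ -> //.
  exact: (measurableT_comp mf (pair1_measurable x)).
- by apply: (@measurable_fun_fubini_tonelli_F _ _ _ _ _ lebesgue_measure _ mfP) => x /=.
- by move=> x _; apply: integral_ge0 => y _ /=.
Qed.


End Product.


Notation mR := (measurableTypeR R).

(** Elimination with pivot [e]: a change of the second coordinate followed by one of the first,
    whose Jacobian is the Schur complement of [e]. *)
Lemma cov_affine2 (a b c e p q : R) : a * e - b * c != 0 ->
  cov (@leb2 R) `|a * e - b * c|
    (fun x : mR * mR => (a * x.1 + b * x.2 + p, c * x.1 + e * x.2 + q) : mR * mR).
Proof.
have H : forall a b c e p q : R, e != 0 -> a * e - b * c != 0 ->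
  cov (@leb2 R) `|a * e - b * c|
    (fun x : mR * mR => (a * x.1 + b * x.2 + p, c * x.1 + e * x.2 + q) : mR * mR).
  move=> {}a {}b {}c {}e {}p {}q e0 d0.
  pose dl := a - b * c / e.
  have dlE : a * e - b * c = dl * e by rewrite /dl; field.
  have dl0 : dl != 0 by apply: contraNneq d0 => dl0; rewrite dlE dl0 mul0r.
  rewrite dlE normrM.
  apply: (@cov_eq _ _ _ _ ((fun x : mR * mR => (dl * x.1 + (b / e * x.2 + (p - b * q / e)), x.2) : mR * mR)
     \o (fun x : mR * mR => (x.1, e * x.2 + (c * x.1 + q)) : mR * mR))).
    by move=> [x y] /=; congr pair; rewrite /dl; [field|ring].
  apply: cov_comp.
  - apply: (@cov_fst _ _ (@lebesgue_measure R) _ (fun z x => dl * x + (b / e * z + (p - b * q / e)))).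
      by do !(apply: measurable_funD => //=); apply: measurable_funM => //=.
    by move=> z; apply: cov_affine1.
  - apply: (@cov_snd _ _ (@lebesgue_measure R) _ (fun x y => e * y + (c * x + q))).
      by do !(apply: measurable_funD => //=); apply: measurable_funM => //=.
    by move=> z; apply: cov_affine1.
(* For a zero pivot, [c] is nonzero because the determinant is. Factoring out the shear that
   subtracts the second coordinate from the first replaces the pivot by [c + e]. *)
move=> d0; have [e0|e0] := eqVneq e 0; last exact: H.
have c0 : c != 0 by apply: contraNneq d0 => c0; rewrite e0 c0 !mulr0 subrr.
have -> : `|a * e - b * c| = `|a * (c + e) - (a + b) * c| * `|1 * 1 - 0 * -1 : R|.
  by rewrite -normrM; congr (`|_|); ring.
apply: (@cov_eq _ _ _ _ ((fun x : mR * mR => (a * x.1 + (a + b) * x.2 + p, c * x.1 + (c + e) * x.2 + q) : mR * mR)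
    \o (fun x : mR * mR => (1 * x.1 + - 1 * x.2 + 0, 0 * x.1 + 1 * x.2 + 0) : mR * mR))).
  by move=> [x y] /=; congr pair; ring.
apply: cov_comp; last first.
  have -> : 1 * 1 - 0 * -1 = 1 * 1 - -1 * 0 :> R by ring.
  by apply: H; rewrite ?oner_neq0// mulr0 subr0 mulr1 oner_neq0.
apply: H; first by rewrite e0 addr0.
by move: d0; congr (_ != 0); ring.
Qed.

(** Elimination with pivot [c3] reduces to [cov_affine2] for the Schur complement, with the third
    coordinate as a parameter. *)
Lemma cov_affine3 (a1 a2 a3 b1 b2 b3 c1 c2 c3 p q r : R) :
  let dt := a1 * (b2 * c3 - b3 * c2) - a2 * (b1 * c3 - b3 * c1) + a3 * (b1 * c2 - b2 * c1) in
  dt != 0 ->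
  cov (@leb3 R) `|dt|
    (fun x : R3 R => (a1 * x.1.1 + a2 * x.1.2 + a3 * x.2 + p,
                      b1 * x.1.1 + b2 * x.1.2 + b3 * x.2 + q,
                      c1 * x.1.1 + c2 * x.1.2 + c3 * x.2 + r) : R3 R).
Proof.
have H : forall (a1 a2 a3 b1 b2 b3 c1 c2 c3 p q r : R),
  let dt := a1 * (b2 * c3 - b3 * c2) - a2 * (b1 * c3 - b3 * c1) + a3 * (b1 * c2 - b2 * c1) in
  c3 != 0 -> dt != 0 ->
  cov (@leb3 R) `|dt|
    (fun x : R3 R => (a1 * x.1.1 + a2 * x.1.2 + a3 * x.2 + p,
                      b1 * x.1.1 + b2 * x.1.2 + b3 * x.2 + q,
                      c1 * x.1.1 + c2 * x.1.2 + c3 * x.2 + r) : R3 R).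
  move=> {}a1 {}a2 {}a3 {}b1 {}b2 {}b3 {}c1 {}c2 {}c3 {}p {}q {}r dt e0 d0.
  pose s1 := a1 - a3 * c1 / c3; pose s2 := a2 - a3 * c2 / c3.
  pose t1 := b1 - b3 * c1 / c3; pose t2 := b2 - b3 * c2 / c3.
  have dlE : dt = (s1 * t2 - s2 * t1) * c3 by rewrite /dt /s1 /s2 /t1 /t2; field.
  have dl0 : s1 * t2 - s2 * t1 != 0 by apply: contraNneq d0 => dl0; rewrite dlE dl0 mul0r.
  rewrite dlE normrM.
  apply: (@cov_eq _ _ _ _
    ((fun x : R3 R => (s1 * x.1.1 + s2 * x.1.2 + (a3 / c3 * x.2 + (p - a3 * r / c3)),
                       t1 * x.1.1 + t2 * x.1.2 + (b3 / c3 * x.2 + (q - b3 * r / c3)), x.2) : R3 R)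
     \o (fun x : R3 R => (x.1, c3 * x.2 + (c1 * x.1.1 + c2 * x.1.2 + r)) : R3 R))).
    by move=> [[x y] z] /=; congr (_, _, _); rewrite /s1 /s2 /t1 /t2; [field|field|ring].
  apply: cov_comp.
  - apply: (@cov_fst _ _ (@leb2 R) _ (fun z x =>
      (s1 * x.1 + s2 * x.2 + (a3 / c3 * z + (p - a3 * r / c3)),
       t1 * x.1 + t2 * x.2 + (b3 / c3 * z + (q - b3 * r / c3))) : mR * mR)).
      by apply: measurable_fun_pair; do !(apply: measurable_funD => //=); apply: measurable_funM => //=;
        apply: measurableT_comp.
    by move=> z; apply: cov_affine2.
  - apply: (@cov_snd _ _ (@leb2 R) _ (fun x y => c3 * y + (c1 * x.1 + c2 * x.2 + r) : mR)).
      by do !(apply: measurable_funD => //=); apply: measurable_funM => //=; apply: measurableT_comp.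
    by move=> z; apply: cov_affine1.
move=> dt d0; have [e0|e0] := eqVneq c3 0; last exact: H.
(* For pivot 0, a shear along the third coordinate replaces [c3] by the squared length [n] of the
   rest of the third row, which vanishes only if the determinant does. *)
pose n := c1 ^+ 2 + c2 ^+ 2.
have c0 : n != 0.
  apply: contraNneq d0 => /eqP; rewrite /n paddr_eq0 ?sqr_ge0// !sqrf_eq0 => /andP[/eqP h1 /eqP h2].
  by apply/eqP; rewrite /dt e0 h1 h2; ring.
rewrite -[`|dt|]mulr1 -[X in _ * X]normr1.
apply: (@cov_eq _ _ _ _ ((fun x : R3 R => (a1 * x.1.1 + a2 * x.1.2 + (a1 * c1 + a2 * c2 + a3) * x.2 + p,
                      b1 * x.1.1 + b2 * x.1.2 + (b1 * c1 + b2 * c2 + b3) * x.2 + q,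
                      c1 * x.1.1 + c2 * x.1.2 + (c1 * c1 + c2 * c2 + c3) * x.2 + r) : R3 R)
    \o (fun x : R3 R => (1 * x.1.1 + 0 * x.1.2 + (- c1) * x.2 + 0,
                      0 * x.1.1 + 1 * x.1.2 + (- c2) * x.2 + 0,
                      0 * x.1.1 + 0 * x.1.2 + 1 * x.2 + 0) : R3 R))).
  by move=> [[x y] z] /=; congr (_, _, _); ring.
apply: cov_comp; last first.
  have E : 1 * (1 * 1 - - c2 * 0) - 0 * (0 * 1 - - c2 * 0) + - c1 * (0 * 0 - 1 * 0) = 1 :> R by ring.
  by move: (H 1 0 (- c1) 0 1 (- c2) 0 0 1 0 0 0 (oner_neq0 _)); rewrite /= E; apply; exact: oner_neq0.
have -> : dt = a1 * (b2 * (c1 * c1 + c2 * c2 + c3) - (b1 * c1 + b2 * c2 + b3) * c2)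
  - a2 * (b1 * (c1 * c1 + c2 * c2 + c3) - (b1 * c1 + b2 * c2 + b3) * c1)
  + (a1 * c1 + a2 * c2 + a3) * (b1 * c2 - b2 * c1) by rewrite /dt; ring.
apply: H; first by rewrite e0 addr0 -!expr2.
by move: d0; congr (_ != 0); rewrite /dt; ring.
Qed.

End ChangeOfVariables.

(** * Moments of the reference triangle and of the reference tetrahedron *)

Section Moments.
Context (R : realType).
Notation mR := (measurableTypeR R).
Notation lam := (@lebesgue_measure R).
Implicit Types (a b c : R).

(** Positive and negative parts are transformed separately; integrability of the transformed
    function makes both integrals finite. *)
Lemma cov_Rintegral d (X : measurableType d) (mu : {measure set X -> \bar R}) c
    (phi : X -> X) (f : X -> R) :
  cov mu c phi -> measurable_fun setT f -> mu.-integrable setT (fun x => (f (phi x))%:E) ->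
  \int[mu]_x f x = c * \int[mu]_x f (phi x).
Proof.
move=> [c0 mphi Hphi] mf fi.
have mf' : measurable_fun setT (fun x => (f x)%:E) by exact/measurable_EFinP.
have Hp := Hphi _ (measurable_funepos mf') (fun x => funepos_ge0 _ x).
have Hn := Hphi _ (measurable_funeneg mf') (fun x => funeneg_ge0 _ x).
have Ep : (\int[mu]_x (fun y => (f y)%:E)^\+ (phi x) = \int[mu]_x (fun x => (f (phi x))%:E)^\+ x)%E.
  by apply: eq_integral => x _; rewrite !funeposE.
have En : (\int[mu]_x (fun y => (f y)%:E)^\- (phi x) = \int[mu]_x (fun x => (f (phi x))%:E)^\- x)%E.
  by apply: eq_integral => x _; rewrite !funenegE.
rewrite /Rintegral integralE Hp Hn Ep En.
rewrite [in RHS]integralE.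
have fp := integral_funepos_lt_pinfty measurableT fi.
have fn := integral_funeneg_lt_pinfty measurableT fi.
have A0 : (0 <= \int[mu]_x (fun x => (f (phi x))%:E)^\+ x)%E by apply: integral_ge0.
have B0 : (0 <= \int[mu]_x (fun x => (f (phi x))%:E)^\- x)%E by apply: integral_ge0.
move: A0 B0 fp fn; move: (\int[mu]_x _)%E => A; move: (\int[mu]_x _)%E => B A0 B0 Ay By.
rewrite -(@fineK _ A) ?ge0_fin_numE// -(@fineK _ B) ?ge0_fin_numE//.
by rewrite /= mulrBr.
Qed.

Lemma integral_horner (P : {poly R}) c : 0 <= c ->
  (\int[lam]_(x in `[0%R, c]) (P^`().[x])%:E)%E = (P.[c] - P.[0])%:E.
Proof.
rewrite le_eqVlt => /predU1P[<-|c0]; first by rewrite set_itv1 integral_set1 subrr.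
rewrite (@continuous_FTC2 _ _ (horner P))//.
- by apply: continuous_subspaceT => x; exact: continuous_horner.
- split; first by move=> x _; exact: derivable_horner.
  + by apply: cvg_at_right_filter; exact: continuous_horner.
  + by apply: cvg_at_left_filter; exact: continuous_horner.
- by move=> x _; rewrite derivE.
Qed.

Lemma integral_sqr_poly (a b d : R) c : 0 <= c ->
  (\int[lam]_(x in `[0%R, c]) (a + b * x + d * x ^+ 2)%:E)%E =
  (a * c + b / 2 * c ^+ 2 + d / 3 * c ^+ 3)%:E.
Proof.
move=> c0; pose P : {poly R} := (a *: 'X + (b / 2) *: 'X^2 + (d / 3) *: 'X^3).
have PE x : P.[x] = a * x + b / 2 * x ^+ 2 + d / 3 * x ^+ 3 by rewrite /P !hornerE.
have P'E x : P^`().[x] = a + b * x + d * x ^+ 2.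
  rewrite /P !(derivD, derivZ, derivX, derivXn)/= !(hornerD, hornerZ, hornerMn, hornerXn, hornerX, hornerC); by field.
under eq_integral do rewrite -P'E.
by rewrite integral_horner// !PE; congr EFin; ring.
Qed.

Lemma integral_cub_poly (a b d e : R) c : 0 <= c ->
  (\int[lam]_(x in `[0%R, c]) (a + b * x + d * x ^+ 2 + e * x ^+ 3)%:E)%E =
  (a * c + b / 2 * c ^+ 2 + d / 3 * c ^+ 3 + e / 4 * c ^+ 4)%:E.
Proof.
move=> c0; pose P : {poly R} := (a *: 'X + (b / 2) *: 'X^2 + (d / 3) *: 'X^3 + (e / 4) *: 'X^4).
have PE x : P.[x] = a * x + b / 2 * x ^+ 2 + d / 3 * x ^+ 3 + e / 4 * x ^+ 4 by rewrite /P !hornerE.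
have P'E x : P^`().[x] = a + b * x + d * x ^+ 2 + e * x ^+ 3.
  rewrite /P !(derivD, derivZ, derivX, derivXn)/= !(hornerD, hornerZ, hornerMn, hornerXn, hornerX, hornerC); by field.
under eq_integral do rewrite -P'E.
by rewrite integral_horner// !PE; congr EFin; ring.
Qed.

Definition aff2 (a b c : R) (x : mR * mR) : R := a + b * x.1 + c * x.2.

Lemma measurable_aff2 a b c : measurable_fun setT (aff2 a b c).
Proof.
by rewrite /aff2; do !(apply: measurable_funD => //=); apply: measurable_funM => //=.
Qed.

Lemma aff2_null a b c : (a, b, c) != 0 -> leb2 [set x | aff2 a b c x = 0] = 0%E :> \bar R.
Proof.
move=> nz; set S := [set x | _].
have mS : measurable S.
  by have := measurable_aff2 a b c measurableT (measurable_set1 (0 : R)); rewrite setTI.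
have S1 k m : k != 0 -> lam [set x | m + k * x = 0] = 0%E.
  move=> k0; rewrite (_ : [set x | _] = [set - m / k]) ?lebesgue_measure_set1//.
  apply/seteqP; split=> x /= h; last by rewrite h; field.
  by apply: (mulfI k0); move/eqP: h; rewrite addrC addr_eq0 => /eqP ->; field.
have [c0|c0] := eqVneq c 0; last first.
  rewrite /leb2 /product_measure1/= integral0_eq// => x _ /=.
  rewrite (_ : xsection S x = [set y | (a + b * x) + c * y = 0]) ?S1//.
  by apply/seteqP; split=> y; rewrite /xsection/= inE.
have [b0|b0] := eqVneq b 0; last first.
  have -> : leb2 S = (lam \x^ lam)%E S.
    apply: product_measure_unique => // A B mA mB; rewrite -product_measure2E//.
  rewrite /product_measure2/= integral0_eq// => y _ /=.
  rewrite (_ : ysection S y = [set x | (a + c * y) + b * x = 0]) ?S1//.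
  by apply/seteqP; split=> x; rewrite /ysection/= inE /S/= /aff2/= => <-; ring.
rewrite (_ : S = set0) ?measure0//.
apply/seteqP; split=> x //=; rewrite /S/= /aff2 b0 c0 !mul0r !addr0 => a0.
by move: nz; rewrite a0 b0 c0 eqxx.
Qed.

Definition otri : set (mR * mR) :=
  [set st | [/\ 0 < (st.1 : R), 0 < (st.2 : R) & (st.1 : R) + st.2 < 1]].

Lemma measurable_aff2_ge a b c : measurable [set x | 0 <= aff2 a b c x].
Proof.
rewrite (_ : [set x | _] = aff2 a b c @^-1` `[0, +oo[%classic).
  by rewrite -[_ @^-1` _]setTI; exact: measurable_aff2.
by apply/seteqP; split=> x /=; rewrite in_itv/= andbT.
Qed.

Lemma measurable_aff2_gt a b c : measurable [set x | 0 < aff2 a b c x].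
Proof.
rewrite (_ : [set x | _] = aff2 a b c @^-1` `]0, +oo[%classic).
  by rewrite -[_ @^-1` _]setTI; exact: measurable_aff2.
by apply/seteqP; split=> x /=; rewrite in_itv/= andbT.
Qed.

Lemma measurable_reftri : measurable (@reftri R).
Proof.
rewrite (_ : @reftri R = [set x | 0 <= aff2 0 1 0 x] `&` [set x | 0 <= aff2 0 0 1 x]
   `&` [set x | 0 <= aff2 1 (-1) (-1) x]).
  by apply: measurableI; [apply: measurableI|]; exact: measurable_aff2_ge.
apply/seteqP; split=> x /=; rewrite /aff2 ?mul0r ?mul1r ?addr0 ?add0r.
  by move=> [h1 h2 h3]; split=> //; lra.
by move=> [[h1 h2] h3]; split=> //; lra.
Qed.

Lemma measurable_otri : measurable otri.
Proof.
rewrite (_ : otri = [set x | 0 < aff2 0 1 0 x] `&` [set x | 0 < aff2 0 0 1 x]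
   `&` [set x | 0 < aff2 1 (-1) (-1) x]).
  by apply: measurableI; [apply: measurableI|]; exact: measurable_aff2_gt.
apply/seteqP; split=> x /=; rewrite /aff2 ?mul0r ?mul1r ?addr0 ?add0r.
  by move=> [h1 h2 h3]; split=> //; lra.
by move=> [[h1 h2] h3]; split=> //; lra.
Qed.

Lemma otri_subset : otri `<=` @reftri R.
Proof. by move=> x [h1 h2 h3]; split; lra. Qed.

Lemma reftriD_null : leb2 (@reftri R `\` otri) = 0%E :> \bar R.
Proof.
have mT := measurable_reftri; have mo := measurable_otri.
have mD a b c : measurable [set x | aff2 a b c x = 0].
  by have := measurable_aff2 a b c measurableT (measurable_set1 (0 : R)); rewrite setTI.
have nT a b c : (a, b, c) != 0 -> (@leb2 R).-negligible [set x | aff2 a b c x = 0].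
  by move=> nz; exists [set x | aff2 a b c x = 0]; split => //; exact: aff2_null.
have N : (@leb2 R).-negligible ([set x | aff2 0 1 0 x = 0] `|` [set x | aff2 0 0 1 x = 0]
   `|` [set x | aff2 1 (-1) (-1) x = 0]).
  by apply: negligibleU; [apply: negligibleU|]; apply: nT; rewrite !xpair_eqE oner_eq0 ?andbF.
have /negligibleP : (@leb2 R).-negligible (@reftri R `\` otri).
  apply: negligibleS N => x [[h1 h2 h3] /= no]; rewrite /aff2 ?mul0r ?mul1r ?addr0 ?add0r.
  have [e1|n1] := eqVneq (x.1 : R) 0; first by left; left.
  have [e2|n2] := eqVneq (x.2 : R) 0; first by left; right.
  right; apply/eqP; apply: contra_notT no => n3; split; rewrite ?lt_neqAle ?h1 ?h2 ?h3 ?andbT 1?eq_sym //.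
  by apply: contraNneq n3 => e; apply/eqP; lra.
by apply; exact: measurableD.
Qed.

Lemma leb2_unit_square : leb2 (`[0, 1]%classic `*` `[0, 1]%classic : set (mR * mR)) = 1%E :> \bar R.
Proof. by rewrite /leb2 product_measure1E//= lebesgue_measure_itv/= lte01 oppr0 adde0 mule1. Qed.

Lemma leb2_reftri_fin : (leb2 (@reftri R) < +oo :> \bar R)%E.
Proof.
apply: (@le_lt_trans _ _ 1%E); last exact: ltry.
rewrite -leb2_unit_square; apply: le_measure; rewrite ?inE; first exact: measurable_reftri.
  by apply: measurableX.
by move=> x [h1 h2 h3]; split => /=; rewrite in_itv/=; lra.
Qed.

Definition quad2 (a b c d e f : R) (x : mR * mR) : R :=
  a + b * x.1 + c * x.2 + d * x.1 ^+ 2 + e * (x.1 * x.2) + f * x.2 ^+ 2.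

Lemma measurable_quad2 a b c d e f : measurable_fun setT (quad2 a b c d e f).
Proof.
by rewrite /quad2; do !(apply: measurable_funD => //=); do !apply: measurable_funM => //=;
  apply: measurable_funX.
Qed.

Lemma bounded_quad2 a b c d e f : [bounded quad2 a b c d e f x | x in @reftri R].
Proof.
exists (`|a| + `|b| + `|c| + `|d| + `|e| + `|f|); split; first by rewrite num_real.
move=> M hM x [/= h1 h2 h3]; apply: le_trans (ltW hM).
have n1 : `|x.1 : R| <= 1 by rewrite ger0_norm//; lra.
have n2 : `|x.2 : R| <= 1 by rewrite ger0_norm//; lra.
rewrite /quad2; do 5! (apply: (le_trans (ler_normD _ _)); apply: lerD;
  last by rewrite normrM ler_piMr// ?normrX ?normrM ?exprn_ile1// mulr_ile1//).
by [].
Qed.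

Lemma quad2_integrable a b c d e f :
  (@leb2 R).-integrable (@reftri R) (EFin \o quad2 a b c d e f).
Proof.
apply: measurable_bounded_integrable; [exact: measurable_reftri|exact: leb2_reftri_fin| |exact: bounded_quad2].
by apply: measurable_funTS; exact: measurable_quad2.
Qed.

Lemma integral_quad2 a b c d e f :
  \int[@leb2 R]_(x in @reftri R) quad2 a b c d e f x =
  a / 2 + (b + c) / 6 + (d + f) / 12 + e / 24.
Proof.
have qi := quad2_integrable a b c d e f.
have mT := measurable_reftri.
rewrite /Rintegral integral_mkcond.
have qi' : (@leb2 R).-integrable setT ((EFin \o quad2 a b c d e f) \_ (@reftri R)).
  by apply/(integrable_mkcond _ mT).
rewrite -(integral12_prod_meas1 qi').
rewrite /fubini_F.
(* The cubic is the inner integral over t in [0, 1 - s], expanded in powers of s. *)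
transitivity (fine (\int[lam]_(x in `[0%R, 1%R])
   ((a + c / 2 + f / 3) + (b - a + e / 2 - c - f) * x + (d - b - e + c / 2 + f) * x ^+ 2
     + (- d + e / 2 - f / 3) * x ^+ 3)%:E)%E); last first.
  by rewrite integral_cub_poly//=; field.
congr fine; rewrite [RHS]integral_mkcond; apply: eq_integral => s _.
rewrite [RHS]patchE; case: ifPn => s01; last first.
  rewrite integral0_eq// => t _; rewrite patchE; case: ifPn => //.
  rewrite inE => -[/= h1 h2 h3]; exfalso; move/negP: s01; apply; rewrite inE/= in_itv/=; lra.
move: s01; rewrite inE/= in_itv/= => /andP[s0 s1].
transitivity (\int[lam]_(t in `[0%R, (1 - s)%R])
  ((a + b * s + d * s ^+ 2) + (c + e * s) * t + f * t ^+ 2)%:E)%E.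
  rewrite [RHS]integral_mkcond; apply: eq_integral => t _.
  rewrite !patchE.
  have -> : ((s, t) \in @reftri R) = (t \in `[0%R, (1 - s)%R]%classic).
    apply/idP/idP; rewrite !inE/= in_itv/=.
      by move=> [/= h1 h2 h3]; lra.
    by move=> /andP[h1 h2]; split => //=; lra.
  by case: ifP => // _; rewrite /= /quad2/=; congr EFin; ring.
rewrite integral_sqr_poly ?subr_ge0//; congr EFin; by field.
Qed.

Lemma integral_otri (f : mR * mR -> R) :
  (@leb2 R).-integrable (@reftri R) (EFin \o f) ->
  (\int[@leb2 R]_(x in otri) (f x)%:E = \int[@leb2 R]_(x in @reftri R) (f x)%:E)%E.
Proof.
move=> fi; have mT := measurable_reftri; have mo := measurable_otri.
rewrite (@negligible_integral _ _ _ _ (@reftri R) (@reftri R `\` otri))//.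
- congr (integral _ _ _); apply/seteqP; split=> x; last by move=> [h1 /not_andP[]// /contrapT].
  by move=> h; split; [exact: otri_subset|move=> []].
- exact: measurableD.
- exact: reftriD_null.
Qed.

Definition aff3 (a b c d : R) (x : R3 R) : R := a + b * x.1.1 + c * x.1.2 + d * x.2.

Lemma measurable_aff3 a b c d : measurable_fun setT (aff3 a b c d).
Proof.
by rewrite /aff3; do !(apply: measurable_funD => //=); apply: measurable_funM => //=;
  apply: measurableT_comp.
Qed.

Lemma measurable_aff3_gt a b c d : measurable [set x | 0 < aff3 a b c d x].
Proof.
rewrite (_ : [set x | _] = aff3 a b c d @^-1` `]0, +oo[%classic).
  by rewrite -[_ @^-1` _]setTI; exact: measurable_aff3.
by apply/seteqP; split=> x /=; rewrite in_itv/= andbT.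
Qed.

Lemma measurable_aff3_ge a b c d : measurable [set x | 0 <= aff3 a b c d x].
Proof.
rewrite (_ : [set x | _] = aff3 a b c d @^-1` `[0, +oo[%classic).
  by rewrite -[_ @^-1` _]setTI; exact: measurable_aff3.
by apply/seteqP; split=> x /=; rewrite in_itv/= andbT.
Qed.

Definition otet : set (R3 R) :=
  [set x | [/\ 0 < (x.1.1 : R), 0 < (x.1.2 : R), 0 < (x.2 : R) & (x.1.1 : R) + x.1.2 + x.2 < 1]].

Lemma measurable_otet : measurable otet.
Proof.
rewrite (_ : otet = [set x | 0 < aff3 0 1 0 0 x] `&` [set x | 0 < aff3 0 0 1 0 x]
   `&` [set x | 0 < aff3 0 0 0 1 x] `&` [set x | 0 < aff3 1 (-1) (-1) (-1) x]).
  by do 3! (apply: measurableI; last exact: measurable_aff3_gt); exact: measurable_aff3_gt.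
apply/seteqP; split=> x /=; rewrite /aff3 ?mul0r ?mul1r ?addr0 ?add0r.
  by move=> [h1 h2 h3 h4]; split=> //; lra.
by move=> [[[h1 h2] h3] h4]; split=> //; lra.
Qed.

Lemma leb3_otet_fin : (leb3 otet < +oo :> \bar R)%E.
Proof.
apply: (@le_lt_trans _ _ (leb3 ((`[0%R, 1%R]%classic `*` `[0%R, 1%R]%classic) `*` `[0%R, 1%R]%classic))); last first.
  rewrite /leb3 product_measure1E//=; last exact: measurableX.
  rewrite -/(leb2 _) leb2_unit_square lebesgue_measure_itv/= lte01 oppr0 adde0 mule1.
  exact: ltry.
apply: le_measure; rewrite ?inE; first exact: measurable_otet.
  by apply: measurableX => //; apply: measurableX.
by move=> x [h1 h2 h3 h4]; do !split => /=; rewrite in_itv/=; lra.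
Qed.

Lemma aff3_integrable a b c d : (@leb3 R).-integrable otet (EFin \o aff3 a b c d).
Proof.
apply: measurable_bounded_integrable; [exact: measurable_otet|exact: leb3_otet_fin| |].
  by apply: measurable_funTS; exact: measurable_aff3.
exists (`|a| + `|b| + `|c| + `|d|); split; first by rewrite num_real.
move=> M hM x [/= h1 h2 h3 h4]; apply: le_trans (ltW hM).
rewrite /aff3; do 3! (apply: (le_trans (ler_normD _ _)); apply: lerD;
  last by rewrite normrM ler_piMr// ger0_norm; lra).
by [].
Qed.

Lemma integral_aff3 a b c d :
  \int[@leb3 R]_(x in otet) aff3 a b c d x = a / 6 + (b + c + d) / 24.
Proof.
have ai := aff3_integrable a b c d.
have mT := measurable_otet.
have /(integrable_mkcond _ mT) ai' := ai.
have F := @integral12_prod_meas1 _ _ _ _ _ (@leb2 R) lam _ ai'.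
rewrite /Rintegral integral_mkcond.
transitivity (fine (\int[@leb2 R]_x fubini_F lam ((EFin \o aff3 a b c d) \_ otet) x)%E).
  by rewrite F.
rewrite /fubini_F.
(* [q] is the integral of the affine function over z in ]0, 1 - x - y[, expanded in x and y. *)
pose q := quad2 (a + d / 2) (b - a - d) (c - a - d) (d / 2 - b) (d - b - c) (d / 2 - c).
transitivity (fine (\int[@leb2 R]_(x in @reftri R) (q x)%:E)%E); last first.
  by rewrite -/(Rintegral _ _ _) integral_quad2; field.
rewrite -integral_otri; last exact: quad2_integrable.
congr fine; rewrite [RHS]integral_mkcond; apply: eq_integral => -[x y] _.
rewrite [RHS]patchE; case: ifPn => xy; last first.
  rewrite integral0_eq// => z _; rewrite patchE; case: ifPn => //.
  rewrite inE => -[/= h1 h2 h3 h4]; exfalso; move/negP: xy; apply; rewrite inE; split => /=; lra.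
move: xy; rewrite inE => -[/= x0 y0 xy].
transitivity (\int[lam]_(z in `]0%R, (1 - x - y)%R[)
  ((a + b * x + c * y) + d * z + 0 * z ^+ 2)%:E)%E.
  rewrite [RHS]integral_mkcond; apply: eq_integral => z _.
  rewrite !patchE.
  have -> : ((x, y, z) \in otet) = (z \in `]0%R, (1 - x - y)%R[%classic).
    apply/idP/idP; rewrite !inE/= in_itv/=.
      by move=> [/= h1 h2 h3 h4]; lra.
    by move=> /andP[h1 h2]; split => //=; lra.
  by case: ifP => // _; rewrite /= /aff3/=; congr EFin; ring.
rewrite integral_itv_bndo_bndc; last first.
  by apply/measurable_EFinP; apply: measurable_funTS; do !(apply: measurable_funD => //=); apply: measurable_funM => //=.
rewrite integral_itv_obnd_cbnd; last first.
  by apply/measurable_EFinP; apply: measurable_funTS; do !(apply: measurable_funD => //=); apply: measurable_funM => //=.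
rewrite integral_sqr_poly ?subr_ge0//; last lra.
by congr EFin; rewrite /q /quad2/=; by field.
Qed.

End Moments.

(** * Barycentric coordinates *)

Section Vectors.
Context (R : realType).
Implicit Types (u v w : 'rV[R]_3) (x y : R3 R).

Lemma big_ord3 (f : 'I_3 -> R) : \sum_i f i = f 0 + f 1 + f 2.
Proof.
rewrite !big_ord_recl big_ord0 addr0 addrA.
by congr (f _ + f _ + f _); apply: val_inj.
Qed.

Lemma dot3 u v : dot u v = u 0 0 * v 0 0 + u 0 1 * v 0 1 + u 0 2 * v 0 2.
Proof. exact: big_ord3. Qed.

Lemma cross0 u v : cross u v 0 0 = u 0 1 * v 0 2 - u 0 2 * v 0 1.
Proof. by rewrite mxE; congr (u _ _ * v _ _ - u _ _ * v _ _); apply: val_inj. Qed.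

Lemma cross1 u v : cross u v 0 1 = u 0 2 * v 0 0 - u 0 0 * v 0 2.
Proof. by rewrite mxE; congr (u _ _ * v _ _ - u _ _ * v _ _); apply: val_inj. Qed.

Lemma cross2 u v : cross u v 0 2 = u 0 0 * v 0 1 - u 0 1 * v 0 0.
Proof. by rewrite mxE; congr (u _ _ * v _ _ - u _ _ * v _ _); apply: val_inj. Qed.

Definition crossE := (cross0, cross1, cross2).

Lemma rV3P u v : u 0 0 = v 0 0 -> u 0 1 = v 0 1 -> u 0 2 = v 0 2 -> u = v.
Proof.
move=> h0 h1 h2; apply/rowP => -[[|[|[|//]]] hi].
- by rewrite (_ : Ordinal hi = 0)//; apply: val_inj.
- by rewrite (_ : Ordinal hi = 1)//; apply: val_inj.
- by rewrite (_ : Ordinal hi = 2)//; apply: val_inj.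
Qed.

Lemma vec0 x : vec x 0 0 = x.1.1. Proof. by rewrite mxE. Qed.
Lemma vec1 x : vec x 0 1 = x.1.2. Proof. by rewrite mxE. Qed.
Lemma vec2 x : vec x 0 2 = x.2. Proof. by rewrite mxE. Qed.

Lemma ptK u : vec (pt u) = u.
Proof. by apply: rV3P; rewrite mxE. Qed.

Lemma dot_crossl u v w : dot (cross u v) w = dot u (cross v w).
Proof. by rewrite !dot3 !crossE; ring. Qed.

Lemma dotDl n (u v w : 'rV[R]_n) : dot (u + v) w = dot u w + dot v w.
Proof. by rewrite /dot -big_split; apply: eq_bigr => i _; rewrite mxE mulrDl. Qed.
Lemma dotC n (u v : 'rV[R]_n) : dot u v = dot v u.
Proof. by apply: eq_bigr => i _; rewrite mulrC. Qed.
Lemma dotDr n (u v w : 'rV[R]_n) : dot u (v + w) = dot u v + dot u w.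
Proof. by rewrite dotC dotDl !(dotC u). Qed.
Lemma dotZl n (c : R) (u v : 'rV[R]_n) : dot (c *: u) v = c * dot u v.
Proof. by rewrite /dot mulr_sumr; apply: eq_bigr => i _; rewrite mxE mulrA. Qed.
Lemma dotZr n (c : R) (u v : 'rV[R]_n) : dot u (c *: v) = c * dot u v.
Proof. by rewrite dotC dotZl dotC. Qed.
Lemma dotNl n (u v : 'rV[R]_n) : dot (- u) v = - dot u v.
Proof. by rewrite -scaleN1r dotZl mulN1r. Qed.
Lemma dotNr n (u v : 'rV[R]_n) : dot u (- v) = - dot u v.
Proof. by rewrite dotC dotNl dotC. Qed.
Lemma dotBr n (u v w : 'rV[R]_n) : dot u (v - w) = dot u v - dot u w.
Proof. by rewrite dotDr dotNr. Qed.
Lemma dot_suml n (I : finType) (f : I -> 'rV[R]_n) (v : 'rV[R]_n) : dot (\sum_i f i) v = \sum_i dot (f i) v.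
Proof.
elim/big_rec2 : _ => [|i x y _ <-]; last by rewrite dotDl.
by rewrite /dot big1// => i _; rewrite mxE mul0r.
Qed.
Lemma dot_sumr n (I : finType) (f : I -> 'rV[R]_n) (v : 'rV[R]_n) : dot v (\sum_i f i) = \sum_i dot v (f i).
Proof. by rewrite dotC dot_suml; apply: eq_bigr => i _; rewrite dotC. Qed.

Lemma dot_ge0 n (u : 'rV[R]_n) : 0 <= dot u u.
Proof. by apply: sumr_ge0 => i _; rewrite -expr2 sqr_ge0. Qed.

Lemma dot_eq0 n (u : 'rV[R]_n) : dot u u = 0 -> u = 0.
Proof.
move=> /psumr_eq0P h; apply/rowP => i; rewrite mxE.
have /eqP : u 0 i * u 0 i = 0 by apply: h => // k _; rewrite -expr2 sqr_ge0.
by rewrite mulf_eq0 orbb => /eqP.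
Qed.

Lemma enorm_ge0 n (u : 'rV[R]_n) : 0 <= enorm u.
Proof. exact: sqrtr_ge0. Qed.

Lemma enormZ n c (u : 'rV[R]_n) : enorm (c *: u) = `|c| * enorm u.
Proof. by rewrite /enorm dotZl dotZr mulrA -expr2 sqrtrM ?sqr_ge0// sqrtr_sqr. Qed.

Lemma enorm_eq0 n (u : 'rV[R]_n) : enorm u = 0 -> u = 0.
Proof.
move=> /eqP; rewrite sqrtr_eq0 => h; apply: dot_eq0; apply/eqP.
by rewrite eq_le h dot_ge0.
Qed.

End Vectors.

Section Barycentric.
Context (R : realType).
Implicit Types (p : 'I_4 -> 'rV[R]_3) (x y : R3 R) (i j : 'I_4) (m : 'cV[R]_(1 + 3)).

Definition ext1 (v : 'rV[R]_3) : 'rV[R]_(1 + 3) := row_mx 1%:M v.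

(** An affine function is coded by its coefficient column, constant term first. This is the layout
    of the columns of a dG function, so components of fields, barycentric coordinates and bounding
    planes are treated alike. *)
Definition aff m (v : 'rV[R]_3) : R := (ext1 v *m m) 0 0.

Definition bmat p : 'M[R]_(1 + 3) := \matrix_i ext1 (p i).

Definition nondeg p : Prop := bmat p \in unitmx.

(** Row reduction: the matrix of extended vertices is a unitriangular matrix times a block
    triangular one whose corner is the matrix of edges. *)
Lemma nondegP p : \det (\matrix_(i < 3) (p (lift ord0 i) - p ord0)) != 0 -> nondeg p.
Proof.
move=> dp; rewrite /nondeg unitmxE unitfE.
pose A : 'M[R]_(1 + 3) := block_mx 1%:M (p ord0) 0 (\matrix_(i < 3) (p (lift ord0 i) - p ord0)).
pose B : 'M[R]_(1 + 3) := block_mx 1%:M 0 (const_mx 1) 1%:M.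
have -> : bmat p = B *m A.
  rewrite mulmx_block !mul1mx !mul0mx !mulmx1 !addr0.
  apply/row_matrixP => i; rewrite rowK.
  case: (split_ordP i) => k ->.
    rewrite [k]ord1 /block_mx rowKu row_row_mx; congr row_mx; last by rewrite [RHS]rowE; apply/rowP => j; rewrite mxE big_ord1 !mxE eqxx mul1r; congr (p _ _ _); apply: val_inj.
    by apply/rowP => j; rewrite !mxE !ord1 eqxx.
  rewrite /block_mx rowKd row_row_mx; congr row_mx; apply/rowP => j; rewrite !mxE ?ord1//.
  rewrite big_ord1 !mxE mul1r addrC subrK; congr (p _ _ _); exact: val_inj.
by rewrite det_mulmx det_lblock det_ublock !det1 !mul1r.
Qed.

Definition bcol p i : 'cV[R]_(1 + 3) := col i (invmx (bmat p)).

Definition bary p i (v : 'rV[R]_3) : R := aff (bcol p i) v.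

Lemma baryE p i v : bary p i v = (ext1 v *m invmx (bmat p)) 0 i.
Proof.
by rewrite /bary /aff [LHS]mxE [RHS]mxE; apply: eq_bigr => k _; rewrite [bcol _ _ _ _]mxE.
Qed.

Lemma sum_row_bmat p (l : 'I_4 -> R) :
  (\row_i l i : 'rV_(1 + 3)) *m bmat p = row_mx (\sum_i l i)%:M (\sum_i l i *: p i).
Proof.
rewrite mulmx_sum_row; under eq_bigr do rewrite mxE rowK /ext1 scale_row_mx.
apply/rowP => k; rewrite summxE; case: (split_ordP k) => j ->.
  rewrite row_mxEl !mxE ord1 eqxx mulr1n; apply: eq_bigr => i _.
  by rewrite row_mxEl !mxE eqxx mulr1.
by rewrite row_mxEr summxE; apply: eq_bigr => i _; rewrite row_mxEr.
Qed.

Lemma bary_comb p v : nondeg p -> \sum_i bary p i v = 1 /\ v = \sum_i bary p i v *: p i.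
Proof.
move=> np; have := sum_row_bmat p (bary p ^~ v).
have -> : (\row_i bary p i v : 'rV_(1 + 3)) = ext1 v *m invmx (bmat p).
  by apply/rowP => i; rewrite mxE baryE.
rewrite mulmxKV// => /eq_row_mx[h1 h2]; split => //.
by move/matrixP: h1 => /(_ 0 0); rewrite !mxE.
Qed.

Lemma bary_uniq p v (l : 'I_4 -> R) i : nondeg p ->
  \sum_i l i = 1 -> v = \sum_i l i *: p i -> bary p i v = l i.
Proof.
move=> np l1 lv; rewrite baryE; have := sum_row_bmat p l.
by rewrite l1 -lv -/(ext1 v) => <-; rewrite mulmxK// mxE.
Qed.

Lemma bary_vtx p i j : nondeg p -> bary p i (p j) = (j == i)%:R.
Proof.
move=> np; rewrite baryE.
have -> : ext1 (p j) = row j (bmat p) by rewrite rowK.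
by rewrite -row_mul mulmxV// !mxE eq_sym.
Qed.

Lemma aff_comb m (I : finType) (l : I -> R) (q : I -> 'rV[R]_3) :
  \sum_i l i = 1 -> aff m (\sum_i l i *: q i) = \sum_i l i * aff m (q i).
Proof.
move=> l1; rewrite /aff; have -> : ext1 (\sum_i l i *: q i) = \sum_i l i *: ext1 (q i).
  apply/rowP => k; rewrite summxE; case: (split_ordP k) => j ->.
    by rewrite row_mxEl; under eq_bigr do rewrite mxE row_mxEl; rewrite -mulr_suml l1 mul1r.
  by rewrite row_mxEr summxE; apply: eq_bigr => i _; rewrite [RHS]mxE row_mxEr mxE.
by rewrite mulmx_suml summxE; apply: eq_bigr => i _; rewrite -scalemxAl mxE.
Qed.

Lemma affE m v : aff m v = m (lshift 3 0) 0 + m (rshift 1 0) 0 * v 0 0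
   + m (rshift 1 1) 0 * v 0 1 + m (rshift 1 2) 0 * v 0 2.
Proof.
rewrite /aff mxE big_split_ord/= big_ord1 big_ord3 row_mxEl !row_mxEr mxE eqxx mul1r.
by rewrite !addrA !(mulrC (v 0 _)).
Qed.

Lemma aff_line m (u v : 'rV[R]_3) (e : R) :
  aff m (u + e *: (v - u)) = (1 - e) * aff m u + e * aff m v.
Proof. by rewrite !affE !mxE; ring. Qed.

Lemma aff_tri m (u v w : 'rV[R]_3) (s t : R) :
  aff m (u + s *: (v - u) + t *: (w - u)) =
  aff2 (aff m u) (aff m v - aff m u) (aff m w - aff m u) (s, t).
Proof. by rewrite !affE /aff2 !mxE/=; ring. Qed.

Lemma aff_vec m x : aff m (vec x) =
  aff3 (m (lshift 3 0) 0) (m (rshift 1 0) 0) (m (rshift 1 1) 0) (m (rshift 1 2) 0) x.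
Proof. by rewrite affE vec0 vec1 vec2. Qed.

Lemma affZ c m v : aff (c *: m) v = c * aff m v.
Proof. by rewrite !affE !mxE; ring. Qed.

(** Interpolation at the four vertices. It serves to recognise a function that vanishes on a face as
    a multiple of one barycentric coordinate. *)
Lemma aff_bary p m : nondeg p -> m = \sum_i aff m (p i) *: bcol p i.
Proof.
move=> np; have : bmat p *m m = \col_i aff m (p i).
  by apply/colP => i; rewrite [RHS]mxE /aff [LHS]mxE [RHS]mxE; apply: eq_bigr => k _; rewrite mxE.
move=> /(congr1 (mulmx (invmx (bmat p)))); rewrite mulKmx// => {1}->.
apply/colP => k; rewrite mxE summxE; apply: eq_bigr => i _; rewrite !mxE mulrC//.
Qed.

Lemma bcol_neq0 p i : nondeg p -> bcol p i != 0.
Proof.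
move=> np; apply/eqP => h; have := bary_vtx i i np.
by rewrite /bary h eqxx affE !mxE !mul0r !addr0 => /eqP; rewrite eq_sym oner_eq0.
Qed.

Lemma simplexP p x : nondeg p -> simplex p x <-> forall i, 0 <= bary p i (vec x).
Proof.
move=> np; split=> [[l [l0 _ l1 lx]] i|h]; first by rewrite (bary_uniq i np l1 lx).
exists (bary p ^~ (vec x)); split => //; first by move=> i; rewrite inE.
  by have [] := bary_comb (vec x) np.
by have [] := bary_comb (vec x) np.
Qed.

Lemma osimplexP p x : nondeg p -> osimplex p x <-> forall i, 0 < bary p i (vec x).
Proof.
move=> np; split=> [[l [l0 l1 lx]] i|h]; first by rewrite (bary_uniq i np l1 lx).
by exists (bary p ^~ (vec x)); have [] := bary_comb (vec x) np.
Qed.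

Lemma measurable_simplex p : nondeg p -> measurable (simplex p).
Proof.
move=> np; rewrite (_ : simplex p = \bigcap_(i in [set: 'I_4]) [set x | 0 <= bary p i (vec x)]).
  apply: fin_bigcap_measurable => [|i _]; first exact: finite_finset.
  under eq_set do rewrite /bary aff_vec; exact: measurable_aff3_ge.
apply/seteqP; split=> x; first by move=> /(simplexP x np) h i _; exact: h.
by move=> h; apply/simplexP => // i; exact: h.
Qed.

Lemma measurable_osimplex p : nondeg p -> measurable (osimplex p).
Proof.
move=> np; rewrite (_ : osimplex p = \bigcap_(i in [set: 'I_4]) [set x | 0 < bary p i (vec x)]).
  apply: fin_bigcap_measurable => [|i _]; first exact: finite_finset.
  under eq_set do rewrite /bary aff_vec; exact: measurable_aff3_gt.
apply/seteqP; split=> x; first by move=> /(osimplexP x np) h i _; exact: h.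
by move=> h; apply/osimplexP => // i; exact: h.
Qed.

End Barycentric.

(** * Generic points of faces *)

Section Faces.
Context (R : realType).
Notation mR := (measurableTypeR R).
Implicit Types (p q : 'I_4 -> 'rV[R]_3) (x y : R3 R) (i j : 'I_4) (m : 'cV[R]_(1 + 3)).
Implicit Types (st : mR * mR) (u v : 'rV[R]_3).

Definition facechart p i st : 'rV[R]_3 :=
  facevtx p i 0 + (st.1 : R) *: (facevtx p i 1 - facevtx p i 0)
    + (st.2 : R) *: (facevtx p i 2 - facevtx p i 0).

Lemma aff_facechart m p i st : aff m (facechart p i st) =
  aff2 (aff m (facevtx p i 0)) (aff m (facevtx p i 1) - aff m (facevtx p i 0))
       (aff m (facevtx p i 2) - aff m (facevtx p i 0)) st.
Proof. exact: aff_tri. Qed.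

Lemma bary_facevtx p i j (k : 'I_3) : nondeg p -> bary p j (facevtx p i k) = (lift i k == j)%:R.
Proof. exact: bary_vtx. Qed.

Lemma bary_face p i st : nondeg p -> bary p i (facechart p i st) = 0.
Proof.
move=> np; rewrite /bary aff_facechart -!/(bary _ _ _) !bary_facevtx//.
have lf k : (lift i k == i) = false by rewrite eq_sym; apply/negbTE/neq_lift.
by rewrite !lf /aff2 /= subrr !mul0r !addr0.
Qed.

Lemma bary_face_lift p i st (k : 'I_3) : nondeg p ->
  bary p (lift i k) (facechart p i st) =
  if k == 0 then 1 - st.1 - st.2 else if k == 1 then st.1 else st.2.
Proof.
move=> np; rewrite /bary aff_facechart -!/(bary _ _ _) !bary_facevtx// !(inj_eq lift_inj) /aff2.
case: k => -[|[|[|//]]] hk; rewrite -?val_eqE/=; ring.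
Qed.

Lemma on_face p i v : nondeg p -> bary p i v = 0 ->
  v = facechart p i (bary p (lift i 1) v, bary p (lift i 2) v).
Proof.
move=> np vi; have [] := bary_comb v np.
rewrite !(bigD1_ord i)//= vi scale0r !add0r big_ord3 => h.
rewrite (_ : \sum_(j < 3) _ = bary p (lift i 0) v *: facevtx p i 0 +
  bary p (lift i 1) v *: facevtx p i 1 + bary p (lift i 2) v *: facevtx p i 2); last first.
  rewrite !big_ord_recl big_ord0 addr0 addrA.
  by congr (bary p (lift i _) v *: p (lift i _) + bary p (lift i _) v *: p (lift i _)
      + bary p (lift i _) v *: p (lift i _)); apply: val_inj.
move=> e; rewrite {1}e /facechart /=.
have -> : bary p (lift i 0) v = 1 - bary p (lift i 1) v - bary p (lift i 2) v by rewrite -h; ring.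
by apply: rV3P; rewrite !mxE; ring.
Qed.

Lemma facechart_simplex p i st : nondeg p -> reftri st -> simplex p (pt (facechart p i st)).
Proof.
move=> np [h1 h2 h3]; apply/simplexP => // j; rewrite ptK.
case: (unliftP i j) => [k ->|->]; last by rewrite bary_face.
by rewrite bary_face_lift//; do !case: ifP => _ //; lra.
Qed.

(** By [aff_bary] the conclusion says that [m] vanishes at the three vertices of the face: a generic
    point lies on the zero plane of [m] only if the whole face does. *)
Definition generic_for p i st m : Prop :=
  aff m (facechart p i st) = 0 -> m = aff m (p i) *: bcol p i.

(** A function vanishing on the whole face excludes no point; any other one vanishes there along a
    line at most, hence on a null set. *)
Lemma generic_negligible p i (ms : seq 'cV[R]_(1 + 3)) : nondeg p ->
  (@leb2 R).-negligible [set st | ~ forall m, m \in ms -> generic_for p i st m].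
Proof.
move=> np; elim: ms => [|m ms IH].
  apply: negligibleS (negligible_set0 _) => st /=; apply; by [].
pose S := [set st : mR * mR | ~ generic_for p i st m].
suff NS : (@leb2 R).-negligible S.
  apply: negligibleS (negligibleU NS IH) => st /= h.
  have [h1|h1] := pselect (S st); [by left|right => h2; apply: h => m'].
  by rewrite inE => /predU1P[->|/h2//]; exact: contrapT.
have [nz|z] := eqVneq (aff m (facevtx p i 0), aff m (facevtx p i 1) - aff m (facevtx p i 0),
   aff m (facevtx p i 2) - aff m (facevtx p i 0)) 0.
  apply: negligibleS (negligible_set0 _) => st /=; apply => _.
  move: nz => [h0]; rewrite h0 !subr0 => h1 h2.
  rewrite {1}(aff_bary m np) (bigD1_ord i)//= big1 ?addr0// => k _.
  suff -> : aff m (p (lift i k)) = 0 by rewrite scale0r.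
  by case: k => -[|[|[|//]]] hk; [rewrite -[RHS]h0|rewrite -[RHS]h1|rewrite -[RHS]h2];
    congr (aff m (p (lift i _))); apply: val_inj.
apply: (@negligibleS _ _ _ _ [set st | aff2 (aff m (facevtx p i 0)) (aff m (facevtx p i 1) - aff m (facevtx p i 0))
   (aff m (facevtx p i 2) - aff m (facevtx p i 0)) st = 0]).
  by move=> st /= h; rewrite -aff_facechart; apply: contrapT => h'; apply: h.
exists [set st | aff2 (aff m (facevtx p i 0)) (aff m (facevtx p i 1) - aff m (facevtx p i 0))
   (aff m (facevtx p i 2) - aff m (facevtx p i 0)) st = 0]; split => //.
  have := measurable_aff2 (aff m (facevtx p i 0)) (aff m (facevtx p i 1) - aff m (facevtx p i 0))
   (aff m (facevtx p i 2) - aff m (facevtx p i 0)) measurableT (measurable_set1 (0 : R)).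
  by rewrite setTI.
exact: aff2_null.
Qed.

(** Positivity of finitely many affine functions is an open condition. As [e] may have either sign,
    the segment can run towards [v] or away from it. *)
Lemma small_segment (ms : seq 'cV[R]_(1 + 3)) u v :
  (forall m, m \in ms -> 0 < aff m u) ->
  exists2 e0 : R, 0 < e0 < 1 & forall e, `|e| <= e0 ->
    forall m, m \in ms -> 0 < aff m (u + e *: (v - u)).
Proof.
elim: ms => [_|m ms IH h]; first by exists 2^-1 => //; lra.
have [|e1 /andP[e10 e11] he1] := IH; first by move=> m' mm'; apply: h; rewrite inE mm' orbT.
have mu0 : 0 < aff m u by apply: h; rewrite inE eqxx.
pose b := `|aff m v - aff m u|.
have b0 : 0 < b + 1 by rewrite ltr_wpDl// normr_ge0.
exists (Num.min e1 (aff m u / (b + 1))).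
  by rewrite lt_min e10 divr_gt0//= gt_min e11.
move=> e; rewrite le_min => /andP[le1 le2] m'; rewrite inE => /predU1P[->|mm']; last exact: he1.
have -> : aff m (u + e *: (v - u)) = aff m u + e * (aff m v - aff m u) by rewrite aff_line; ring.
have : `|e * (aff m v - aff m u)| < aff m u.
  rewrite normrM -/b.
  apply: (@le_lt_trans _ _ (aff m u / (b + 1) * b)); first by rewrite ler_wpM2r// normr_ge0.
  by rewrite -mulrA gtr_pMr// mulrC ltr_pdivrMr// mul1r ltrDl.
by rewrite ltr_norml => /andP[]; lra.
Qed.

(** The two faces span the same plane and, [c] being negative, the tetrahedra lie on opposite sides
    of it. With hanging nodes the faces need not coincide. *)
Definition paired p i q j : Prop := exists2 c : R, c < 0 & bcol q j = c *: bcol p i.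

Lemma paired_inj p i q j j' : nondeg q -> paired p i q j -> paired p i q j' -> j = j'.
Proof.
move=> nq [c c0 e] [c' c'0 e']; apply/eqP/negP => /negP jj'.
have h1 : bary q j (q j) = c * bary p i (q j) by rewrite /bary e affZ.
have h2 : bary q j' (q j) = c' * bary p i (q j) by rewrite /bary e' affZ.
move: h1 h2; rewrite !bary_vtx// eqxx (negbTE jj') => h1 /esym/eqP.
rewrite mulf_eq0 (lt_eqF c'0)/= => /eqP h2; move/eqP: h1.
by rewrite h2 mulr0 oner_eq0.
Qed.

Lemma paired_sym p i q j : paired p i q j -> paired q j p i.
Proof.
move=> [c c0 e]; exists c^-1; first by rewrite invr_lt0.
by rewrite e scalerA mulVf ?scale1r// lt_eqF.
Qed.

Lemma bary_segment p i st e : nondeg p -> otri st -> 0 < e < 1 ->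
  osimplex p (pt (facechart p i st + e *: (p i - facechart p i st))).
Proof.
move=> np [h1 h2 h3] /andP[e0 e1]; apply/osimplexP => // j.
rewrite ptK /bary aff_line -!/(bary _ _ _) bary_vtx//.
case: (unliftP i j) => [k ->|->]; last by rewrite bary_face// eqxx mulr0 add0r mulr1.
rewrite bary_face_lift// (negbTE (neq_lift _ _)) mulr0 addr0.
by apply: mulr_gt0; [lra|do !case: ifP => _ //; lra].
Qed.

Lemma bary_out p i st e : nondeg p ->
  bary p i (facechart p i st + e *: (p i - facechart p i st)) = e.
Proof. by move=> np; rewrite /bary aff_line -!/(bary _ _ _) bary_vtx// bary_face// eqxx mulr0 add0r mulr1. Qed.

(** Moving from the generic point towards [p i] enters the interior of [p], hence never that of [q].
    So the point is not interior to [q], and some barycentric coordinate of [q] vanishes there. By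
    genericity it is a multiple of that of [p]; a positive factor would let the segment enter [q],
    and two vanishing coordinates would be proportional. *)
Lemma paired_of_generic p q i st : nondeg p -> nondeg q ->
  osimplex p `&` osimplex q = set0 -> otri st ->
  (forall j, generic_for p i st (bcol q j)) -> simplex q (pt (facechart p i st)) ->
  exists2 j, paired p i q j & forall j', j' != j -> 0 < bary q j' (facechart p i st).
Proof.
move=> np nq pq ost gst /(simplexP _ nq); set x := facechart p i st; rewrite ptK => xq.
have meet e : 0 < e < 1 -> exists j, bary q j (x + e *: (p i - x)) <= 0.
  move=> he; apply: contrapT => /forallNP h.
  have : (osimplex p `&` osimplex q) (pt (x + e *: (p i - x))).
    split; first exact: bary_segment.
    by apply/osimplexP => // j; rewrite ptK ltNge; apply/negP/h.
  by rewrite pq.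
have [[j xj]|/forallNP h] := pselect (exists j, bary q j x = 0); last first.
  have [|e0 /andP[e00 e01] he] := @small_segment [seq bcol q j | j <- enum 'I_4] x (p i).
    by move=> m /mapP[j _ ->]; rewrite lt_neqAle xq andbT eq_sym; apply/eqP/h.
  have [|j] := meet e0; first by rewrite e00.
  rewrite leNgt /bary he//; first by rewrite ger0_norm// ltW.
  by apply/mapP; exists j; rewrite ?mem_enum.
have ej := gst j xj; set c := aff _ _ in ej.
have c0 : c != 0 by apply: contraTneq (bcol_neq0 j nq) => c0; rewrite ej c0 scale0r eqxx.
have pos j' : j' != j -> 0 < bary q j' x.
  move=> jj'; rewrite lt_neqAle xq andbT eq_sym; apply/eqP => xj'.
  have ej' := gst j' xj'; set c' := aff _ _ in ej'.
  have h1 : bary q j (q j) = c * bary p i (q j) by rewrite /bary ej affZ.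
  have h2 : bary q j' (q j) = c' * bary p i (q j) by rewrite /bary ej' affZ.
  move: h1 h2; rewrite !bary_vtx// eqxx [j == j']eq_sym (negbTE jj') => h1 /esym/eqP.
  rewrite mulf_eq0 => /orP[/eqP c'0|/eqP h2].
    by have := bcol_neq0 j' nq; rewrite ej' c'0 scale0r eqxx.
  by move/eqP: h1; rewrite h2 mulr0 oner_eq0.
exists j => //; exists c => //; rewrite lt_neqAle c0/= leNgt; apply/negP => cpos.
have [|e0 /andP[e00 e01] he] := @small_segment [seq bcol q j' | j' <- enum 'I_4 & j' != j] x (p i).
  by move=> m /mapP[j']; rewrite mem_filter => /andP[jj' _] ->; exact: pos.
have [|j'] := meet e0; first by rewrite e00.
have [->|jj'] := eqVneq j' j.
  by rewrite /bary ej affZ -/(bary _ _ _) bary_out// leNgt mulr_gt0.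
rewrite leNgt /bary he//; first by rewrite ger0_norm// ltW.
by apply/mapP; exists j' => //; rewrite mem_filter jj' /= mem_enum.
Qed.

(** Beyond the face, away from [p i], the coordinate [j] becomes positive because [c] is negative;
    the other ones stay positive by continuity. *)
Lemma paired_beyond p q i j st : nondeg p -> nondeg q -> paired p i q j ->
  (forall j', j' != j -> 0 < bary q j' (facechart p i st)) ->
  exists2 e0 : R, 0 < e0 < 1 & forall e, 0 < e <= e0 ->
    osimplex q (pt (facechart p i st + (- e) *: (p i - facechart p i st))).
Proof.
move=> np nq [c c0 ej] pos; set x := facechart p i st in pos *.
have [|e0 he0 he] := @small_segment [seq bcol q j' | j' <- enum 'I_4 & j' != j] x (p i).
  by move=> m /mapP[j']; rewrite mem_filter => /andP[jj' _] ->; exact: pos.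
exists e0 => // e /andP[e_gt0 ee0]; apply/osimplexP => // j'; rewrite ptK.
have [->|jj'] := eqVneq j' j.
  by rewrite /bary ej affZ -/(bary _ _ _) bary_out// mulrN -mulNr mulr_gt0// oppr_gt0.
apply: he; first by rewrite normrN ger0_norm// ltW.
by apply/mapP; exists j' => //; rewrite mem_filter jj' /= mem_enum.
Qed.

End Faces.

Section MeshFaces.
Context (R : realType) (D : cuboid R) (T : mesh D).
Notation mR := (measurableTypeR R).
Implicit Types (K L : 'I_(nel T)) (x : R3 R) (i j : 'I_4) (m : 'cV[R]_(1 + 3)) (st : mR * mR).

Definition mkaff (a b c d : R) : 'cV[R]_(1 + 3) :=
  col_mx a%:M (\col_k nth 0 [:: b; c; d] k).

Lemma aff_mkaff a b c d v : aff (mkaff a b c d) v = a + b * v 0 0 + c * v 0 1 + d * v 0 2.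
Proof. by rewrite affE /mkaff col_mxEu !col_mxEd !mxE. Qed.

Lemma mkaff_neq0 a b c d : (b, c, d) != 0 -> mkaff a b c d != 0.
Proof.
apply: contraNneq => /colP e.
have := e (rshift 1 0); have := e (rshift 1 1); have := e (rshift 1 2).
by rewrite /mkaff !col_mxEd !mxE /= => -> -> ->; rewrite !xpair_eqE !eqxx.
Qed.

Definition planes : seq 'cV[R]_(1 + 3) :=
  [:: mkaff (- xL D) 1 0 0; mkaff (xR D) (-1) 0 0; mkaff (- yL D) 0 1 0; mkaff (yR D) 0 (-1) 0;
      mkaff (- zL D) 0 0 1; mkaff (zR D) 0 0 (-1)].

Lemma planes_neq0 m : m \in planes -> m != 0.
Proof.
by rewrite !inE => /or4P[| | |/or3P[]] /eqP ->; apply: mkaff_neq0;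
  rewrite !xpair_eqE ?oppr_eq0 ?oner_eq0 ?andbF.
Qed.

Lemma dombarP x : dombar D x <-> forall m, m \in planes -> 0 <= aff m (vec x).
Proof.
split.
  move=> [[/=]]; rewrite !in_itv/= => /andP[h1 h2] /andP[h3 h4] /andP[h5 h6] m.
  by rewrite !inE => /or4P[| | |/or3P[]] /eqP ->; rewrite aff_mkaff vec0 vec1 vec2; lra.
move=> h; have hp m : m \in planes -> 0 <= aff m (vec x) by exact: h.
do !split => /=; rewrite in_itv/=; apply/andP; split.
- by have := hp (mkaff (- xL D) 1 0 0); rewrite !inE eqxx aff_mkaff vec0 vec1 vec2 => /(_ erefl); lra.
- by have := hp (mkaff (xR D) (-1) 0 0); rewrite !inE eqxx ?orbT aff_mkaff vec0 vec1 vec2 => /(_ erefl); lra.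
- by have := hp (mkaff (- yL D) 0 1 0); rewrite !inE eqxx ?orbT aff_mkaff vec0 vec1 vec2 => /(_ erefl); lra.
- by have := hp (mkaff (yR D) 0 (-1) 0); rewrite !inE eqxx ?orbT aff_mkaff vec0 vec1 vec2 => /(_ erefl); lra.
- by have := hp (mkaff (- zL D) 0 0 1); rewrite !inE eqxx ?orbT aff_mkaff vec0 vec1 vec2 => /(_ erefl); lra.
- by have := hp (mkaff (zR D) 0 0 (-1)); rewrite !inE eqxx ?orbT aff_mkaff vec0 vec1 vec2 => /(_ erefl); lra.
Qed.

Lemma domP x : dom D x <-> forall m, m \in planes -> 0 < aff m (vec x).
Proof.
split.
  move=> [[/=]]; rewrite !in_itv/= => /andP[h1 h2] /andP[h3 h4] /andP[h5 h6] m.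
  by rewrite !inE => /or4P[| | |/or3P[]] /eqP ->; rewrite aff_mkaff vec0 vec1 vec2; lra.
move=> h; have hp m : m \in planes -> 0 < aff m (vec x) by exact: h.
do !split => /=; rewrite in_itv/=; apply/andP; split.
- by have := hp (mkaff (- xL D) 1 0 0); rewrite !inE eqxx aff_mkaff vec0 vec1 vec2 => /(_ erefl); lra.
- by have := hp (mkaff (xR D) (-1) 0 0); rewrite !inE eqxx ?orbT aff_mkaff vec0 vec1 vec2 => /(_ erefl); lra.
- by have := hp (mkaff (- yL D) 0 1 0); rewrite !inE eqxx ?orbT aff_mkaff vec0 vec1 vec2 => /(_ erefl); lra.
- by have := hp (mkaff (yR D) 0 (-1) 0); rewrite !inE eqxx ?orbT aff_mkaff vec0 vec1 vec2 => /(_ erefl); lra.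
- by have := hp (mkaff (- zL D) 0 0 1); rewrite !inE eqxx ?orbT aff_mkaff vec0 vec1 vec2 => /(_ erefl); lra.
- by have := hp (mkaff (zR D) 0 0 (-1)); rewrite !inE eqxx ?orbT aff_mkaff vec0 vec1 vec2 => /(_ erefl); lra.
Qed.

Lemma nondeg_vtx K : nondeg (vtx T K).
Proof. exact/nondegP/vtx_nondeg. Qed.
Hint Resolve nondeg_vtx : core.

Lemma simplex_dombar K x : simplex (vtx T K) x -> dombar D x.
Proof. by rewrite -(vtx_cover T) => h; exists K. Qed.

Lemma osimplexW (p : 'I_4 -> 'rV[R]_3) x : osimplex p x -> simplex p x.
Proof. by move=> [l [l0 l1 lx]]; exists l; split => // i; [exact: ltW|rewrite inE]. Qed.

(** These functions cut out [D] and all the elements; genericity is required for the whole finite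
    list at once. *)
Definition mesh_affs : seq 'cV[R]_(1 + 3) :=
  planes ++ [seq bcol (vtx T Lj.1) Lj.2 | Lj <- enum [set: 'I_(nel T) * 'I_4]].

Lemma bcol_mesh_affs L j : bcol (vtx T L) j \in mesh_affs.
Proof.
rewrite mem_cat; apply/orP; right; apply/mapP; exists (L, j) => //.
by rewrite mem_enum inE.
Qed.

Lemma plane_mesh_affs m : m \in planes -> m \in mesh_affs.
Proof. by rewrite mem_cat => ->. Qed.

Definition good_point K i st : Prop :=
  otri st /\ forall m, m \in mesh_affs -> generic_for (vtx T K) i st m.

Local Notation X K i st := (facechart (vtx T K) i st).

Lemma good_paired K L i st : K != L -> good_point K i st ->
  simplex (vtx T L) (pt (X K i st)) ->
  exists2 j, paired (vtx T K) i (vtx T L) j &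
    forall j', j' != j -> 0 < bary (vtx T L) j' (X K i st).
Proof.
move=> KL [ost g] h; apply: paired_of_generic => //; first exact: vtx_disj.
by move=> j; apply: g; exact: bcol_mesh_affs.
Qed.

Lemma good_beyond K L i st : K != L -> good_point K i st ->
  simplex (vtx T L) (pt (X K i st)) ->
  exists2 e0 : R, 0 < e0 < 1 & forall e, 0 < e <= e0 ->
    osimplex (vtx T L) (pt (X K i st + (- e) *: (vtx T K i - X K i st))).
Proof. by move=> KL gd h; have [j pj hj] := good_paired KL gd h; exact: paired_beyond pj hj. Qed.

(** Two neighbours would both contain the points just behind the face in their interiors. *)
Lemma good_unique K L L' i st : K != L -> K != L' -> good_point K i st ->
  simplex (vtx T L) (pt (X K i st)) -> simplex (vtx T L') (pt (X K i st)) -> L = L'.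
Proof.
move=> KL KL' gd h h'; apply/eqP/negP => /negP LL'.
have [e /andP[e0 e1] he] := good_beyond KL gd h.
have [e' /andP[e'0 e'1] he'] := good_beyond KL' gd h'.
have : (osimplex (vtx T L) `&` osimplex (vtx T L'))
    (pt (X K i st + (- Num.min e e') *: (vtx T K i - X K i st))).
  by split; [apply: he|apply: he']; rewrite lt_min e0 e'0 ge_min lexx ?orbT.
by rewrite vtx_disj.
Qed.

(** If a bounding plane of [D] passed through the point, its function would by genericity be a
    positive multiple of the barycentric coordinate [i] of [K]. It would then be negative just
    behind the face, where [L] still lies in the closure of [D]. *)
Lemma good_boundary K L i st : K != L -> good_point K i st ->
  simplex (vtx T L) (pt (X K i st)) -> dom D (pt (X K i st)).
Proof.
move=> KL gd h; apply: contrapT => nd.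
have xb : dombar D (pt (X K i st)) by exact: simplex_dombar h.
have [m mp m0] : exists2 m, m \in planes & aff m (X K i st) = 0.
  apply: contrapT => hn; apply: nd; apply/domP => m mp.
  rewrite lt_neqAle; move/dombarP : xb => /(_ m mp); rewrite ptK => ->; rewrite andbT eq_sym.
  by apply/eqP => m0; apply: hn; exists m.
have em := gd.2 _ (plane_mesh_affs mp) m0.
set c := aff _ _ in em.
have c0 : 0 <= c.
  have /dombarP : dombar D (pt (vtx T K i)).
    apply: (@simplex_dombar K); apply/simplexP => // j; rewrite ptK bary_vtx//.
  by move=> /(_ m mp); rewrite ptK.
have c_gt0 : 0 < c.
  rewrite lt_neqAle c0 andbT eq_sym; apply/eqP => c0'.
  by have := planes_neq0 mp; rewrite em c0' scale0r eqxx.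
have [e /andP[e0 e1] he] := good_beyond KL gd h.
have /he/osimplexW/simplex_dombar/dombarP/(_ m mp) : 0 < e <= e by rewrite e0 lexx.
by rewrite ptK em affZ -/(bary _ _ _) bary_out// leNgt mulrN oppr_lt0 mulr_gt0.
Qed.

(** If every other element misses the point, each has a negative barycentric coordinate there. A
    small step out of [K] keeps these signs and stays in [D], against the covering of the closure of
    [D]. *)
Lemma good_exists K i st : good_point K i st -> dom D (pt (X K i st)) ->
  exists2 L, K != L & simplex (vtx T L) (pt (X K i st)).
Proof.
move=> gd xd; apply: contrapT => hn.
have hL L : K != L -> exists j, bary (vtx T L) j (X K i st) < 0.
  move=> KL; apply: contrapT => /forallNP h; apply: hn; exists L => //.
  by apply/simplexP => // j; rewrite ptK leNgt; apply/negP/h.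
pose jL L := if pselect (exists j, bary (vtx T L) j (X K i st) < 0) is left h
  then xchoose h else ord0.
have jLP L : K != L -> bary (vtx T L) (jL L) (X K i st) < 0.
  move=> /hL h; rewrite /jL; case: pselect => // h'; exact: (xchooseP h').
pose ms := planes ++ [seq - 1 *: bcol (vtx T L) (jL L) | L <- enum 'I_(nel T) & K != L].
have [|e0 /andP[e00 e01] he] := @small_segment _ ms (X K i st) (vtx T K i).
  move=> m; rewrite mem_cat => /orP[mp|/mapP[L]].
    by move/domP : xd => /(_ m mp); rewrite ptK.
  by rewrite mem_filter => /andP[KL _] ->; rewrite affZ mulN1r oppr_gt0; exact: jLP.
set y := X K i st + (- e0) *: (vtx T K i - X K i st).
have hy m : m \in ms -> 0 < aff m y by apply: he; rewrite normrN ger0_norm// ltW.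
have : dombar D (pt y).
  by apply/dombarP => m mp; rewrite ptK ltW// hy// mem_cat mp.
rewrite -(vtx_cover T) => -[L _ /(simplexP _ (nondeg_vtx L)) hyL].
have [KL|KL] := eqVneq K L.
  by have := hyL i; rewrite -KL ptK bary_out// oppr_ge0 leNgt e00.
have := hyL (jL L); rewrite ptK leNgt -oppr_gt0 -mulN1r -affZ hy//.
by rewrite mem_cat; apply/orP; right; apply/mapP; exists L => //; rewrite mem_filter KL /= mem_enum.
Qed.

(** Exactly one of the indicators is 1: a point inside [D] has one further element, a point on the
    boundary none. *)
Lemma good_sum K i st : good_point K i st ->
  \sum_(L | K != L) \1_(simplex (vtx T L)) (pt (X K i st)) +
    \1_(dombar D `\` dom D) (pt (X K i st)) = 1 :> R.
Proof.
move=> gd; set x := pt _.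
have xb : dombar D x.
  by apply: (@simplex_dombar K); apply: facechart_simplex => //; apply: otri_subset; case: gd.
have [xd|xd] := pselect (dom D x).
  have [L KL xL] := good_exists gd xd.
  rewrite (bigD1 L)//= big1 => [|L' /andP[KL' LL']].
    rewrite !indicE (mem_set xL) memNset ?addr0//; by move=> [].
  rewrite indicE memNset// => xL'; move/eqP: LL'; apply.
  exact: good_unique gd xL' xL.
rewrite big1 => [|L KL]; first by rewrite indicE mem_set ?add0r.
by rewrite indicE memNset// => xL; apply: xd; exact: good_boundary gd xL.
Qed.

Lemma good_negligible K i : (@leb2 R).-negligible [set st | reftri st /\ ~ good_point K i st].
Proof.
have N1 := generic_negligible i mesh_affs (nondeg_vtx K).
have N2 : (@leb2 R).-negligible (@reftri R `\` @otri R).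
  exists (@reftri R `\` @otri R); split => //; last exact: reftriD_null.
  by apply: measurableD; [exact: measurable_reftri|exact: measurable_otri].
apply: negligibleS (negligibleU N1 N2) => st /= [h1 h2].
have [h|h] := pselect (otri st); last by right.
by left => h3; apply: h2.
Qed.

End MeshFaces.
#[global] Hint Resolve nondeg_vtx : core.

(** * Surface integrals *)

Section SurfaceIntegrals.
Context (R : realType).
Notation mR := (measurableTypeR R).
Implicit Types (p q : 'I_4 -> 'rV[R]_3) (x : R3 R) (i j : 'I_4) (st : mR * mR) (g h : R3 R -> R).

(** Measurable and bounded on bounded sets: an algebra of functions that contains polynomials and
    indicators and whose members are integrable on faces and square integrable on [D]. It replaces
    integrability proofs for individual integrands. *)
Definition lbm g : Prop := measurable_fun setT g /\ forall M : R, exists C : R,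
  forall x, `|x.1.1 : R| <= M -> `|x.1.2 : R| <= M -> `|x.2 : R| <= M -> `|g x| <= C.

Lemma lbm_cst (c : R) : lbm (fun=> c).
Proof. by split=> [|M]; [exact: measurable_cst|exists `|c|]. Qed.

Lemma lbm_coord (k : 'I_3) : lbm (fun x => vec x 0 k).
Proof.
split; last by move=> M; exists M => x h1 h2 h3; rewrite mxE; case: k => -[|[|[|//]]].
under eq_fun do rewrite mxE.
by case: k => -[|[|[|//]]] hk /=; do ?exact: measurable_snd; apply: measurableT_comp => //.
Qed.

Lemma lbmD g h : lbm g -> lbm h -> lbm (fun x => g x + h x).
Proof.
move=> [mg bg] [mh bh]; split=> [|M]; first exact: measurable_funD.
have [C hC] := bg M; have [C' hC'] := bh M.
by exists (C + C') => x h1 h2 h3; rewrite (le_trans (ler_normD _ _))// lerD ?hC ?hC'.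
Qed.

Lemma lbmM g h : lbm g -> lbm h -> lbm (fun x => g x * h x).
Proof.
move=> [mg bg] [mh bh]; split=> [|M]; first exact: measurable_funM.
have [C hC] := bg M; have [C' hC'] := bh M.
by exists (C * C') => x h1 h2 h3; rewrite normrM ler_pM ?normr_ge0 ?hC ?hC'.
Qed.

Lemma lbmN g : lbm g -> lbm (fun x => - g x).
Proof. by move=> /(lbmM (lbm_cst (-1))); under eq_fun do rewrite mulN1r. Qed.

Lemma lbmB g h : lbm g -> lbm h -> lbm (fun x => g x - h x).
Proof. by move=> lg lh; apply: lbmD => //; exact: lbmN. Qed.

Lemma lbm_sum (I : Type) (s : seq I) (P : pred I) (g : I -> R3 R -> R) :
  (forall k, lbm (g k)) -> lbm (fun x => \sum_(k <- s | P k) g k x).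
Proof.
move=> hg; elim: s => [|k s IH]; first by under eq_fun do rewrite big_nil; exact: lbm_cst.
have [Pk|/negbTE Pk] := boolP (P k); last by under eq_fun do rewrite big_cons Pk.
by under eq_fun do rewrite big_cons Pk; exact: lbmD.
Qed.

Definition lbmv n (F : R3 R -> 'rV[R]_n) : Prop := forall k, lbm (fun x => F x 0 k).

Lemma lbm_dot n (F G : R3 R -> 'rV[R]_n) : lbmv F -> lbmv G -> lbm (fun x => dot (F x) (G x)).
Proof. by move=> hF hG; apply: lbm_sum => k; exact: lbmM. Qed.

Lemma lbmv_cross (F G : R3 R -> 'rV[R]_3) : lbmv F -> lbmv G -> lbmv (fun x => cross (F x) (G x)).
Proof.
move=> hF hG k; under eq_fun do rewrite mxE.
by apply: lbmB; apply: lbmM; [exact: hF|exact: hG|exact: hF|exact: hG].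
Qed.

Lemma lbmv_cst n (v : 'rV[R]_n) : lbmv (fun=> v).
Proof. by move=> k; exact: lbm_cst. Qed.

Lemma lbmvD n (F G : R3 R -> 'rV[R]_n) : lbmv F -> lbmv G -> lbmv (fun x => F x + G x).
Proof. by move=> hF hG k; under eq_fun do rewrite mxE; exact: lbmD. Qed.

Lemma lbmvB n (F G : R3 R -> 'rV[R]_n) : lbmv F -> lbmv G -> lbmv (fun x => F x - G x).
Proof. by move=> hF hG k; under eq_fun do rewrite !mxE; exact: lbmB. Qed.

Lemma lbmv_polyval (c : 'M[R]_(1 + 3, 3 + 3)) : lbmv (polyval c).
Proof.
move=> k; under eq_fun do rewrite mxE; apply: lbm_sum => l; apply: lbmM; last exact: lbm_cst.
case: (split_ordP l) => k' ->; first by under eq_fun do rewrite row_mxEl; exact: lbm_cst.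
by under eq_fun do rewrite row_mxEr; exact: lbm_coord.
Qed.

Lemma lbmv_Epart (c : 'M[R]_(1 + 3, 3 + 3)) : lbmv (Epart c).
Proof. by move=> k; under eq_fun do rewrite mxE; exact: lbmv_polyval. Qed.

Lemma lbmv_Hpart (c : 'M[R]_(1 + 3, 3 + 3)) : lbmv (Hpart c).
Proof. by move=> k; under eq_fun do rewrite mxE; exact: lbmv_polyval. Qed.

Definition facept p i st : R3 R := pt (facechart p i st).

Lemma measurable_facept p i : measurable_fun setT (facept p i).
Proof.
have m k : measurable_fun setT (fun st => facechart p i st 0 k : mR).
  rewrite (_ : (fun st => _) = aff2 (facevtx p i 0 0 k) ((facevtx p i 1 - facevtx p i 0) 0 k)
     ((facevtx p i 2 - facevtx p i 0) 0 k)); first exact: measurable_aff2.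
  by apply/funext => st; rewrite /facechart /aff2 !mxE; ring.
by apply: measurable_fun_pair; [apply: measurable_fun_pair|]; exact: m.
Qed.

Lemma facept_bounded p i : exists M : R, forall st, @reftri R st ->
  [/\ `|(facept p i st).1.1 : R| <= M, `|(facept p i st).1.2 : R| <= M & `|(facept p i st).2 : R| <= M].
Proof.
have H k : exists M : R, forall st, @reftri R st -> `|facechart p i st 0 k| <= M.
  exists (`|facevtx p i 0 0 k| + `|(facevtx p i 1 - facevtx p i 0) 0 k| + `|(facevtx p i 2 - facevtx p i 0) 0 k|).
  move=> st [h1 h2 h3]; rewrite /facechart mxE [X in X + _]mxE.
  do 2! (apply: (le_trans (ler_normD _ _)); apply: lerD;
    last by rewrite mxE normrM ler_piMl// ger0_norm//; lra).
  by [].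
have [M0 h0] := H 0; have [M1 h1] := H 1; have [M2 h2] := H 2.
exists (Num.max M0 (Num.max M1 M2)) => st hst.
by split; rewrite /= !le_max ?h0 ?h1 ?h2 ?orbT.
Qed.

Lemma surf_integrable p i (B : set (R3 R)) g : measurable B -> lbm g ->
  (@leb2 R).-integrable (@reftri R) (EFin \o (fun st => \1_B (facept p i st) * g (facept p i st))).
Proof.
move=> mB [mg bg]; have mX := measurable_facept p i.
apply: measurable_bounded_integrable; [exact: measurable_reftri|exact: leb2_reftri_fin| |].
  apply: measurable_funTS; apply: measurable_funM; last exact: (measurableT_comp mg mX).
  apply: (measurableT_comp _ mX); exact: measurable_indic.
have [M hM] := facept_bounded p i; have [C hC] := bg M.
exists C; split; first by rewrite num_real.
move=> C' CC' st hst; apply: le_trans (ltW CC').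
have [h1 h2 h3] := hM st hst.
rewrite normrM (le_trans _ (hC _ h1 h2 h3))// ler_piMl//.
by rewrite indicE ger0_norm// lern1; case: (_ \in _).
Qed.

Lemma surfintE p i B g : surfint p i B g =
  enorm (areavec p i) * \int[@leb2 R]_(st in @reftri R) (\1_B (facept p i st) * g (facept p i st)).
Proof. by []. Qed.

Lemma eq_surfint p i B g h : g =1 h -> surfint p i B g = surfint p i B h.
Proof. by move=> /funext ->. Qed.

Lemma surfintD p i B g h : measurable B -> lbm g -> lbm h ->
  surfint p i B (fun x => g x + h x) = surfint p i B g + surfint p i B h.
Proof.
move=> mB lg lh; rewrite !surfintE -mulrDr -RintegralD; [|exact: measurable_reftri|exact: surf_integrable..].
by congr (_ * _); apply: eq_Rintegral => st _; rewrite mulrDr.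
Qed.

Lemma surfintZ p i B c g : measurable B -> lbm g ->
  surfint p i B (fun x => c * g x) = c * surfint p i B g.
Proof.
move=> mB lg; rewrite !surfintE mulrCA; congr (_ * _).
rewrite -RintegralZl; [|exact: measurable_reftri|exact: surf_integrable].
by apply: eq_Rintegral => st _; rewrite mulrCA.
Qed.

Lemma surfintN p i B g : measurable B -> lbm g ->
  surfint p i B (fun x => - g x) = - surfint p i B g.
Proof.
by move=> mB lg; rewrite -mulN1r -surfintZ//; apply: eq_surfint => x; rewrite mulN1r.
Qed.

Lemma surfintB p i B g h : measurable B -> lbm g -> lbm h ->
  surfint p i B (fun x => g x - h x) = surfint p i B g - surfint p i B h.
Proof. by move=> mB lg lh; rewrite surfintD ?surfintN//; exact: lbmN. Qed.

Lemma le_surfint p i B g h : measurable B -> lbm g -> lbm h -> (forall x, g x <= h x) ->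
  surfint p i B g <= surfint p i B h.
Proof.
move=> mB lg lh gh; rewrite !surfintE ler_wpM2l ?enorm_ge0//.
apply: le_Rintegral; [exact: measurable_reftri|exact: surf_integrable..|].
by move=> st _; rewrite ler_wpM2l.
Qed.

Lemma Rintegral_ae_reftri (f1 f2 : mR * mR -> R) :
  (@leb2 R).-integrable (@reftri R) (EFin \o f1) -> (@leb2 R).-integrable (@reftri R) (EFin \o f2) ->
  (@leb2 R).-negligible [set st | @reftri R st /\ f1 st <> f2 st] ->
  \int[@leb2 R]_(st in @reftri R) f1 st = \int[@leb2 R]_(st in @reftri R) f2 st.
Proof.
move=> i1 i2 N; congr fine; apply: ae_eq_integral.
- exact: measurable_reftri.
- exact: measurable_int i1.
- exact: measurable_int i2.
- apply: negligibleS N => st /= h; split.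
    by apply: contrapT => h'; apply: h => /h'.
  by move=> h'; apply: h => _ /=; rewrite h'.
Qed.

Definition facesign p i : R := dot (areavec p i) (p i - facevtx p i 0).

(** Both sides are affine in [v] and vanish on the face; at [p i] they agree by the definition of
    [facesign]. *)
Lemma dot_areavec p i v : nondeg p ->
  dot (areavec p i) (v - facevtx p i 0) = facesign p i * bary p i v.
Proof.
move=> np; have [s1 e] := bary_comb v np.
have -> : v - facevtx p i 0 = \sum_k bary p k v *: (p k - facevtx p i 0).
  by under eq_bigr do rewrite scalerBr; rewrite sumrB -e -scaler_suml s1 scale1r.
rewrite dot_sumr (bigD1_ord i)//= dotZr big1 ?addr0 1?mulrC// => k _.
rewrite dotZr; apply/eqP; rewrite mulf_eq0; apply/orP; right.
rewrite -[p (lift i k)]/(facevtx p i k).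
case: k => -[|[|[|//]]] hk; apply/eqP.
- by rewrite (_ : Ordinal hk = 0) ?subrr; [rewrite dot3 !mxE; ring|apply: val_inj].
- by rewrite (_ : Ordinal hk = 1); [rewrite dot3 !crossE; ring|apply: val_inj].
- by rewrite (_ : Ordinal hk = 2); [rewrite dot3 !crossE; ring|apply: val_inj].
Qed.

Lemma facechart_inj p i st st' : nondeg p -> facechart p i st = facechart p i st' -> st = st'.
Proof.
move=> np e; have := (bary_face_lift i st 1 np, bary_face_lift i st 2 np).
rewrite e !bary_face_lift//= => -[h1 h2]; case: st st' h1 h2 {e} => s t [s' t'] /= -> ->.
by [].
Qed.

Lemma areavec_neq0 p i : nondeg p -> areavec p i != 0.
Proof.
move=> np; apply/eqP => A0.
pose E1 := facevtx p i 1 - facevtx p i 0; pose E2 := facevtx p i 2 - facevtx p i 0.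
(* Up to sign the combination is the cross product of the first edge with the area vector. If the
   latter vanishes, the edges are dependent, which contradicts the injectivity of the chart. *)
have e12 : (- dot E1 E2) *: E1 + dot E1 E1 *: E2 = 0.
  have -> : (- dot E1 E2) *: E1 + dot E1 E1 *: E2 = - cross E1 (areavec p i).
    rewrite /areavec -/E1 -/E2; apply: rV3P; rewrite 2![in LHS]mxE [X in _ + X]mxE [RHS]mxE !crossE !dot3; ring.
  rewrite A0; apply: rV3P; rewrite mxE crossE !mxE; ring.
have h0 : facechart p i (0, 0) = facevtx p i 0 by rewrite /facechart /= !scale0r !addr0.
have : facechart p i (- dot E1 E2, dot E1 E1) = facechart p i (0, 0).
  by rewrite h0 /facechart /= -/E1 -/E2 -addrA e12 addr0.
move=> /(facechart_inj np)[_ /dot_eq0 E10].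
have : facechart p i (1, 0) = facechart p i (0, 0).
  by rewrite h0 /facechart /= -/E1 E10 scaler0 scale0r !addr0.
by move=> /(facechart_inj np)[/eqP]; rewrite oner_eq0.
Qed.

Lemma facesign_neq0 p i : nondeg p -> facesign p i != 0.
Proof.
move=> np; apply/eqP => s0; have := dot_areavec i (facevtx p i 0 + areavec p i) np.
rewrite s0 mul0r addrAC subrr add0r => /dot_eq0/eqP.
by rewrite (negbTE (areavec_neq0 i np)).
Qed.

Lemma facechart_simplexE p i st : nondeg p -> simplex p (facept p i st) <-> reftri st.
Proof.
move=> np; split; last exact: facechart_simplex.
move=> /(simplexP _ np) h; have := (h (lift i 0), h (lift i 1), h (lift i 2)).
by rewrite ptK !bary_face_lift//= => -[[h0 h1] h2]; split=> //; lra.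
Qed.

End SurfaceIntegrals.

(** * Dissipativity of the discrete Maxwell operator *)

Section Symmetry.
Context (R : realType).
Notation mR := (measurableTypeR R).
Implicit Types (p q : 'I_4 -> 'rV[R]_3) (x : R3 R) (i j : 'I_4) (st : mR * mR) (g h : R3 R -> R).

Lemma paired_facevtx p q i j k : nondeg p -> nondeg q -> paired p i q j ->
  bary p i (facevtx q j k) = 0.
Proof.
move=> np nq [c c0 e].
have : bary q j (facevtx q j k) = 0.
  by rewrite bary_facevtx// eq_sym (negbTE (neq_lift _ _)).
by rewrite /bary e affZ => /eqP; rewrite mulf_eq0 (lt_eqF c0) => /eqP.
Qed.

(** Transition from the chart of face [j] of [q] to that of face [i] of [p]. It is defined on the
    whole parameter plane, not only where the faces overlap. *)
Definition face_change p i q j st : mR * mR :=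
  (bary p (lift i 1) (facechart q j st), bary p (lift i 2) (facechart q j st)).

Lemma face_changeP p i q j st : nondeg p -> nondeg q -> paired p i q j ->
  facechart p i (face_change p i q j st) = facechart q j st.
Proof.
move=> np nq [c c0 e]; symmetry; apply: on_face => //.
have := bary_face j st nq.
by rewrite /bary e affZ => /eqP; rewrite mulf_eq0 (lt_eqF c0) => /eqP.
Qed.

(** The transition is affine, and its determinant is the ratio of the area vectors: the edges of one
    face are combinations of the edges of the other, and their cross product scales with the
    determinant. *)
Lemma paired_change p i q j : nondeg p -> nondeg q -> paired p i q j ->
  exists2 c : R, areavec q j = c *: areavec p i /\ c != 0 &
    cov (@leb2 R) `|c| (face_change p i q j).
Proof.
move=> np nq pr.
pose al (k : 'I_3) v := bary p (lift i k) v; pose P k := facevtx q j k.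
pose a := al 1 (P 1) - al 1 (P 0); pose b := al 1 (P 2) - al 1 (P 0).
pose c := al 2 (P 1) - al 2 (P 0); pose e := al 2 (P 2) - al 2 (P 0).
pose E1 := facevtx p i 1 - facevtx p i 0; pose E2 := facevtx p i 2 - facevtx p i 0.
have PE k : P k = facevtx p i 0 + al 1 (P k) *: E1 + al 2 (P k) *: E2.
  by rewrite [LHS](on_face np (paired_facevtx k np nq pr)).
have AE : areavec q j = (a * e - b * c) *: areavec p i.
  have e1 : P 1 - P 0 = a *: E1 + c *: E2.
    etransitivity; first exact: (congr2 (fun u v : 'rV[R]_3 => u - v) (PE 1) (PE 0)).
    by rewrite /a /c; apply: rV3P; rewrite !mxE; ring.
  have e2 : P 2 - P 0 = b *: E1 + e *: E2.
    etransitivity; first exact: (congr2 (fun u v : 'rV[R]_3 => u - v) (PE 2) (PE 0)).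
    by rewrite /b /e; apply: rV3P; rewrite !mxE; ring.
  rewrite /areavec -!/(P _) e1 e2.
  rewrite -/E1 -/E2; clear e1 e2 PE; move: E1 E2 => F1 F2; move: a b c e => a' b' c' e'.
  by apply: rV3P; rewrite [RHS]mxE !crossE !mxE; ring.
have d0 : a * e - b * c != 0.
  by apply: contraTneq (areavec_neq0 j nq) => d0; rewrite AE d0 scale0r eqxx.
exists (a * e - b * c) => //.
apply: (cov_eq _ (cov_affine2 (al 1 (P 0)) (al 2 (P 0)) d0)) => st.
rewrite /face_change /bary !aff_facechart /aff2 -!/(bary _ _ _) -/(P _) -!/(al _ _).
by congr pair; rewrite /a /b /c /e; ring.
Qed.

(** One integrand is restricted to the triangle of [p] and to [q]; under the transition of charts
    these two restrictions exchange roles, and the Jacobian absorbs the ratio of the areas. *)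
Lemma paired_surfint p i q j g : nondeg p -> nondeg q -> paired p i q j -> lbm g ->
  surfint p i (simplex q) g = surfint q j (simplex p) g.
Proof.
move=> np nq pr lg; have [c [AE c0] cv] := paired_change np nq pr.
have mq := measurable_simplex nq; have mp := measurable_simplex np.
rewrite !surfintE AE enormZ [`|c| * _]mulrC -mulrA; congr (_ * _); rewrite Rintegral_mkcond.
have mT := @measurable_reftri R.
have iq := surf_integrable q j mp lg; have ip := surf_integrable p i mq lg.
have E st : ((fun st => \1_(simplex q) (facept p i st) * g (facept p i st)) \_ (@reftri R))
      (face_change p i q j st) =
    ((fun st => \1_(simplex p) (facept q j st) * g (facept q j st)) \_ (@reftri R)) st.
  rewrite !patchE.
  have e : facept p i (face_change p i q j st) = facept q j st.
    by rewrite /facept face_changeP.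
  have -> : (face_change p i q j st \in @reftri R) = (facept q j st \in simplex p).
    by apply/idP/idP; rewrite !inE -e => /(facechart_simplexE _ _ np).
  have -> : (st \in @reftri R) = (facept q j st \in simplex q).
    by apply/idP/idP; rewrite !inE => /(facechart_simplexE _ _ nq).
  rewrite e !indicE; by do 2!case: (_ \in _) => //=; rewrite ?mul0r.
rewrite (cov_Rintegral cv); first last.
- under eq_fun do rewrite E.
  have /(integrable_mkcond _ mT) := iq.
  by rewrite restrict_EFin.
- apply/(measurable_restrictT _ mT).
  by have := measurable_int _ ip; move/measurable_EFinP.
congr (_ * _); rewrite [RHS]Rintegral_mkcond.
by apply: eq_Rintegral => st _; exact: E.
Qed.

(** The area vectors may be parallel or antiparallel, depending on the order of the vertices. The
    sign of [c] cancels against the one in [facesign], and the negative factor between the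
    barycentric coordinates remains. *)
Lemma paired_outnormal p i q j : nondeg p -> nondeg q -> paired p i q j ->
  outnormal q j = - outnormal p i.
Proof.
move=> np nq pr; have [c [AE c0] _] := paired_change np nq pr.
have [c' c'0 e'] := pr.
have A0 : enorm (areavec p i) != 0.
  by apply: contra_neq (areavec_neq0 i np) => /enorm_eq0.
have key : facesign q j = c * facesign p i * c'^-1.
  rewrite [facesign q j]/facesign AE dotZl -mulrA; congr (_ * _).
  have -> : q j - facevtx q j 0 = (q j - facevtx p i 0) - (facevtx q j 0 - facevtx p i 0).
    by rewrite opprB addrA subrK.
  rewrite dotBr !dot_areavec// paired_facevtx// mulr0 subr0; congr (_ * _).
  have : bary q j (q j) = 1 by rewrite bary_vtx// eqxx.
  rewrite /bary e' affZ => h; apply: (mulfI (ltr0_neq0 c'0)).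
  by rewrite h mulfV// ltr0_neq0.
rewrite /outnormal -/(facesign q j) -/(facesign p i) key AE enormZ !sgrM sgrV (ltr0_sg c'0).
rewrite scalerA -[RHS]scaleNr; congr (_ *: _).
rewrite [X in _ * X = _](numEsg c).
have n0 : `|c| != 0 by rewrite normr_eq0.
have s2 : Num.sg c * Num.sg c = 1 by rewrite -expr2 sqr_sg c0.
transitivity ((Num.sg c * Num.sg c) * (Num.sg (facesign p i) / enorm (areavec p i))).
  by field; rewrite A0 n0.
by rewrite s2; ring.
Qed.

End Symmetry.

(** * The divergence theorem on a tetrahedron *)

Section Divergence.
Context (R : realType).
Notation mR := (measurableTypeR R).
Implicit Types (p : 'I_4 -> 'rV[R]_3) (x : R3 R) (i j : 'I_4) (st : mR * mR).
Implicit Types (n h : 'M[R]_(1 + 3, 3)) (u v w : 'rV[R]_3) (m : 'cV[R]_(1 + 3)).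

Definition afield n u : 'rV[R]_3 := ext1 u *m n.

Definition ddir n u : 'rV[R]_3 := u *m dsubmx n.

Definition curlm n : 'rV[R]_3 :=
  \row_k (dsubmx n (k + 1) (k + 2) - dsubmx n (k + 2) (k + 1)).

Lemma afieldD n u v : afield n (u + v) = afield n u + ddir n v.
Proof.
rewrite /afield /ddir /ext1 -[n in LHS]vsubmxK -[n in X in _ = X + _]vsubmxK !mul_row_col.
by rewrite mulmxDl addrA.
Qed.

Lemma ddirZ n c u : ddir n (c *: u) = c *: ddir n u.
Proof. by rewrite /ddir scalemxAl. Qed.

Lemma ddirB n u v : ddir n (u - v) = ddir n u - ddir n v.
Proof. by rewrite /ddir mulmxBl. Qed.

Lemma afield_aff n u (j : 'I_3) : afield n u 0 j = aff (col j n) u.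
Proof. by rewrite /afield /aff [LHS]mxE [RHS]mxE; apply: eq_bigr => k _; rewrite [col _ _ _ _]mxE. Qed.

Lemma Epart_afield c x : Epart c x = afield (lsubmx c) (vec x).
Proof.
by apply/rowP => k; rewrite /Epart /polyval /afield /ext1 !mxE; apply: eq_bigr => l _; rewrite [lsubmx _ _ _]mxE.
Qed.

Lemma Hpart_afield c x : Hpart c x = afield (rsubmx c) (vec x).
Proof.
by apply/rowP => k; rewrite /Hpart /polyval /afield /ext1 !mxE; apply: eq_bigr => l _; rewrite [rsubmx _ _ _]mxE.
Qed.

Lemma pd_aff m (k : 'I_3) x : pd k (fun y => aff m (vec y)) x = m (rshift 1 k) 0.
Proof.
rewrite /pd /derive; apply: cvg_lim => //.
apply: (cvg_trans _ (@cvg_cst _ (m (rshift 1 k) 0 : R^o) _ (0 : R)^' _)).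
apply: near_eq_cvg; near=> h.
have h0 : h != 0 by near: h; exact: nbhs_dnbhs_neq.
rewrite /= /cst; apply/(scalerI h0); rewrite scalerA mulfV// scale1r.
rewrite !affE !vec0 !vec1 !vec2 /= !mxE /=.
case: k => -[|[|[|//]]] hk; rewrite -?val_eqE /= ?mulr1n ?mulr0n.
- rewrite (_ : rshift 1 (Ordinal hk) = rshift 1 0); last exact: val_inj.
  by rewrite /GRing.scale/= ; ring.
- rewrite (_ : rshift 1 (Ordinal hk) = rshift 1 1); last exact: val_inj.
  by rewrite /GRing.scale/= ; ring.
- rewrite (_ : rshift 1 (Ordinal hk) = rshift 1 2); last exact: val_inj.
  by rewrite /GRing.scale/= ; ring.
Unshelve. all: by end_near. Qed.

Lemma curl_afield n x : curl (fun y => afield n (vec y)) x = curlm n.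
Proof.
apply/rowP => k; rewrite !mxE.
under [fun y => _]eq_fun do rewrite afield_aff.
under [X in _ - pd _ X _ = _]eq_fun do rewrite afield_aff.
by rewrite !pd_aff !mxE.
Qed.

Lemma ddir3 n u k : ddir n u 0 k = u 0 0 * dsubmx n 0 k + u 0 1 * dsubmx n 1 k + u 0 2 * dsubmx n 2 k.
Proof. by rewrite mxE big_ord3. Qed.

Lemma curlm0 n : curlm n 0 0 = dsubmx n 1 2 - dsubmx n 2 1.
Proof. by rewrite mxE; congr (dsubmx n _ _ - dsubmx n _ _); apply: val_inj. Qed.
Lemma curlm1 n : curlm n 0 1 = dsubmx n 2 0 - dsubmx n 0 2.
Proof. by rewrite mxE; congr (dsubmx n _ _ - dsubmx n _ _); apply: val_inj. Qed.
Lemma curlm2 n : curlm n 0 2 = dsubmx n 0 1 - dsubmx n 1 0.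
Proof. by rewrite mxE; congr (dsubmx n _ _ - dsubmx n _ _); apply: val_inj. Qed.

(* The curl is the sum of g_i x (d/da_i) over a basis a_i with dual basis g_i. *)
Lemma curlm_basis n (a b c : 'rV[R]_3) : dot a (cross b c) *: curlm n =
  cross (cross b c) (ddir n a) + cross (cross c a) (ddir n b) + cross (cross a b) (ddir n c).
Proof.
have hL k : (dot a (cross b c) *: curlm n) 0 k = dot a (cross b c) * curlm n 0 k by rewrite mxE.
have hR (u v w : 'rV[R]_3) k : (u + v + w) 0 k = u 0 k + v 0 k + w 0 k by rewrite !mxE.
apply: rV3P; rewrite hL hR ?curlm0 ?curlm1 ?curlm2 dot3 !crossE !ddir3;
  move: (dsubmx n) => G; ring.
Qed.

Definition tetchart p x : R3 R := pt (p 0 + (x.1.1 : R) *: (p 1 - p 0)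
  + (x.1.2 : R) *: (p 2 - p 0) + (x.2 : R) *: (p 3 - p 0)).

Definition tetdet p : R := dot (p 1 - p 0) (cross (p 2 - p 0) (p 3 - p 0)).

Lemma cov_tetchart p : tetdet p != 0 -> cov (@leb3 R) `|tetdet p| (tetchart p).
Proof.
set a := p 1 - p 0; set b := p 2 - p 0; set c := p 3 - p 0 => d0.
have e : tetdet p = a 0 0 * (b 0 1 * c 0 2 - c 0 1 * b 0 2) - b 0 0 * (a 0 1 * c 0 2 - c 0 1 * a 0 2)
   + c 0 0 * (a 0 1 * b 0 2 - b 0 1 * a 0 2).
  by rewrite /tetdet -/a -/b -/c dot3 !crossE; ring.
have tE x : tetchart p x = pt (p 0 + (x.1.1 : R) *: a + (x.1.2 : R) *: b + (x.2 : R) *: c) by [].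
rewrite e in d0 *.
apply: (cov_eq _ (cov_affine3 (p 0 0 0) (p 0 0 1) (p 0 0 2) d0)) => x.
by rewrite tE; clearbody a b c; rewrite /pt; congr (_, _, _); rewrite !mxE; ring.
Qed.

Lemma facevtxE p : [/\ [/\ facevtx p 0 0 = p 1, facevtx p 0 1 = p 2 & facevtx p 0 2 = p 3],
   [/\ facevtx p 1 0 = p 0, facevtx p 1 1 = p 2 & facevtx p 1 2 = p 3],
   [/\ facevtx p 2 0 = p 0, facevtx p 2 1 = p 1 & facevtx p 2 2 = p 3] &
   [/\ facevtx p 3 0 = p 0, facevtx p 3 1 = p 1 & facevtx p 3 2 = p 2]].
Proof. by do !split; rewrite /facevtx; congr p; apply: val_inj. Qed.

(** The orientation of an area vector follows the order of the remaining vertices, not the outward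
    direction. This explains the sign of [areavec p 2] and the alternating signs in [facesignE]. *)
Lemma areavecE p : let a := p 1 - p 0 in let b := p 2 - p 0 in let c := p 3 - p 0 in
  [/\ areavec p 0 = cross b c + cross c a + cross a b,
      areavec p 1 = cross b c, areavec p 2 = - cross c a & areavec p 3 = cross a b].
Proof.
move=> a b c; have [[e1 e2 e3] [e4 e5 e6] [e7 e8 e9] [e10 e11 e12]] := facevtxE p.
have hp : p 2 - p 1 = b - a /\ p 3 - p 1 = c - a by rewrite /a /b /c; split; apply: rV3P; rewrite !mxE; ring.
have [-> ->] : areavec p 0 = cross (b - a) (c - a) /\ areavec p 2 = cross a c.
  by rewrite /areavec e1 e2 e3 e7 e8 e9 hp.1 hp.2.
rewrite /areavec e4 e5 e6 e10 e11 e12 -/a -/b -/c; split => //.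
  clear hp; clearbody a b c.
  have hR (u v w : 'rV[R]_3) k : (u + v + w) 0 k = u 0 k + v 0 k + w 0 k by rewrite !mxE.
  by apply: rV3P; rewrite [RHS]hR !crossE !mxE; ring.
clear hp; clearbody a b c.
by apply: rV3P; rewrite [RHS]mxE !crossE; ring.
Qed.

Lemma facesignE p : [/\ facesign p 0 = - tetdet p, facesign p 1 = tetdet p,
  facesign p 2 = - tetdet p & facesign p 3 = tetdet p].
Proof.
have [A0 A1 A2 A3] := areavecE p.
have [[e1 e2 e3] [e4 e5 e6] [e7 e8 e9] [e10 e11 e12]] := facevtxE p.
rewrite /facesign A0 A1 A2 A3 e1 e4 e7 e10 /tetdet.
have -> : p 0 - p 1 = - (p 1 - p 0) by rewrite opprB.
move: (p 1 - p 0) (p 2 - p 0) (p 3 - p 0) => a b c.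
have hR (u v w : 'rV[R]_3) k : (u + v + w) 0 k = u 0 k + v 0 k + w 0 k by rewrite !mxE.
split; rewrite ?dotNl ?dotNr; [congr (- _)| |congr (- _)|];
  rewrite [LHS]dot3 [RHS]dot3 ?hR !crossE; ring.
Qed.

Lemma tetdet_neq0 p : nondeg p -> tetdet p != 0.
Proof. by move=> np; have [_ <- _ _] := facesignE p; exact: facesign_neq0. Qed.

Lemma tetchart_osimplex p x : nondeg p -> osimplex p (tetchart p x) <-> otet x.
Proof.
move=> np; have s4 (f : 'I_4 -> R) : \sum_i f i = f 0 + f 1 + f 2 + f 3.
  by rewrite !big_ord_recl big_ord0 addr0 !addrA; congr (f _ + f _ + f _ + f _); apply: val_inj.
have s4v (f : 'I_4 -> 'rV[R]_3) : \sum_i f i = f 0 + f 1 + f 2 + f 3.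
  by rewrite !big_ord_recl big_ord0 addr0 !addrA; congr (f _ + f _ + f _ + f _); apply: val_inj.
pose l (i : 'I_4) : R := nth 0 [:: 1 - x.1.1 - x.1.2 - x.2; (x.1.1 : R); (x.1.2 : R); (x.2 : R)] i.
have lE i : bary p i (vec (tetchart p x)) = l i.
  apply: bary_uniq => //; first by rewrite s4 /l /=; ring.
  by rewrite ptK s4v /l /=; apply: rV3P; rewrite !mxE; ring.
split.
  move=> /(osimplexP _ np) h; have := (lE 0, lE 1, lE 2, lE 3); rewrite /l /= => -[[[h0 h1] h2] h3].
  have := (h 0, h 1, h 2, h 3); rewrite h0 h1 h2 h3 => -[[[k0 k1] k2] k3]; split => //; lra.
move=> [h1 h2 h3 h4]; apply/osimplexP => // i; rewrite lE /l.
by case: i => -[|[|[|[|//]]]] hi /=; lra.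
Qed.

Lemma integral_osimplex p n w : nondeg p ->
  \int[@leb3 R]_(x in osimplex p) dot w (afield n (vec x)) =
  `|tetdet p| * (dot w (afield n (p 0)) / 6 + (dot w (ddir n (p 1 - p 0))
     + dot w (ddir n (p 2 - p 0)) + dot w (ddir n (p 3 - p 0))) / 24).
Proof.
move=> np; have d0 := tetdet_neq0 np.
set A := dot w (afield n (p 0)); set B := dot _ (ddir n (p 1 - _)).
set C := dot _ (ddir n (p 2 - _)); set E := dot _ (ddir n (p 3 - _)).
have mo := measurable_osimplex np.
have F x : ((fun x => dot w (afield n (vec x))) \_ (osimplex p)) (tetchart p x) = (aff3 A B C E \_ (@otet R)) x.
  rewrite !patchE.
  have -> : (tetchart p x \in osimplex p) = (x \in @otet R).
    by apply/idP/idP; rewrite !inE => /tetchart_osimplex; apply.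
  case: ifP => // _; rewrite ptK !afieldD !ddirZ !dotDr !dotZr /aff3 -/A -/B -/C -/E; ring.
rewrite Rintegral_mkcond (cov_Rintegral (cov_tetchart d0)); first last.
- under eq_fun do rewrite F.
  have /(integrable_mkcond _ (@measurable_otet R)) := aff3_integrable A B C E.
  by rewrite restrict_EFin.
- apply/(measurable_restrictT _ mo); apply: measurable_funTS.
  have [] // : lbm (fun x => dot w (afield n (vec x))).
  apply: lbm_dot; first exact: lbmv_cst.
  move=> k; under eq_fun do rewrite afield_aff affE; do !apply: lbmD; do ?apply: lbmM; try exact: lbm_cst;
    exact: lbm_coord.
congr (_ * _); under eq_Rintegral do rewrite F.
by rewrite -Rintegral_mkcond integral_aff3.
Qed.

(** Integral over the reference triangle of the triple product of [u] with two fields that are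
    affine in the chart: values [h0], [e0] at the first vertex, increments [h1], [h2], [e1], [e2]
    along the edges. The weights 1/2, 1/6, 1/12, 1/24 are the moments of the triangle. *)
Definition triquad (u h0 h1 h2 e0 e1 e2 : 'rV[R]_3) : R :=
  let B (h e : 'rV[R]_3) := dot u (cross h e) in
  B h0 e0 / 2 + (B h1 e0 + B h0 e1 + (B h2 e0 + B h0 e2)) / 6 + (B h1 e1 + B h2 e2) / 12
   + (B h1 e2 + B h2 e1) / 24.

Lemma surfint_normal p i (h n : 'M[R]_(1 + 3, 3)) : nondeg p ->
  let f k := facevtx p i k in
  surfint p i setT (fun x => dot (outnormal p i) (cross (afield h (vec x)) (afield n (vec x)))) =
  - Num.sg (facesign p i) * triquad (areavec p i)
    (afield h (f 0)) (ddir h (f 1 - f 0)) (ddir h (f 2 - f 0))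
    (afield n (f 0)) (ddir n (f 1 - f 0)) (ddir n (f 2 - f 0)).
Proof.
move=> np f.
have A0 : enorm (areavec p i) != 0 by apply: contra_neq (areavec_neq0 i np) => /enorm_eq0.
rewrite surfintE /outnormal -/(facesign p i).
set h0 := afield h _; set h1 := ddir h _; set h2 := ddir h _.
set e0 := afield n _; set e1 := ddir n _; set e2 := ddir n _.
pose B (h e : 'rV[R]_3) := dot (areavec p i) (cross h e).
pose k := - (Num.sg (facesign p i) / enorm (areavec p i)).
transitivity (enorm (areavec p i) * \int[@leb2 R]_(st in @reftri R)
  quad2 (k * B h0 e0) (k * (B h1 e0 + B h0 e1)) (k * (B h2 e0 + B h0 e2)) (k * B h1 e1)
   (k * (B h1 e2 + B h2 e1)) (k * B h2 e2) st).
  congr (_ * _); apply: eq_Rintegral => st _.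
  rewrite indicT mul1r dotZl -/k ptK /facechart !afieldD !ddirZ -/(f 0) -/(f 1) -/(f 2).
  rewrite -/h0 -/h1 -/h2 -/e0 -/e1 -/e2 /quad2 /B.
  clearbody k h0 h1 h2 e0 e1 e2.
  have hR (u v w : 'rV[R]_3) (s t : R) l : (u + s *: v + t *: w) 0 l = u 0 l + s * v 0 l + t * w 0 l.
    by rewrite !mxE.
  rewrite !dot3 !crossE !hR; ring.
rewrite integral_quad2 /triquad -!/(B _ _) /k; by field.
Qed.

(** The divergence theorem for two affine fields as pure algebra: all terms are expanded into triple
    products, and antisymmetry brings equal ones to the same order. [n1], [n2], [n3] stand for the
    cross products of the edges at one vertex; the opposite face has their sum as area vector. *)
Lemma divergence_identity (n1 n2 n3 h0 ha hb hc e0 ea eb ec : 'rV[R]_3) :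
  triquad (n1 + n2 + n3) (h0 + ha) (hb - ha) (hc - ha) (e0 + ea) (eb - ea) (ec - ea)
  - triquad n1 h0 hb hc e0 eb ec + triquad (- n2) h0 ha hc e0 ea ec - triquad n3 h0 ha hb e0 ea eb =
  (dot (cross n1 ha + cross n2 hb + cross n3 hc) e0 / 6
    + (dot (cross n1 ha + cross n2 hb + cross n3 hc) ea
       + dot (cross n1 ha + cross n2 hb + cross n3 hc) eb
       + dot (cross n1 ha + cross n2 hb + cross n3 hc) ec) / 24)
  - (dot (cross n1 ea + cross n2 eb + cross n3 ec) h0 / 6
    + (dot (cross n1 ea + cross n2 eb + cross n3 ec) ha
       + dot (cross n1 ea + cross n2 eb + cross n3 ec) hb
       + dot (cross n1 ea + cross n2 eb + cross n3 ec) hc) / 24).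
Proof.
pose B (u h e : 'rV[R]_3) : R := dot u (cross h e).
have BA (u h e : 'rV[R]_3) : dot (cross u h) e = B u h e by rewrite dot_crossl.
have Bs (u h e : 'rV[R]_3) : B u e h = - B u h e by rewrite /B !dot3 !crossE; ring.
have BD1 (u v h e : 'rV[R]_3) : B (u + v) h e = B u h e + B v h e by rewrite /B dotDl.
have BN1 (u h e : 'rV[R]_3) : B (- u) h e = - B u h e by rewrite /B dotNl.
have BD2 (u h k e : 'rV[R]_3) : B u (h + k) e = B u h e + B u k e.
  by rewrite /B !dot3 !crossE !mxE; ring.
have BN2 (u h e : 'rV[R]_3) : B u (- h) e = - B u h e by rewrite /B !dot3 !crossE !mxE; ring.
have BD3 (u h e k : 'rV[R]_3) : B u h (e + k) = B u h e + B u h k.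
  by rewrite /B !dot3 !crossE !mxE; ring.
have BN3 (u h e : 'rV[R]_3) : B u h (- e) = - B u h e by rewrite /B !dot3 !crossE !mxE; ring.
rewrite /triquad -!/(B _ _ _) !dotDl !BA !(BD1, BN1, BD2, BN2, BD3, BN3).
rewrite ?(Bs _ h0 _) ?(Bs _ ha ea) ?(Bs _ ha eb) ?(Bs _ ha ec) ?(Bs _ hb ea) ?(Bs _ hb eb) ?(Bs _ hb ec)
  ?(Bs _ hc ea) ?(Bs _ hc eb) ?(Bs _ hc ec) ?(Bs _ ha e0) ?(Bs _ hb e0) ?(Bs _ hc e0).
by field.
Qed.

(** Gauss's theorem for the cross product of the two fields, whose divergence is the integrand on
    the left. Volume integrals carry the absolute value of [tetdet p], surface integrals its sign
    through the normals; writing the former as sign times value leaves [divergence_identity]. *)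
Lemma divergence p (h n : 'M[R]_(1 + 3, 3)) : nondeg p ->
  \int[@leb3 R]_(x in osimplex p) dot (curlm h) (afield n (vec x))
  - \int[@leb3 R]_(x in osimplex p) dot (curlm n) (afield h (vec x)) =
  \sum_i surfint p i setT (fun x => dot (outnormal p i) (cross (afield h (vec x)) (afield n (vec x)))).
Proof.
move=> np; have d0 := tetdet_neq0 np.
have s4 (f : 'I_4 -> R) : \sum_i f i = f 0 + f 1 + f 2 + f 3.
  by rewrite !big_ord_recl big_ord0 addr0 !addrA; congr (f _ + f _ + f _ + f _); apply: val_inj.
rewrite s4 !surfint_normal// !integral_osimplex//.
have [-> -> -> ->] := facesignE p; have [-> -> -> ->] := areavecE p.
have [[-> -> ->] [-> -> ->] [-> -> ->] [-> -> ->]] := facevtxE p.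
have -> : p 2 - p 1 = (p 2 - p 0) - (p 1 - p 0) by apply: rV3P; rewrite !mxE; ring.
have -> : p 3 - p 1 = (p 3 - p 0) - (p 1 - p 0) by apply: rV3P; rewrite !mxE; ring.
have -> : afield h (p 1) = afield h (p 0) + ddir h (p 1 - p 0) by rewrite -afieldD addrC subrK.
have -> : afield n (p 1) = afield n (p 0) + ddir n (p 1 - p 0) by rewrite -afieldD addrC subrK.
set a := p 1 - p 0; set b := p 2 - p 0; set c := p 3 - p 0.
rewrite (ddirB h b a) (ddirB h c a) (ddirB n b a) (ddirB n c a).
have := divergence_identity (cross b c) (cross c a) (cross a b) (afield h (p 0)) (ddir h a) (ddir h b) (ddir h c)
  (afield n (p 0)) (ddir n a) (ddir n b) (ddir n c).
rewrite -!curlm_basis !dotZl -/(tetdet p) => id.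
rewrite sgrN [X in X * _ - _](_ : `|tetdet p| = Num.sg (tetdet p) * tetdet p); last by rewrite normrEsg.
rewrite [X in _ - X * _](_ : `|tetdet p| = Num.sg (tetdet p) * tetdet p); last by rewrite normrEsg.
transitivity (Num.sg (tetdet p) * (triquad (cross b c + cross c a + cross a b) (afield h (p 0) + ddir h a)
    (ddir h b - ddir h a) (ddir h c - ddir h a) (afield n (p 0) + ddir n a) (ddir n b - ddir n a)
    (ddir n c - ddir n a)
  - triquad (cross b c) (afield h (p 0)) (ddir h b) (ddir h c) (afield n (p 0)) (ddir n b) (ddir n c)
  + triquad (- cross c a) (afield h (p 0)) (ddir h a) (ddir h c) (afield n (p 0)) (ddir n a) (ddir n c)
  - triquad (cross a b) (afield h (p 0)) (ddir h a) (ddir h b) (afield n (p 0)) (ddir n a) (ddir n b))).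
  by rewrite id; field.
ring.
Qed.

End Divergence.

(** * Cancellation of fluxes between neighbouring elements *)

Section Dissipativity.
Context (R : realType) (D : cuboid R) (T : mesh D).
Implicit Types (K L : 'I_(nel T)) (x : R3 R) (i j : 'I_4) (g : R3 R -> R) (v : dG T) (B : set (R3 R)).

Lemma lbm_indic B : measurable B -> lbm (\1_B : R3 R -> R).
Proof.
move=> mB; split; first exact: measurable_indic.
by move=> M; exists 1 => x _ _ _; rewrite indicE ger0_norm ?lern1//; case: (_ \in _).
Qed.

Lemma surfint_indic (p : 'I_4 -> 'rV[R]_3) i B g :
  surfint p i setT (fun x => \1_B x * g x) = surfint p i B g.
Proof. by rewrite !surfintE; congr (_ * _); apply: eq_Rintegral => st _; rewrite indicT mul1r. Qed.

Lemma surfint_sum (p : 'I_4 -> 'rV[R]_3) i B (I : finType) (P : pred I) (g : I -> R3 R -> R) :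
  measurable B -> (forall k, lbm (g k)) ->
  surfint p i B (fun x => \sum_(k | P k) g k x) = \sum_(k | P k) surfint p i B (g k).
Proof.
move=> mB lg; rewrite -[RHS]big_filter.
transitivity (surfint p i B (fun x => \sum_(k <- [seq k <- index_enum I | P k]) g k x)).
  by apply: eq_surfint => x; rewrite big_filter.
elim: [seq k <- _ | _] => [|k s IH].
  rewrite big_nil surfintE; under eq_Rintegral do rewrite big_nil mulr0.
  by rewrite Rintegral_cst ?mul0r ?mulr0//; exact: measurable_reftri.
rewrite big_cons -IH -surfintD//; last exact: lbm_sum.
by apply: eq_surfint => x; rewrite big_cons.
Qed.

Let np K : nondeg (vtx T K). Proof. exact: nondeg_vtx. Qed.
Let ms K : measurable (simplex (vtx T K)). Proof. exact: measurable_simplex. Qed.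

Lemma measurable_boundary : measurable (dombar D `\` dom D).
Proof.
apply: measurableD; last exact: measurable_dom.
by apply: measurableX; [apply: measurableX|]; exact: measurable_itv.
Qed.

(** [good_sum] is a partition of unity at almost every point of the face. *)
Lemma surfint_split K i g : lbm g ->
  surfint (vtx T K) i setT g =
  \sum_(L | K != L) surfint (vtx T K) i (simplex (vtx T L)) g
  + surfint (vtx T K) i (dombar D `\` dom D) g.
Proof.
move=> lg; under eq_bigr do rewrite -surfint_indic.
rewrite -[X in _ + X]surfint_indic -surfint_sum//; last first.
  by move=> L; apply: lbmM => //; exact: lbm_indic.
have mb := measurable_boundary.
rewrite -surfintD//; last 2 first.
- by apply: lbm_sum => L; apply: lbmM => //; exact: lbm_indic.
- by apply: lbmM => //; exact: lbm_indic.
rewrite !surfintE; congr (_ * _); apply: Rintegral_ae_reftri.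
- exact: surf_integrable.
- apply: (@surf_integrable _ _ _ _ (fun x => \sum_(L | K != L) \1_(simplex (vtx T L)) x * g x
     + \1_(dombar D `\` dom D) x * g x)) => //; apply: lbmD; last by apply: lbmM => //; exact: lbm_indic.
  by apply: lbm_sum => L; apply: lbmM => //; exact: lbm_indic.
- apply: negligibleS (good_negligible K i) => st [hst h]; split => // gd; apply: h.
  by rewrite -mulr_suml -mulrDl (good_sum gd) mul1r.
Qed.

(** A generic point of the face that belongs to [L] would produce a partner face, so the integrand
    vanishes almost everywhere. *)
Lemma surfint_unpaired K L i g : K != L -> lbm g ->
  ~ (exists j, paired (vtx T K) i (vtx T L) j) ->
  surfint (vtx T K) i (simplex (vtx T L)) g = 0.
Proof.
move=> KL lg up; rewrite surfintE.
rewrite (@Rintegral_ae_reftri _ _ (fun=> 0)).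
- by rewrite Rintegral_cst ?mul0r ?mulr0//; exact: measurable_reftri.
- exact: surf_integrable.
- have -> : EFin \o (fun=> 0) = cst 0%E :> (measurableTypeR R * measurableTypeR R -> \bar R) by [].
  exact: integrable0.
- apply: negligibleS (good_negligible K i) => st [hst h]; split => // gd; apply: h.
  rewrite indicE memNset ?mul0r// => hx; apply: up.
  by have [j hj _] := good_paired KL gd hx; exists j.
Qed.

(** The normal belongs to [K] while the trace is taken from [L], so that both traces on a common
    face can be paired with the same normal. *)
Definition flux v K i L B : R := surfint (vtx T K) i B
  (fun x => dot (outnormal (vtx T K) i) (cross (Hpart (v L) x) (Epart (v L) x))).

Lemma lbm_flux (u : 'rV[R]_3) v L : lbm (fun x => dot u (cross (Hpart (v L) x) (Epart (v L) x))).
Proof.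
apply: lbm_dot; first exact: lbmv_cst.
by apply: lbmv_cross; [exact: lbmv_Hpart|exact: lbmv_Epart].
Qed.

(** The first two hypotheses hold when each index has exactly one partner or a vanishing term. In
    this form the double sum can be exchanged without choosing a bijection. *)
Lemma sum_matching (I : finType) (P : rel I) (f1 f2 : I -> R) :
  (forall i : I, f1 i = \sum_(j | P i j) f1 i) -> (forall j : I, f2 j = \sum_(i | P i j) f2 j) ->
  (forall i j : I, P i j -> f1 i = - f2 j) -> \sum_i f1 i = - \sum_j f2 j.
Proof.
move=> h1 h2 h; rewrite (eq_bigr _ (fun (i : I) _ => h1 i)) [in RHS](eq_bigr _ (fun (j : I) _ => h2 j)).
rewrite (exchange_big_dep predT)//= -sumrN; apply: eq_bigr => j _.
by rewrite -sumrN; apply: eq_bigr => i /h.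
Qed.

(** Faces without partner contribute nothing; paired ones have equal surface integrals and opposite
    normals, whichever element the trace comes from. *)
Lemma flux_antisym v K L L' : K != L ->
  \sum_i flux v K i L' (simplex (vtx T L)) = - \sum_j flux v L j L' (simplex (vtx T K)).
Proof.
move=> KL; have LK : L != K by rewrite eq_sym.
have H K1 K2 i : K1 != K2 -> flux v K1 i L' (simplex (vtx T K2)) =
    \sum_(j | `[< paired (vtx T K1) i (vtx T K2) j >]) flux v K1 i L' (simplex (vtx T K2)).
  move=> K12; have [[j pj]|up] := pselect (exists j, paired (vtx T K1) i (vtx T K2) j).
    rewrite (big_pred1 j)// => j'; apply/asboolP/eqP => [pj'|-> //].
    exact: paired_inj pj' pj.
  rewrite big_pred0 => [|j]; last by apply/asboolP => pj; apply: up; exists j.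
  exact: surfint_unpaired (lbm_flux _ _ _) up.
apply: (@sum_matching 'I_4 (fun i j => `[< paired (vtx T K) i (vtx T L) j >])) => [i|j|i j /asboolP pij].
- exact: H.
- rewrite {1}(H L K j LK); apply: eq_bigl => i.
  by apply/asboolP/asboolP => /paired_sym.
rewrite /flux (paired_surfint (np K) (np L) pij (lbm_flux _ _ _)).
rewrite (paired_outnormal (np K) (np L) pij).
rewrite -surfintN//; last exact: lbm_flux.
by apply: eq_surfint => x; rewrite dotNl opprK.
Qed.

Lemma volume_flux v K :
  \int[@leb3 R]_(x in osimplex (vtx T K)) dot (curl (Hpart (v K)) x) (Epart (v K) x)
  - \int[@leb3 R]_(x in osimplex (vtx T K)) dot (curl (Epart (v K)) x) (Hpart (v K) x)
  = \sum_i flux v K i K setT.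
Proof.
have eH : Hpart (v K) = fun y => afield (rsubmx (v K)) (vec y).
  by apply/funext => y; rewrite Hpart_afield.
have eE : Epart (v K) = fun y => afield (lsubmx (v K)) (vec y).
  by apply/funext => y; rewrite Epart_afield.
rewrite /flux eH eE -divergence//; congr (_ - _);
  by apply: eq_Rintegral => x _; rewrite curl_afield.
Qed.

(** The products of jumps with sums of traces add up to twice the difference of the two one-sided
    fluxes; the jump penalties enter with a negative sign and are dropped. *)
Lemma intface_le v K L :
  intface v v K L <= 2 * (\sum_i flux v K i L (simplex (vtx T L)) - \sum_i flux v K i K (simplex (vtx T L))).
Proof.
rewrite /intface -sumrB mulr_sumr; apply: ler_sum => i _.
rewrite /flux -surfintB//; [|exact: lbm_flux..].
rewrite -surfintZ//; last by apply: lbmB; exact: lbm_flux.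
have lH w M : lbmv (Hpart (w M) : R3 R -> _) by exact: lbmv_Hpart.
have lE w M : lbmv (Epart (w M) : R3 R -> _) by exact: lbmv_Epart.
apply: le_surfint => //.
- have ln : lbmv (fun _ : R3 R => outnormal (vtx T K) i) by exact: lbmv_cst.
  have lc (F : R3 R -> 'rV[R]_3) : lbmv F -> lbmv (fun x => cross (outnormal (vtx T K) i) (F x)).
    by move=> lF; exact: lbmv_cross.
  have ljH : lbmv (fun x => Hpart (v L) x - Hpart (v K) x) by exact: lbmvB.
  have ljE : lbmv (fun x => Epart (v L) x - Epart (v K) x) by exact: lbmvB.
  by apply: lbmB; [apply: lbmB; [apply: lbmB|]|]; apply: lbm_dot; do ?apply: lc => //; exact: lbmvD.
- by apply: lbmM; [exact: lbm_cst|apply: lbmB; exact: lbm_flux].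
- move=> x /=; set n := outnormal _ _.
  set HL := Hpart (v L) x; set HK := Hpart (v K) x; set EL := Epart (v L) x; set EK := Epart (v K) x.
  have -> : dot (cross n (HL - HK)) (EK + EL) - dot (cross n (EL - EK)) (HK + HL) =
     2 * (dot n (cross HL EL) - dot n (cross HK EK)).
    by clearbody HL HK EL EK n; rewrite !dot3 !crossE !mxE; ring.
  by have := dot_ge0 (cross n (EL - EK)); have := dot_ge0 (cross n (HL - HK)); lra.
Qed.

Lemma extface_le v K : extface v v K <= - \sum_i flux v K i K (dombar D `\` dom D).
Proof.
have mb := measurable_boundary.
rewrite /extface -sumrN; apply: ler_sum => i _.
rewrite /flux -surfintN//; last exact: lbm_flux.
have lc (F : R3 R -> 'rV[R]_3) : lbmv F -> lbmv (fun x => cross (outnormal (vtx T K) i) (F x)).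
  by move=> lF; apply: lbmv_cross => //; exact: lbmv_cst.
have lH := lbmv_Hpart (v K); have lE := lbmv_Epart (v K).
apply: le_surfint => //.
- by apply: lbmB; apply: lbm_dot => //; exact: lc.
- by apply: lbmN; exact: lbm_flux.
- move=> x /=; set n := outnormal _ _; set H := Hpart _ _; set E := Epart _ _.
  have -> : dot (cross n E) H = - dot n (cross H E).
    by clearbody n H E; rewrite !dot3 !crossE; ring.
  by have := dot_ge0 (cross n E); lra.
Qed.

Lemma Mform_le0 v : Mform v v <= 0.
Proof.
(* Flux through the part of the boundary of [K] shared with [L], with the normal of [K] and the
   trace from [L']. *)
pose S K L L' := \sum_i flux v K i L' (simplex (vtx T L)).
pose Bd K := \sum_i flux v K i K (dombar D `\` dom D).
have volE K : \int[@leb3 R]_(x in osimplex (vtx T K)) dot (curl (Hpart (v K)) x) (Epart (v K) x)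
  - \int[@leb3 R]_(x in osimplex (vtx T K)) dot (curl (Epart (v K)) x) (Hpart (v K) x)
  = \sum_(L | K != L) S K L K + Bd K.
  rewrite volume_flux /S exchange_big -big_split/=; apply: eq_bigr => i _.
  by rewrite -surfint_split//; exact: lbm_flux.
rewrite /Mform (eq_bigr _ (fun K _ => volE K)).
apply: (@le_trans _ _ (\sum_K (\sum_(L | K != L) S K L K + Bd K)
  + 2^-1 * (\sum_(K < nel T) \sum_(L < nel T | (K < L)%N) 2 * (S K L L - S K L K)) + \sum_K (- Bd K))).
  apply: lerD; last by apply: ler_sum => K _; exact: extface_le.
  rewrite lerD2l ler_wpM2l// ?invr_ge0//.
  by apply: ler_sum => K _; apply: ler_sum => L _; exact: intface_le.
have hS K L L' : K != L -> S K L L' = - S L K L' by exact: flux_antisym.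
clear volE; clearbody S Bd.
rewrite big_split/= sumrN addrAC addrK.
under [X in 2^-1 * X]eq_bigr do rewrite -mulr_sumr.
rewrite -mulr_sumr mulrA mulVf// mul1r.
(* Once pairs are ordered, each carries the volume fluxes of its two elements and the two terms of
   its interior face; these four cancel by the antisymmetry of [S]. *)
have sp K : \sum_(L | K != L) S K L K =
    \sum_(L < nel T | (K < L)%N) S K L K + \sum_(L < nel T | (L < K)%N) S K L K.
  rewrite (bigID (fun L : 'I_(nel T) => (K < L)%N))/=; congr (_ + _); apply: eq_bigl => L.
    by case: ltngtP => KL; rewrite ?andbF ?andbT//; apply/eqP => e; rewrite e ltnn in KL.
  case: ltngtP => KL; rewrite ?andbF ?andbT//; first by apply/eqP => e; rewrite e ltnn in KL.
  by apply/negbTE; rewrite negbK; apply/eqP/val_inj.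
under eq_bigr do rewrite sp.
rewrite big_split/= [X in _ + X + _](_ : _ = \sum_(K < nel T) \sum_(L < nel T | (K < L)%N) S L K L); last first.
  rewrite (exchange_big_dep predT)//=; apply: eq_bigr => K _; by apply: eq_bigl => L.
rewrite -!big_split/= big1// => K _; rewrite -!big_split/= big1// => L KL.
have nKL : K != L by apply: contraTneq KL => ->; rewrite ltnn.
have -> : S K L L = - S L K L by exact: hS.
ring.
Qed.

End Dissipativity.

(** * Square integrable functions *)

Section SquareIntegrable.
Context d (X : measurableType d) (R : realType) (mu : {measure set X -> \bar R}).
Implicit Types (f g h : X -> R) (c : R).

(** Stated for a general measure because it serves both [lebD D], where [L2P] identifies it with
    [L2], and the probability [P]. *)
Definition sqi f : Prop := measurable_fun setT f /\ (\int[mu]_x ((f x) ^+ 2)%:E < +oo)%E.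

Definition ip f g : R := \int[mu]_x (f x * g x).

Lemma le_ge0_integral (f g : X -> \bar R) :
  (forall x, 0 <= f x)%E -> measurable_fun setT f -> measurable_fun setT g ->
  (forall x, f x <= g x)%E -> (\int[mu]_x f x <= \int[mu]_x g x)%E.
Proof. by move=> f0 mf mg fg; apply: ge0_le_integral. Qed.

Lemma measurable_sqr f : measurable_fun setT f -> measurable_fun setT (fun x => ((f x) ^+ 2)%:E).
Proof. by move=> mf; apply/measurable_EFinP; exact: measurable_funX. Qed.

Lemma sqi_sqr_integrable f : sqi f -> mu.-integrable setT (fun x => ((f x) ^+ 2)%:E).
Proof.
move=> [mf fy]; apply/integrableP; split; first exact: measurable_sqr.
by under eq_integral do rewrite gee0_abs ?lee_fin ?sqr_ge0//.
Qed.

Lemma sqi_mul_integrable f g : sqi f -> sqi g -> mu.-integrable setT (fun x => (f x * g x)%:E).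
Proof.
move=> sf sg; have [mf _] := sf; have [mg _] := sg.
have h := integrableD measurableT (sqi_sqr_integrable sf) (sqi_sqr_integrable sg).
apply: (le_integrable measurableT _ _ h).
  by apply/measurable_EFinP; exact: measurable_funM.
move=> x _; rewrite -EFinD /= lee_fin [leRHS]ger0_norm ?addr_ge0 ?sqr_ge0// normrM.
rewrite -(real_normK (num_real (f x))) -(real_normK (num_real (g x))).
by have := sqr_ge0 (`|f x| - `|g x|); have := normr_ge0 (f x); have := normr_ge0 (g x); nra.
Qed.

Lemma sqi0 : sqi (cst 0).
Proof.
split => //; under eq_integral do rewrite /cst expr0n /=.
by rewrite integral0 ltry.
Qed.

Lemma sqiZ c f : sqi f -> sqi (fun x => c * f x).
Proof.
move=> [mf fy]; split; first exact: measurable_funM.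
under eq_integral do rewrite exprMn EFinM.
rewrite ge0_integralZl ?lee_fin ?sqr_ge0//; first by rewrite lte_mul_pinfty ?lee_fin ?sqr_ge0.
- exact: measurable_sqr.
- by move=> x _; rewrite lee_fin sqr_ge0.
Qed.

Lemma sqiD f g : sqi f -> sqi g -> sqi (fun x => f x + g x).
Proof.
move=> sf sg; have [mf fy] := sf; have [mg gy] := sg; split; first exact: measurable_funD.
apply: (@le_lt_trans _ _ (\int[mu]_x (2%:E * ((f x) ^+ 2)%:E + 2%:E * ((g x) ^+ 2)%:E))%E).
  apply: le_ge0_integral.
  - by move=> x; rewrite lee_fin sqr_ge0.
  - by apply: measurable_sqr; exact: measurable_funD.
  - by apply: emeasurable_funD; apply: emeasurable_funM => //; exact: measurable_sqr.
  - move=> x; rewrite -!EFinM -EFinD lee_fin.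
    by have := sqr_ge0 (f x - g x); rewrite !expr2; nra.
rewrite ge0_integralD//.
- rewrite !ge0_integralZl//; try (by move=> x _; rewrite lee_fin sqr_ge0); try exact: measurable_sqr.
  by rewrite lte_add_pinfty// lte_mul_pinfty.
- by move=> x _; rewrite mule_ge0// lee_fin sqr_ge0.
- by apply: emeasurable_funM => //; exact: measurable_sqr.
- by move=> x _; rewrite mule_ge0// lee_fin sqr_ge0.
- by apply: emeasurable_funM => //; exact: measurable_sqr.
Qed.

Lemma sqiN f : sqi f -> sqi (fun x => - f x).
Proof. by move=> /(sqiZ (-1)); under eq_fun do rewrite mulN1r. Qed.

Lemma sqiB f g : sqi f -> sqi g -> sqi (fun x => f x - g x).
Proof. by move=> sf /sqiN; exact: sqiD. Qed.

Lemma sqi_sum (I : Type) (s : seq I) (f : I -> X -> R) :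
  (forall i, sqi (f i)) -> sqi (fun x => \sum_(i <- s) f i x).
Proof.
move=> hf; elim: s => [|i s IH]; first by under eq_fun do rewrite big_nil; exact: sqi0.
by under eq_fun do rewrite big_cons; exact: sqiD.
Qed.

Lemma ipC f g : ip f g = ip g f.
Proof. by apply: eq_Rintegral => x _; rewrite mulrC. Qed.

Lemma ipDl f g h : sqi f -> sqi g -> sqi h -> ip (fun x => f x + g x) h = ip f h + ip g h.
Proof.
move=> sf sg sh; rewrite /ip -RintegralD//; [|exact: sqi_mul_integrable..].
by apply: eq_Rintegral => x _; rewrite mulrDl.
Qed.

Lemma ipZl c f g : sqi f -> sqi g -> ip (fun x => c * f x) g = c * ip f g.
Proof.
move=> sf sg; rewrite /ip -RintegralZl//; last exact: sqi_mul_integrable.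
by apply: eq_Rintegral => x _; rewrite mulrA.
Qed.

Lemma ipBl f g h : sqi f -> sqi g -> sqi h -> ip (fun x => f x - g x) h = ip f h - ip g h.
Proof.
move=> sf sg sh; rewrite ipDl//; last exact: sqiN.
rewrite -[- ip g h]mulN1r -ipZl//; congr (_ + ip _ _).
by apply/funext => x; rewrite mulN1r.
Qed.

Lemma ip_suml (I : Type) (s : seq I) (f : I -> X -> R) g : (forall i, sqi (f i)) -> sqi g ->
  ip (fun x => \sum_(i <- s) f i x) g = \sum_(i <- s) ip (f i) g.
Proof.
move=> hf sg; elim: s => [|i s IH].
  rewrite big_nil /ip; under eq_Rintegral do rewrite big_nil mul0r.
  by rewrite Rintegral_cst// mul0r.
rewrite big_cons -IH -ipDl//; last exact: sqi_sum.
by congr ip; apply/funext => x; rewrite big_cons.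
Qed.

Lemma ipE f : sqi f -> (\int[mu]_x ((f x) ^+ 2)%:E)%E = (ip f f)%:E.
Proof.
move=> [mf fy]; rewrite /ip /Rintegral; under [in RHS]eq_integral do rewrite -expr2.
by rewrite fineK// ge0_fin_numE// integral_ge0// => x _; rewrite lee_fin sqr_ge0.
Qed.

Lemma ip_ge0 f : 0 <= ip f f.
Proof. by apply: Rintegral_ge0 => x _; rewrite -expr2 sqr_ge0. Qed.

End SquareIntegrable.

Lemma discriminant_bound (R : realType) (a b c : R) : 0 <= a -> 0 <= c ->
  (forall t : R, 0 <= a - 2 * t * b + t ^+ 2 * c) -> b ^+ 2 <= a * c.
Proof.
move=> a0 c0 h; have [c_gt0|c_le0] := ltP 0 c.
  have := h (b / c).
  have -> : a - 2 * (b / c) * b + (b / c) ^+ 2 * c = (a * c - b ^+ 2) / c.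
    by field; rewrite gt_eqF.
  by rewrite pmulr_lge0 ?invr_gt0// subr_ge0.
have -> : c = 0 by apply/eqP; rewrite eq_le c_le0 c0.
rewrite mulr0; have [->|b0] := eqVneq b 0; first by rewrite expr0n.
(* For [c = 0] and nonzero [b], this value of t turns the nonnegative expression into -1. *)
have := h ((a + 1) / (2 * b)).
have -> : c = 0 by apply/eqP; rewrite eq_le c_le0 c0.
have -> : a - 2 * ((a + 1) / (2 * b)) * b + ((a + 1) / (2 * b)) ^+ 2 * 0 = -1 by field.
by rewrite oppr_ge0 ler10.
Qed.

Lemma ip_cauchy d (X : measurableType d) (R : realType) (mu : {measure set X -> \bar R})
    (f g : X -> R) : sqi mu f -> sqi mu g -> ip mu f g ^+ 2 <= ip mu f f * ip mu g g.
Proof.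
move=> sf sg; apply: discriminant_bound; [exact: ip_ge0..|move=> t].
have := ip_ge0 mu (fun x => f x - t * g x).
have st := sqiZ t sg.
rewrite ipBl//; last exact: sqiB.
rewrite ipZl//; last exact: sqiB.
rewrite ![ip mu _ (fun x => f x - t * g x)]ipC !ipBl// !ipZl// (ipC mu g f).
by congr (_ <= _); ring.
Qed.

Section LebD.
Context (R : realType) (D : cuboid R).
Notation mR := (measurableTypeR R).
Implicit Types (f g : R3 R -> R).
Notation mu := (lebD D).

Lemma L2P f : L2 D f <-> sqi mu f.
Proof.
have key : ('N[mu]_2%:E[EFin \o f] `^ 2 = \int[mu]_x ((f x) ^+ 2)%:E)%E.
  rewrite poweR_Lnorm//; apply: eq_integral => x _ /=.
  by rewrite powR_mulrn// real_normK// num_real.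
have N0 : (0 <= 'N[mu]_2%:E[EFin \o f])%E by exact: Lnorm_ge0.
rewrite /L2 /=; split.
  move=> /andP[/[!inE]/= mf fin]; split => //.
  rewrite -key; move: fin; rewrite /finite_norm/= => fin.
  move: N0 fin; case: ('N[mu]_2%:E[EFin \o f])%E => [r|//|//] r0 _.
  by rewrite poweR_EFin ltry.
move=> [mf fy]; apply/andP; split; first by rewrite inE.
rewrite inE/= /finite_norm; move: N0 fy; rewrite -key.
case: ('N[mu]_2%:E[EFin \o f])%E => [r|//|//] _; first by move=> _; exact: ltry.
by rewrite poweRyr.
Qed.

Lemma nsqL2E f : L2 D f -> nsqL2 D f = (ipL2 D f f)%:E.
Proof. by move=> /L2P/ipE. Qed.

Lemma lebD_setC : mu (~` dom D) = 0%E.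
Proof. by rewrite /lebD /mrestr/= setICl measure0. Qed.

Lemma lebD_fin : (mu setT < +oo)%E.
Proof.
rewrite /lebD /mrestr/= setTI /dom /leb3 product_measure1E//=.
- rewrite product_measure1E//= !lebesgue_measure_itv/= !lte_fin.
  by rewrite xLR yLR zLR -!EFinD -!EFinM ltry.
- by apply: measurableX.
Qed.

Lemma dom_lbm_bounded f : lbm f -> exists C, forall x, dom D x -> `|f x| <= C.
Proof.
move=> [_ bf]; have [C hC] := bf (`|xL D| + `|xR D| + `|yL D| + `|yR D| + `|zL D| + `|zR D|).
have itv (a b c : R) : a < b -> b < c -> `|b| <= `|a| + `|c|.
  move=> ab bc; have := ler_norm c; have := ler_norm (- a); rewrite normrN => h1 h2.
  have := normr_ge0 a; have := normr_ge0 c; rewrite ler_norml; lra.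
exists C => x [[/=]]; rewrite !in_itv/= => /andP[h1 h2] /andP[h3 h4] /andP[h5 h6].
have := (normr_ge0 (xL D), normr_ge0 (xR D), (normr_ge0 (yL D), normr_ge0 (yR D)), (normr_ge0 (zL D), normr_ge0 (zR D))).
move=> [[[k1 k2] [k3 k4]] [k5 k6]].
by apply: hC; [have := itv _ _ _ h1 h2|have := itv _ _ _ h3 h4|have := itv _ _ _ h5 h6]; lra.
Qed.

Lemma ae_dom : {ae mu, forall x, dom D x}.
Proof.
exists (~` dom D); split; [by apply: measurableC; exact: measurable_dom|exact: lebD_setC|by []].
Qed.

(** [g] is bounded on [D], and cutting it off outside [D] changes the integrand only on a null set
    of [lebD D]. *)
Lemma L2_lbmM f g : L2 D f -> lbm g -> L2 D (fun x => g x * f x).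
Proof.
move=> /L2P[mf fy] lg; have [mg _] := lg; apply/L2P; split; first exact: measurable_funM.
have [C hC] := dom_lbm_bounded lg.
pose g' x := g x * \1_(dom D) x.
have mg' : measurable_fun setT g'.
  by apply: (measurable_funM mg); apply: measurable_indic; exact: measurable_dom.
rewrite (@ge0_ae_eq_integral _ _ _ mu setT _ (fun x => ((g' x * f x) ^+ 2)%:E))//.
- apply: (@le_lt_trans _ _ (\int[mu]_x ((C ^+ 2)%:E * ((f x) ^+ 2)%:E))%E).
    apply: le_ge0_integral.
    + by move=> x; rewrite lee_fin sqr_ge0.
    + by apply: measurable_sqr; exact: measurable_funM.
    + by apply: emeasurable_funM => //; exact: measurable_sqr.
    + move=> x; rewrite -EFinM lee_fin exprMn ler_wpM2r ?sqr_ge0// /g' indicE.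
      have [xD|xD] := boolP (x \in dom D); last by rewrite mulr0 expr0n sqr_ge0.
      rewrite mulr1 -(real_normK (num_real (g x))); move/set_mem/hC : xD => h.
      by apply: lerXn2r => //; rewrite nnegrE// (le_trans _ h).
  rewrite ge0_integralZl//; [by rewrite lte_mul_pinfty ?lee_fin ?sqr_ge0|exact: measurable_sqr| |].
    by move=> x _; rewrite lee_fin sqr_ge0.
  by rewrite lee_fin sqr_ge0.
- by apply: measurable_sqr; exact: measurable_funM.
- by apply: measurable_sqr; exact: measurable_funM.
- by move=> x _; rewrite lee_fin sqr_ge0.
- by move=> x _; rewrite lee_fin sqr_ge0.
- apply: filterS ae_dom => x xD _.
  by rewrite /g' indicE mem_set// mulr1.
Qed.

Lemma L2_cst (c : R) : L2 D (fun=> c).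
Proof.
apply/L2P; split => //; rewrite integral_cst//.
by rewrite lte_mul_pinfty ?lee_fin ?sqr_ge0 ?lebD_fin.
Qed.

Lemma L2_lbm g : lbm g -> L2 D g.
Proof. by move=> lg; have := L2_lbmM (L2_cst 1) lg; under eq_fun do rewrite mulr1. Qed.

Lemma L2D f g : L2 D f -> L2 D g -> L2 D (fun x => f x + g x).
Proof. by move=> /L2P sf /L2P sg; apply/L2P; exact: sqiD. Qed.
Lemma L2B f g : L2 D f -> L2 D g -> L2 D (fun x => f x - g x).
Proof. by move=> /L2P sf /L2P sg; apply/L2P; exact: sqiB. Qed.
Lemma L2Z c f : L2 D f -> L2 D (fun x => c * f x).
Proof. by move=> /L2P sf; apply/L2P; exact: sqiZ. Qed.
Lemma L2_sumr (I : Type) (s : seq I) (f : I -> R3 R -> R) :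
  (forall i, L2 D (f i)) -> L2 D (fun x => \sum_(i <- s) f i x).
Proof. by move=> h; apply/L2P; apply: sqi_sum => i; exact/L2P. Qed.

Lemma ipL2C f g : ipL2 D f g = ipL2 D g f. Proof. exact: ipC. Qed.
Lemma ipL2Zl c f g : L2 D f -> L2 D g -> ipL2 D (fun x => c * f x) g = c * ipL2 D f g.
Proof. by move=> /L2P ? /L2P ?; exact: ipZl. Qed.
Lemma ipL2Bl f g h : L2 D f -> L2 D g -> L2 D h ->
  ipL2 D (fun x => f x - g x) h = ipL2 D f h - ipL2 D g h.
Proof. by move=> /L2P ? /L2P ? /L2P ?; exact: ipBl. Qed.
Lemma ipL2_suml (I : Type) (s : seq I) (f : I -> R3 R -> R) g : (forall i, L2 D (f i)) -> L2 D g ->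
  ipL2 D (fun x => \sum_(i <- s) f i x) g = \sum_(i <- s) ipL2 D (f i) g.
Proof. by move=> h /L2P sg; apply: ip_suml => // i; exact/L2P. Qed.
Lemma ipL2_cauchy f g : L2 D f -> L2 D g -> ipL2 D f g ^+ 2 <= ipL2 D f f * ipL2 D g g.
Proof. by move=> /L2P ? /L2P ?; exact: ip_cauchy. Qed.
Lemma ipL2_ge0 f : 0 <= ipL2 D f f. Proof. exact: ip_ge0. Qed.

Implicit Types (u v : vfield R).

Lemma HH_lbmv u : lbmv u -> HH D u.
Proof. by move=> lu i; apply: L2_lbm. Qed.

Lemma ipHH_integrable u v : HH D u -> HH D v -> (lebD D).-integrable setT (fun x => (dot (u x) (v x))%:E).
Proof.
move=> hu hv; rewrite /dot.
suff H : forall s : seq 'I_(3 + 3),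
   (lebD D).-integrable setT (fun x => (\sum_(i <- s) u x 0 i * v x 0 i)%:E) by exact: H.
elim=> [|i s IH]; first by under eq_fun do rewrite big_nil; exact: integrable0.
under eq_fun do rewrite big_cons EFinD; apply: integrableD => //.
by apply: (@sqi_mul_integrable _ _ _ _ (fun x => u x 0 i) (fun x => v x 0 i)); apply/L2P; [exact: hu|exact: hv].
Qed.

Lemma ipHHC u v : ipHH D u v = ipHH D v u.
Proof. by apply: eq_Rintegral => x _; rewrite dotC. Qed.

Lemma HHD u v : HH D u -> HH D v -> HH D (fun x => u x + v x).
Proof. by move=> hu hv i; under eq_fun do rewrite mxE; exact: L2D. Qed.

Lemma HHZ c u : HH D u -> HH D (fun x => c *: u x).
Proof. by move=> hu i; under eq_fun do rewrite mxE; exact: L2Z. Qed.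

Lemma ipHHDl u v w : HH D u -> HH D v -> HH D w ->
  ipHH D (fun x => u x + v x) w = ipHH D u w + ipHH D v w.
Proof.
move=> hu hv hw; rewrite /ipHH -RintegralD//; [|exact: ipHH_integrable..].
by apply: eq_Rintegral => x _; rewrite dotDl.
Qed.

Lemma ipHHZl c u v : HH D u -> HH D v -> ipHH D (fun x => c *: u x) v = c * ipHH D u v.
Proof.
move=> hu hv; rewrite /ipHH -RintegralZl//; last exact: ipHH_integrable.
by apply: eq_Rintegral => x _; rewrite dotZl.
Qed.

Lemma ipHH_ge0 u : 0 <= ipHH D u u.
Proof. by apply: Rintegral_ge0 => x _; exact: dot_ge0. Qed.

Lemma nsqHHE u : HH D u -> nsqHH D u = (ipHH D u u)%:E.
Proof.
move=> hu; rewrite /ipHH /Rintegral fineK//.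
by apply: integrable_fin_num => //; exact: ipHH_integrable.
Qed.

Lemma ipHH_cauchy u v : HH D u -> HH D v -> ipHH D u v ^+ 2 <= ipHH D u u * ipHH D v v.
Proof.
move=> hu hv; apply: discriminant_bound; [exact: ipHH_ge0..|move=> t].
have hw : HH D (fun x => u x + - t *: v x) by apply: HHD => //; exact: HHZ.
have := ipHH_ge0 (fun x => u x + - t *: v x).
have htv := HHZ (- t) hv.
rewrite ipHHDl// ipHHZl// ![ipHH D _ (fun x => _ + _)]ipHHC !ipHHDl// !ipHHZl// (ipHHC v u).
by congr (_ <= _); ring.
Qed.

End LebD.

(** * The discontinuous Galerkin space *)

Section DGSpace.
Context (R : realType) (D : cuboid R) (T : mesh D).
Notation J := ('I_(nel T) * 'I_(1 + 3) * 'I_(3 + 3))%type.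
Implicit Types (u v w : dG T) (c : R) (K L : 'I_(nel T)) (x : R3 R).

Definition dGdim : nat := #|{: J}|.

Definition crd v : 'rV[R]_dGdim :=
  \row_k v (enum_val k).1.1 (enum_val k).1.2 (enum_val k).2.

Definition ofc (x : 'rV[R]_dGdim) : dG T :=
  [ffun K => \matrix_(a, b) x 0 (enum_rank (K, a, b))].

Lemma crdK : cancel crd ofc.
Proof. by move=> v; apply/ffunP => K; apply/matrixP => a b; rewrite !ffunE !mxE enum_rankK. Qed.

Lemma ofcK : cancel ofc crd.
Proof.
move=> x; apply/rowP => k; rewrite !mxE ffunE mxE; congr (x 0 _).
by rewrite -[RHS]enum_valK; congr enum_rank; case: (enum_val k) => -[].
Qed.

Lemma crd_lin c u v : crd (c *: u + v) = c *: crd u + crd v.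
Proof. by apply/rowP => k; rewrite !mxE !ffunE !mxE. Qed.

Lemma ofc_lin c (x y : 'rV[R]_dGdim) : ofc (c *: x + y) = c *: ofc x + ofc y.
Proof. by apply: (can_inj crdK); rewrite crd_lin !ofcK. Qed.

Definition dbasis (k : 'I_dGdim) : dG T := ofc (delta_mx 0 k).

Definition linear_form (f : dG T -> R) := forall c u v, f (c *: u + v) = c * f u + f v.


Lemma linear_formE f v : linear_form f -> f v = \sum_k crd v 0 k * f (dbasis k).
Proof.
move=> lf; have f0 : f 0 = 0 by have := lf (-1) 0 0; rewrite scaler0 addr0 mulN1r addNr.
have ofc0 : ofc 0 = 0 by apply/ffunP => K; apply/matrixP => a b; rewrite !ffunE !mxE.
rewrite -{1}[v]crdK [X in ofc X]row_sum_delta.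
elim/big_rec2 : _ => [|k y1 y2 _ <-]; first by rewrite ofc0.
by rewrite ofc_lin lf.
Qed.

Definition bilinear_form (B : dG T -> dG T -> R) :=
  (forall v, linear_form (B ^~ v)) /\ (forall u, linear_form (B u)).

Definition form_mx (B : dG T -> dG T -> R) : 'M[R]_dGdim :=
  \matrix_(k, l) B (dbasis k) (dbasis l).

Lemma form_mxE B u v : bilinear_form B ->
  B u v = (crd u *m form_mx B *m (crd v)^T) 0 0.
Proof.
move=> [l1 l2]; rewrite (linear_formE u (l1 v)) mxE.
under eq_bigr do rewrite (linear_formE v (l2 _)) mulr_sumr.
rewrite exchange_big; apply: eq_bigr => l _; rewrite [X in _ = X * _]mxE mulr_suml.
by apply: eq_bigr => k _; rewrite !mxE; ring.
Qed.

Lemma embed_lin c u v x : embed (c *: u + v) x = c *: embed u x + embed v x.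
Proof.
rewrite /embed scaler_sumr -big_split/=; apply: eq_bigr => K _.
rewrite !ffunE /polyval mulmxDr -scalemxAr scalerDr; congr (_ + _).
by rewrite !scalerA mulrC.
Qed.

Lemma lbmv_embed u : lbmv (embed u).
Proof.
move=> k; under eq_fun do rewrite summxE.
apply: lbm_sum => K; under eq_fun do rewrite mxE; apply: lbmM; last exact: lbmv_polyval.
by apply: lbm_indic; exact: (measurable_osimplex (nondeg_vtx K)).
Qed.

Lemma HH_embed u : HH D (embed u).
Proof. exact/HH_lbmv/lbmv_embed. Qed.
Hint Resolve HH_embed : core.

Lemma ipHH_embed_lin (f : vfield R) : HH D f -> linear_form (fun v => ipHH D f (embed v)).
Proof.
move=> hf c u v; rewrite ipHHC.
transitivity (ipHH D (fun x => c *: embed u x + embed v x) f).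
  by congr ipHH; apply/funext => x; rewrite embed_lin.
have hc := HHZ c (HH_embed u).
by rewrite ipHHDl// ipHHZl// !(ipHHC _ f).
Qed.

Definition gram u v : R := ipHH D (embed u) (embed v).

Lemma gramC u v : gram u v = gram v u. Proof. exact: ipHHC. Qed.

Lemma gram_bilinear : bilinear_form gram.
Proof.
split=> [v c u u'|u]; last exact: ipHH_embed_lin.
by rewrite !(gramC _ v); exact: ipHH_embed_lin.
Qed.

Lemma gram_ge0 u : 0 <= gram u u. Proof. exact: ipHH_ge0. Qed.

Lemma aff3_null (a b c d : R) : (a, b, c, d) != 0 -> leb3 [set x | aff3 a b c d x = 0] = 0%E :> \bar R.
Proof.
move=> nz; set S := [set x | _].
have mS : measurable S.
  by have := measurable_aff3 a b c d measurableT (measurable_set1 (0 : R)); rewrite setTI.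
have [d0|d0] := eqVneq d 0; last first.
  have -> : leb3 S = (\int[@leb2 R]_x (@lebesgue_measure R \o xsection S) x)%E by [].
  rewrite integral0_eq// => x _ /=.
  rewrite (_ : xsection S x = [set - (a + b * x.1 + c * x.2) / d]) ?lebesgue_measure_set1//.
  apply/seteqP; split=> z; rewrite /xsection/= inE /S/= /aff3/= => h.
    by apply: (mulfI d0); move/eqP: h; rewrite addrC addr_eq0 => /eqP ->; field.
  by rewrite h; field.
have -> : leb3 S = ((@leb2 R) \x^ (@lebesgue_measure R))%E S.
  rewrite /leb3; apply: (@product_measure_unique _ _ _ _ _ (@leb2 R) (@lebesgue_measure R)) => // A B mA mB.
  by rewrite -product_measure2E.
rewrite /product_measure2/= integral0_eq// => z _ /=.
rewrite (_ : ysection S z = [set x | aff2 a b c x = 0]).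
  by apply: aff2_null; move: nz; rewrite d0 !xpair_eqE eqxx andbT.
by apply/seteqP; split=> x; rewrite /ysection/= inE /S/= /aff3/= d0 mul0r addr0.
Qed.

Lemma osimplex_dom K x : osimplex (vtx T K) x -> dom D x.
Proof.
move=> hx; have nK := nondeg_vtx K; apply/domP => m mp.
have m0 i : 0 <= aff m (vtx T K i).
  have /dombarP/(_ m mp) : dombar D (pt (vtx T K i)); last by rewrite ptK.
  apply: (@simplex_dombar _ _ T K); apply/simplexP => // j; rewrite ptK bary_vtx//.
have [l1 e] := bary_comb (vec x) nK.
have b0 i : 0 < bary (vtx T K) i (vec x) by move/osimplexP : hx; exact.
rewrite e aff_comb// lt_neqAle sumr_ge0 ?andbT; last first.
  by move=> i _; rewrite mulr_ge0// ltW.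
rewrite eq_sym; apply/eqP => /eqP; rewrite psumr_eq0; last by move=> i _; rewrite mulr_ge0// ltW.
move=> /allP h; have := planes_neq0 mp.
rewrite (aff_bary m nK) big1 ?eqxx// => i _.
have := h i; rewrite mem_index_enum mulf_eq0 (gt_eqF (b0 i)) /= => /(_ erefl)/eqP ->.
by rewrite scale0r.
Qed.

(** Integrating a constant field of value 1 gives the absolute value of [tetdet] over 6 as
    volume. *)
Lemma leb3_osimplex_gt0 K : leb3 (osimplex (vtx T K)) != 0%E :> \bar R.
Proof.
have nK := nondeg_vtx K; apply/eqP => h.
pose n : 'M[R]_(1 + 3, 3) := col_mx (const_mx 1) 0.
have afn (v : 'rV[R]_3) : afield n v = const_mx 1.
  by rewrite /afield /ext1 mul_row_col mulmx0 addr0 mul1mx.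
have dn (v : 'rV[R]_3) : ddir n v = 0 by rewrite /ddir /n col_mxKd mulmx0.
have := integral_osimplex n (delta_mx 0 0) nK.
have d0 : dot (delta_mx 0 0 : 'rV[R]_3) 0 = 0 by rewrite dot3 !mxE; ring.
have d1 : dot (delta_mx 0 0 : 'rV[R]_3) (const_mx 1) = 1 by rewrite dot3 !mxE/=; ring.
rewrite !dn !afn d0 d1; under eq_Rintegral do rewrite afn d1.
rewrite Rintegral_cst; last exact: measurable_osimplex.
rewrite [X in 1 * X](_ : _ = 0); last exact: (congr1 fine h).
rewrite mulr0 !addr0 mul0r addr0 => /esym/eqP.
by rewrite mulf_eq0 normr_eq0 (negbTE (tetdet_neq0 nK)) mul1r invr_eq0 pnatr_eq0.
Qed.

Lemma embed_osimplex u K x : osimplex (vtx T K) x -> embed u x = polyval (u K) x.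
Proof.
move=> hx; rewrite /embed (bigD1 K)//= big1 => [|L LK].
  by rewrite indicE mem_set// scale1r addr0.
rewrite indicE memNset ?scale0r// => hL.
by have : (osimplex (vtx T L) `&` osimplex (vtx T K)) x by []; rewrite vtx_disj.
Qed.

(** On an open element [embed v] is affine. A nonzero affine function has a null zero set, so it
    cannot vanish almost everywhere on a set of positive volume. *)
Lemma gram_eq0 v : gram v v = 0 -> v = 0.
Proof.
move=> g0; apply/ffunP => K; rewrite ffunE; apply/matrixP => a j; rewrite mxE.
have nK := nondeg_vtx K; have mK := measurable_osimplex nK.
have me : measurable_fun setT (fun x => (dot (embed v x) (embed v x))%:E).
  exact: (measurable_int _ (ipHH_integrable (HH_embed v) (HH_embed v))).
have ae0 : {ae lebD D, forall x, dot (embed v x) (embed v x) = 0}.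
  have /(ae_eq_integral_abs _ measurableT me) : (\int[lebD D]_x `|(dot (embed v x) (embed v x))%:E| = 0)%E.
    under eq_integral do rewrite gee0_abs ?lee_fin ?dot_ge0//.
    by rewrite -/(nsqHH D (embed v)) nsqHHE// -/(gram v v) g0.
  by apply: filterS => x h; have [] := h Logic.I.
pose m := col j (v K).
suff m0 : m = 0 by have := congr1 (fun M : 'cV[R]_(1 + 3) => M a 0) m0; rewrite !mxE.
apply/eqP/negPn/negP => mn0.
have : (leb3 (osimplex (vtx T K)) = 0 :> \bar R)%E.
  have [N [mN N0 hN]] := ae0.
  pose S := [set x | aff m (vec x) = 0].
  have mS : measurable S.
    rewrite /S; under eq_set do rewrite aff_vec.
    by have := measurable_aff3 (m (lshift 3 0) 0) (m (rshift 1 0) 0) (m (rshift 1 1) 0) (m (rshift 1 2) 0)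
      measurableT (measurable_set1 (0 : R)); rewrite setTI.
  have S0 : leb3 S = 0%E :> \bar R.
    rewrite /S; under eq_set do rewrite aff_vec.
    apply: aff3_null; apply: contraNneq mn0 => -[h0 h1 h2 h3].
    apply/eqP/colP => k; rewrite [RHS]mxE; case: (split_ordP k) => k' ->; first by rewrite [k']ord1.
    case: k' => -[|[|[|//]]] hk; [rewrite -[RHS]h1|rewrite -[RHS]h2|rewrite -[RHS]h3];
      congr (m (rshift 1 _) 0); exact: val_inj.
  have ND : leb3 (N `&` dom D) = 0%E :> \bar R by exact: N0.
  apply: (@subset_measure0 _ _ _ (@leb3 R) _ ((N `&` dom D) `|` S) mK).
  - by apply: measurableU => //; apply: measurableI => //; exact: measurable_dom.
  - move=> x hx; have [Nx|Nx] := pselect (N x); first by left; split => //; exact: osimplex_dom hx.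
    right; have : dot (embed v x) (embed v x) = 0 by apply: contrapT => h; apply: Nx; exact: hN.
    move=> /dot_eq0; rewrite (embed_osimplex _ hx) => /rowP/(_ j); rewrite mxE /S/= /m => h.
    rewrite [RHS]mxE in h; rewrite -h /aff mxE; apply: eq_bigr => k _; by rewrite [col _ _ _ _]mxE.
  - have mN' : measurable (N `&` dom D) by apply: measurableI => //; exact: measurable_dom.
    exact: null_set_setU.
by apply/eqP; exact: leb3_osimplex_gt0.
Qed.

Definition Gmx := form_mx gram.

Lemma gramE u v : gram u v = (crd u *m Gmx *m (crd v)^T) 0 0.
Proof. exact: form_mxE gram_bilinear. Qed.

Lemma Gmx_sym : Gmx^T = Gmx.
Proof. by apply/matrixP => k l; rewrite !mxE gramC. Qed.

Lemma Gmx_unit : Gmx \in unitmx.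
Proof.
rewrite -row_free_unit; apply/inj_row_free => x xG.
by apply: (can_inj ofcK); apply/eqP; rewrite -subr_eq0; apply/eqP; apply: gram_eq0;
  rewrite gramE -[_ - _]addrC -scaleN1r crd_lin !ofcK scaleN1r oppr0 add0r xG mul0mx mxE.
Qed.

(** Invertibility of the Gram matrix represents every linear form. Therefore the [xget] in [pih] and
    [Mh] finds an actual solution and not its default value. *)
Lemma gram_riesz f : linear_form f -> exists w, forall v, gram w v = f v.
Proof.
move=> lf; exists (ofc ((\row_l f (dbasis l)) *m invmx Gmx)) => v.
rewrite gramE ofcK mulmxKV ?Gmx_unit// (linear_formE v lf) mxE.
by apply: eq_bigr => l _; rewrite !mxE mulrC.
Qed.

Lemma pihP (f : vfield R) : HH D f -> forall v, gram (pih T f) v = ipHH D f (embed v).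
Proof.
move=> hf; rewrite /pih; have [w hw] := gram_riesz (ipHH_embed_lin hf).
exact: (@xgetPex _ _ [set w | forall v, gram w v = ipHH D f (embed v)] (ex_intro _ w hw)).
Qed.

End DGSpace.
#[global] Hint Resolve HH_embed : core.

(** * The scheme tested against dG functions: Maxwell, noise and load forms *)

Section Forms.
Context (R : realType) (D : cuboid R) (T : mesh D).
Implicit Types (u v w : dG T) (c : R) (K L : 'I_(nel T)) (x : R3 R).

Lemma afield_lin c (h n : 'M[R]_(1 + 3, 3)) (v : 'rV[R]_3) : afield (c *: h + n) v = c *: afield h v + afield n v.
Proof. by rewrite /afield mulmxDr -scalemxAr. Qed.

Lemma ddir_lin c (h n : 'M[R]_(1 + 3, 3)) (v : 'rV[R]_3) : ddir (c *: h + n) v = c *: ddir h v + ddir n v.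
Proof.
rewrite /ddir (_ : dsubmx _ = c *: dsubmx h + dsubmx n); first by rewrite mulmxDr -scalemxAr.
by apply/matrixP => k l; rewrite !mxE.
Qed.

Lemma lsub_lin c u v K : lsubmx ((c *: u + v) K) = c *: lsubmx (u K) + lsubmx (v K).
Proof. by apply/matrixP => k l; rewrite !mxE !ffunE !mxE. Qed.

Lemma rsub_lin c u v K : rsubmx ((c *: u + v) K) = c *: rsubmx (u K) + rsubmx (v K).
Proof. by apply/matrixP => k l; rewrite !mxE !ffunE !mxE. Qed.

Lemma Epart_lin c u v K x : Epart ((c *: u + v) K) x = c *: Epart (u K) x + Epart (v K) x.
Proof. by rewrite !Epart_afield lsub_lin afield_lin. Qed.

Lemma Hpart_lin c u v K x : Hpart ((c *: u + v) K) x = c *: Hpart (u K) x + Hpart (v K) x.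
Proof. by rewrite !Hpart_afield rsub_lin afield_lin. Qed.

Lemma curlm_lin c (h n : 'M[R]_(1 + 3, 3)) : curlm (c *: h + n) = c *: curlm h + curlm n.
Proof. by apply/rowP => k; rewrite !mxE; ring. Qed.

Lemma curl_Hpart (m : 'M[R]_(1 + 3, 3 + 3)) x : curl (Hpart m) x = curlm (rsubmx m).
Proof.
have -> : Hpart m = fun y => afield (rsubmx m) (vec y) by apply/funext => y; rewrite Hpart_afield.
exact: curl_afield.
Qed.

Lemma curl_Epart (m : 'M[R]_(1 + 3, 3 + 3)) x : curl (Epart m) x = curlm (lsubmx m).
Proof.
have -> : Epart m = fun y => afield (lsubmx m) (vec y) by apply/funext => y; rewrite Epart_afield.
exact: curl_afield.
Qed.

Lemma crossDr (a b e : 'rV[R]_3) : cross e (a + b) = cross e a + cross e b.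
Proof. by apply: rV3P; rewrite [RHS]mxE !crossE !mxE; ring. Qed.
Lemma crossZr c (a e : 'rV[R]_3) : cross e (c *: a) = c *: cross e a.
Proof. by apply: rV3P; rewrite [RHS]mxE !crossE !mxE; ring. Qed.

Lemma eq_bilinear (B B' : dG T -> dG T -> R) : (forall u v, B u v = B' u v) ->
  bilinear_form B' -> bilinear_form B.
Proof. by move=> e; have -> : B = B' by apply/funext => u; apply/funext => v. Qed.

Lemma bilinearD (B B' : dG T -> dG T -> R) : bilinear_form B -> bilinear_form B' ->
  bilinear_form (fun u v => B u v + B' u v).
Proof. by move=> [l1 l2] [l3 l4]; split=> [v c u u'|u c v v']; rewrite ?l1 ?l2 ?l3 ?l4; ring. Qed.

Lemma bilinearZ a (B : dG T -> dG T -> R) : bilinear_form B -> bilinear_form (fun u v => a * B u v).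
Proof. by move=> [l1 l2]; split=> [v c u u'|u c v v']; rewrite ?l1 ?l2; ring. Qed.

Lemma bilinear_sum (I : Type) (s : seq I) (P : pred I) (B : I -> dG T -> dG T -> R) :
  (forall i, bilinear_form (B i)) -> bilinear_form (fun u v => \sum_(i <- s | P i) B i u v).
Proof.
move=> hB; split=> [v c u u'|u c v v']; rewrite mulr_sumr -big_split/=; apply: eq_bigr => i _.
  by rewrite (hB i).1.
by rewrite (hB i).2.
Qed.

Lemma volume_bilinear K (f g : dG T -> 'M[R]_(1 + 3, 3)) :
  (forall c u v, f (c *: u + v) = c *: f u + f v) -> (forall c u v, g (c *: u + v) = c *: g u + g v) ->
  bilinear_form (fun u v => \int[@leb3 R]_(x in osimplex (vtx T K)) dot (curlm (f u)) (afield (g v) (vec x))).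
Proof.
move=> lf lg; have nK := nondeg_vtx K.
split=> [v c u u'|u c v v']; rewrite !integral_osimplex//.
  by rewrite lf curlm_lin !dotDl !dotZl; ring.
by rewrite lg !afield_lin !ddir_lin !dotDr !dotZr; ring.
Qed.

Lemma surfint_bilinear (p : 'I_4 -> 'rV[R]_3) i B (g : dG T -> dG T -> R3 R -> R) : measurable B ->
  (forall u v, lbm (g u v)) ->
  (forall x, bilinear_form (fun u v => g u v x)) -> bilinear_form (fun u v => surfint p i B (g u v)).
Proof.
move=> mB lg bg; split=> [v c u u'|u c v v'].
  rewrite -surfintZ// -surfintD//; last by apply: lbmM => //; exact: lbm_cst.
  by apply: eq_surfint => x; rewrite (bg x).1.
rewrite -surfintZ// -surfintD//; last by apply: lbmM => //; exact: lbm_cst.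
by apply: eq_surfint => x; rewrite (bg x).2.
Qed.

Lemma Mform_bilinear : bilinear_form (@Mform R D T).
Proof.
have mb := measurable_boundary D.
have ms K : measurable (simplex (vtx T K)) by exact: (measurable_simplex (nondeg_vtx K)).
have lc n (F : R3 R -> 'rV[R]_3) : lbmv F -> lbmv (fun x => cross n (F x)).
  by move=> lF; apply: lbmv_cross => //; exact: lbmv_cst.
have lH w M : lbmv (Hpart (w M) : R3 R -> 'rV[R]_3) by exact: lbmv_Hpart.
have lE w M : lbmv (Epart (w M) : R3 R -> 'rV[R]_3) by exact: lbmv_Epart.
rewrite /Mform; apply: bilinearD; last first.
  apply: bilinear_sum => K; apply: bilinear_sum => i; apply: surfint_bilinear => // [u v|x].
    by apply: lbmB; apply: lbm_dot => //; exact: lc.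
  split=> [v c u u'|u c v v'] /=; set n := outnormal _ _;
    by rewrite !Epart_lin ?Hpart_lin !(crossDr, crossZr) !(dotDl, dotDr, dotZl, dotZr); ring.
apply: bilinearD; last first.
  apply: bilinearZ; apply: bilinear_sum => K; apply: bilinear_sum => L; apply: bilinear_sum => i.
  apply: surfint_bilinear => // [u v|x].
    have ljH w : lbmv (fun x => Hpart (w L) x - Hpart (w K) x) by exact: lbmvB.
    have ljE w : lbmv (fun x => Epart (w L) x - Epart (w K) x) by exact: lbmvB.
    by apply: lbmB; [apply: lbmB; [apply: lbmB|]|]; apply: lbm_dot; do ?apply: lc => //; exact: lbmvD.
  split=> [v c u u'|u c v v'] /=.
    set n := outnormal _ _.
    have jE : Epart ((c *: u + u') L) x - Epart ((c *: u + u') K) x =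
        c *: (Epart (u L) x - Epart (u K) x) + (Epart (u' L) x - Epart (u' K) x).
      by rewrite !Epart_lin scalerBr opprD addrACA.
    have jH : Hpart ((c *: u + u') L) x - Hpart ((c *: u + u') K) x =
        c *: (Hpart (u L) x - Hpart (u K) x) + (Hpart (u' L) x - Hpart (u' K) x).
      by rewrite !Hpart_lin scalerBr opprD addrACA.
    rewrite jE jH; move: (Epart (u L) x - _) (Epart (u' L) x - _) (Hpart (u L) x - _) (Hpart (u' L) x - _).
    by move=> a1 a2 a3 a4; rewrite !(crossDr _ _ n) !crossZr !dotDl !dotZl; ring.
  set n := outnormal _ _.
  have jE : Epart ((c *: v + v') L) x - Epart ((c *: v + v') K) x =
      c *: (Epart (v L) x - Epart (v K) x) + (Epart (v' L) x - Epart (v' K) x).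
    by rewrite !Epart_lin scalerBr opprD addrACA.
  have jH : Hpart ((c *: v + v') L) x - Hpart ((c *: v + v') K) x =
      c *: (Hpart (v L) x - Hpart (v K) x) + (Hpart (v' L) x - Hpart (v' K) x).
    by rewrite !Hpart_lin scalerBr opprD addrACA.
  have sE : Epart ((c *: v + v') K) x + Epart ((c *: v + v') L) x =
      c *: (Epart (v K) x + Epart (v L) x) + (Epart (v' K) x + Epart (v' L) x).
    by rewrite !Epart_lin scalerDr addrACA.
  have sH : Hpart ((c *: v + v') K) x + Hpart ((c *: v + v') L) x =
      c *: (Hpart (v K) x + Hpart (v L) x) + (Hpart (v' K) x + Hpart (v' L) x).
    by rewrite !Hpart_lin scalerDr addrACA.
  rewrite jE jH sE sH; move: (Epart (v L) x - _) (Epart (v' L) x - _) (Hpart (v L) x - _) (Hpart (v' L) x - _).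
  move: (Epart (u L) x - _) (Hpart (u L) x - _) => b1 b2 a1 a2 a3 a4.
  move: (Epart (v K) x + _) (Epart (v' K) x + _) (Hpart (v K) x + _) (Hpart (v' K) x + _) => c1 c2 c3 c4.
  by rewrite !(crossDr _ _ n) !crossZr !dotDr !dotZr; ring.
apply: bilinear_sum => K.
pose vol (f g : dG T -> 'M[R]_(1 + 3, 3)) u v :=
  \int[@leb3 R]_(x in osimplex (vtx T K)) dot (curlm (f u)) (afield (g v) (vec x)).
pose rs w := rsubmx (w K); pose ls w := lsubmx (w K).
have lrs c u v : rs (c *: u + v) = c *: rs u + rs v by exact: rsub_lin.
have lls c u v : ls (c *: u + v) = c *: ls u + ls v by exact: lsub_lin.
have e u v : \int[@leb3 R]_(x in osimplex (vtx T K)) dot (curl (Hpart (u K)) x) (Epart (v K) x)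
    - \int[@leb3 R]_(x in osimplex (vtx T K)) dot (curl (Epart (u K)) x) (Hpart (v K) x)
   = vol rs ls u v + (-1) * vol ls rs u v.
  rewrite mulN1r; congr (_ - _); apply: eq_Rintegral => x _.
    by rewrite curl_Hpart Epart_afield.
  by rewrite curl_Epart Hpart_afield.
apply: (eq_bilinear e).
by apply: bilinearD; [|apply: bilinearZ]; exact: volume_bilinear.
Qed.

Lemma MhP u v : gram (Mh u) v = Mform u v.
Proof.
rewrite /Mh; have [w hw] := gram_riesz (Mform_bilinear.2 u).
exact: (@xgetPex _ _ [set w | forall v, gram w v = Mform u v] (ex_intro _ w hw)).
Qed.

Definition noise_form (W : R3 R -> R) u v : R := ipHH D (fun x => W x *: Jmap (embed u x)) (embed v).

Lemma Jmap_lin c (a b : 'rV[R]_(3 + 3)) : Jmap (c *: a + b) = c *: Jmap a + Jmap b.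
Proof.
rewrite /Jmap scale_row_mx add_row_mx; congr row_mx; first by apply/rowP => k; rewrite !mxE; ring.
by apply/rowP => k; rewrite !mxE.
Qed.

Lemma dot_Jmap (a : 'rV[R]_(3 + 3)) : dot (Jmap a) a = 0.
Proof.
rewrite /dot big_split_ord /= -big_split/= big1// => i _.
by rewrite /Jmap row_mxEl row_mxEr !mxE; ring.
Qed.

Lemma HH_noise (W : R3 R -> R) u : L2 D W -> HH D (fun x => W x *: Jmap (embed u x)).
Proof.
move=> lW i; under eq_fun do rewrite mxE mulrC; apply: L2_lbmM => //.
rewrite /Jmap; have le := lbmv_embed u.
case: (split_ordP i) => j ->.
  by under eq_fun do rewrite row_mxEl !mxE; apply: lbmN; exact: le.
by under eq_fun do rewrite row_mxEr !mxE; exact: le.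
Qed.

Lemma noise_bilinear (W : R3 R -> R) : L2 D W -> bilinear_form (noise_form W).
Proof.
move=> lW; split=> [v c u u'|u]; last by apply: ipHH_embed_lin; exact: HH_noise.
rewrite /noise_form.
transitivity (ipHH D (fun x => c *: (W x *: Jmap (embed u x)) + W x *: Jmap (embed u' x)) (embed v)).
  congr ipHH; apply/funext => x; rewrite embed_lin Jmap_lin scalerDr; congr (_ + _).
  by rewrite !scalerA mulrC.
have h := HH_noise u lW; have hc := HHZ c h.
by rewrite ipHHDl ?ipHHZl//; exact: HH_noise.
Qed.

Lemma noise_form_diag (W : R3 R -> R) u : noise_form W u u = 0.
Proof.
rewrite /noise_form /ipHH; under eq_Rintegral do rewrite dotZl dot_Jmap mulr0.
by rewrite Rintegral_cst// mul0r.
Qed.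

Variables (dt lambda1 : R).

Definition step_form (W : R3 R -> R) u v : R := dt / 2 * Mform u v + lambda1 / 2 * noise_form W u v.

Lemma step_bilinear W : L2 D W -> bilinear_form (step_form W).
Proof.
by move=> lW; apply: bilinearD; apply: bilinearZ; [exact: Mform_bilinear|exact: noise_bilinear].
Qed.

Lemma step_form_le0 W u : 0 < dt -> step_form W u u <= 0.
Proof.
move=> dt0; rewrite /step_form noise_form_diag mulr0 addr0.
by rewrite mulr_ge0_le0 ?Mform_le0// divr_ge0// ltW.
Qed.

Definition load_form (l : 'rV[R]_(3 + 3)) (W : R3 R -> R) v : R :=
  ipL2 D W (fun x => dot l (embed v x)).

Lemma lbm_dot_embed (l : 'rV[R]_(3 + 3)) v : lbm (fun x => dot l (embed v x)).
Proof. by apply: lbm_dot; [exact: lbmv_cst|exact: lbmv_embed]. Qed.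

Lemma load_formE l W v : load_form l W v = ipHH D (fun x => W x *: l) (embed v).
Proof. by apply: eq_Rintegral => x _; rewrite dotZl. Qed.

Lemma HH_load l (W : R3 R -> R) : L2 D W -> HH D (fun x => W x *: l).
Proof.
by move=> lW i; under eq_fun do rewrite mxE mulrC; exact: L2Z.
Qed.

Lemma dot_cauchy n (a b : 'rV[R]_n) : dot a b ^+ 2 <= dot a a * dot b b.
Proof.
apply: discriminant_bound; [exact: dot_ge0..|move=> t].
have := dot_ge0 (a - t *: b).
rewrite !dotBr ![dot (a - _) _]dotC !dotBr !dotZr (dotC _ a) !dotZr.
by rewrite ?dotZl ?(dotC b a); congr (_ <= _); ring.
Qed.

(** Cauchy-Schwarz twice, for functions on [D] and pointwise for the vector [l]; the constant does
    not see the mesh. *)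
Lemma load_form_bound l W v : L2 D W ->
  load_form l W v ^+ 2 <= ipL2 D W W * dot l l * gram v v.
Proof.
move=> lW; have hl := lbm_dot_embed l v.
apply: (le_trans (ipL2_cauchy lW (L2_lbm D hl))); rewrite -mulrA ler_wpM2l ?ipL2_ge0//.
have e1 := nsqL2E (L2_lbm D hl); have e2 := nsqHHE (HH_embed v).
rewrite -lee_fin EFinM -e1 /gram -e2 /nsqHH -ge0_integralZl ?lee_fin ?dot_ge0//.
- apply: le_ge0_integral => [x|||x].
  + by rewrite lee_fin sqr_ge0.
  + by apply: measurable_sqr; case: hl.
  + apply: emeasurable_funM => //.
    exact: (measurable_int _ (ipHH_integrable (HH_embed v) (HH_embed v))).
  + by rewrite -EFinM lee_fin dot_cauchy.
- exact: (measurable_int _ (ipHH_integrable (HH_embed v) (HH_embed v))).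
- by move=> x _; rewrite lee_fin dot_ge0.
Qed.

Lemma scheme_form (e : R) (W1 W2 : R3 R -> R) (l : 'rV[R]_(3 + 3)) u u' : L2 D W1 -> L2 D W2 ->
  u' - e *: u = (dt / 2) *: (Mh u' + e *: Mh u)
      + (lambda1 / 2) *: pih T (fun x => W1 x *: Jmap (embed (u' + e *: u) x))
      + pih T (fun x => W2 x *: l) ->
  forall v, gram u' v - step_form W1 u' v = e * (gram u v + step_form W1 u v) + load_form l W2 v.
Proof.
move=> l1 l2 h v; have [gl _] := gram_bilinear T.
have gN c w : gram (c *: w) v = c * gram w v.
  by have := gl v c w 0; rewrite addr0 => ->; have := gl v (-1) 0 0; rewrite scaler0 addr0 mulN1r addNr => ->; rewrite addr0.
have gD w w' : gram (w + w') v = gram w v + gram w' v by have := gl v 1 w w'; rewrite scale1r mul1r.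
have g2 (A B C E : dG T) a b c f : gram A v = a -> gram B v = b -> gram C v = c -> gram E v = f ->
    u' - e *: u = (dt / 2) *: (A + e *: B) + (lambda1 / 2) *: C + E ->
    gram u' v - e * gram u v = dt / 2 * (a + e * b) + lambda1 / 2 * c + f.
  move=> <- <- <- <- /(congr1 (fun w => gram w v)); rewrite gD -scaleN1r !gN mulN1r => ->.
  by rewrite 2!gD !gN gD gN.
have := g2 _ _ _ _ _ _ _ _ (MhP u' v) (MhP u v) (pihP (HH_noise (u' + e *: u) l1) v) (pihP (HH_load l l2) v) h.
rewrite -/(noise_form W1 (u' + e *: u) v) -load_formE.
have -> : noise_form W1 (u' + e *: u) v = noise_form W1 u' v + e * noise_form W1 u v.
  by rewrite addrC (noise_bilinear l1).1 addrC.
rewrite /step_form; move: (gram u' v) (gram u v) (Mform u' v) (Mform u v).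
by move: (noise_form W1 u' v) (noise_form W1 u v) (load_form l W2 v) => *; lra.
Qed.

End Forms.

(** * Resolvents of dissipative matrices *)

Section ResolventStep.
Variables (R : realType) (N : nat) (G L : 'M[R]_N).
Implicit Types (x y z : 'rV[R]_N).

Definition mxform (A : 'M[R]_N) x y : R := (x *m A *m y^T) 0 0.

Lemma mxformDl A x y z : mxform A (x + y) z = mxform A x z + mxform A y z.
Proof. by rewrite /mxform !mulmxDl mxE. Qed.

Lemma mxformZl A c x y : mxform A (c *: x) y = c * mxform A x y.
Proof. by rewrite /mxform -!scalemxAl mxE. Qed.

Lemma mxform_trmx A x y : mxform A x y = mxform A^T y x.
Proof.
by rewrite /mxform -[in LHS](trmxK (x *m A *m y^T)) mxE !trmx_mul trmxK mulmxA.
Qed.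

Hypotheses (Gsym : G^T = G) (Gge0 : forall x, 0 <= mxform G x x)
  (Gdef : forall x, mxform G x x = 0 -> x = 0) (Lle0 : forall x, mxform L x x <= 0).

Lemma mxformC x y : mxform G x y = mxform G y x.
Proof. by rewrite mxform_trmx Gsym. Qed.

Lemma mxformDr x y z : mxform G x (y + z) = mxform G x y + mxform G x z.
Proof. by rewrite mxformC mxformDl !(mxformC x). Qed.

Lemma mxformB (A B : 'M[R]_N) x y : mxform (A - B) x y = mxform A x y - mxform B x y.
Proof. by rewrite /mxform mulmxBr mulmxBl mxE; congr (_ + _); rewrite mxE. Qed.

Lemma mxformD (A B : 'M[R]_N) x y : mxform (A + B) x y = mxform A x y + mxform B x y.
Proof. by rewrite /mxform mulmxDr mulmxDl mxE. Qed.

Lemma mxform_mul (A B : 'M[R]_N) x y : x *m A = y *m B -> forall z, mxform A x z = mxform B y z.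
Proof. by move=> e z; rewrite /mxform e. Qed.

(** For a kernel vector x the values G(x, x) >= 0 and L(x, x) <= 0 coincide, so both are 0. *)
Lemma resolvent_unit : G - L \in unitmx.
Proof.
rewrite -row_free_unit; apply/inj_row_free => x xk; apply: Gdef; apply/eqP.
have h : mxform (G - L) x x = 0 by rewrite /mxform xk mul0mx mxE.
by rewrite eq_le Gge0 andbT; move: h; rewrite mxformB => /eqP; rewrite subr_eq0 => /eqP ->.
Qed.

(** The relation reads (y - x) G = (x + y) L. Paired with x + y, its left side is the difference of
    the squared norms of [y] and [x], and its right side is nonpositive. *)
Lemma resolvent_contraction x y : y *m (G - L) = x *m (G + L) -> mxform G y y <= mxform G x x.
Proof.
move=> e; have h z : mxform G y z - mxform L y z = mxform G x z + mxform L x z.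
  by rewrite -mxformB -mxformD; exact: mxform_mul.
have := h y; have := h x.
have := Lle0 (x + y); rewrite mxformDl {1 2}/mxform linearD /= !mulmxDr ![X in X + _]mxE ![X in _ + X]mxE.
rewrite -!/(mxform _ _ _) (mxformC y x).
by move: (mxform L _ _) (mxform L _ _) (mxform L _ _) (mxform L _ _) (mxform G _ _) (mxform G _ _)
  (mxform G _ _) => *; lra.
Qed.

(** Test with [y] itself: its squared norm is at most the load applied to [y], whose square is at
    most [c] times the squared norm. *)
Lemma resolvent_bound (g y : 'rV[R]_N) c : 0 <= c -> y *m (G - L) = g ->
  (forall z, (g *m z^T) 0 0 ^+ 2 <= c * mxform G z z) -> mxform G y y <= c.
Proof.
move=> c0 e h; have := h y; rewrite -e -/(mxform (G - L) y y) mxformB.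
move: (Lle0 y) (Gge0 y); move: (mxform L _ _) (mxform G _ _) => l a l0 a0.
have la : a <= a - l by lra.
have : a ^+ 2 <= (a - l) ^+ 2 by rewrite ler_sqr ?nnegrE // (le_trans a0).
rewrite expr2 => h1 /(le_trans h1).
have [->//|a1] := eqVneq a 0.
by rewrite ler_pM2r // lt_neqAle eq_sym a1.
Qed.

Lemma mxform_cauchy x y : mxform G x y ^+ 2 <= mxform G x x * mxform G y y.
Proof.
apply: discriminant_bound; [exact: Gge0 | exact: Gge0 | move=> t].
have := Gge0 (x + (- t) *: y).
rewrite mxformDl !mxformDr !mxformZl (mxformC x (_ *: y)) (mxformC y (_ *: y)) !mxformZl (mxformC y x).
by move: (mxform _ _ _) (mxform _ _ _) (mxform _ _ _) => a b c h; lra.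
Qed.

End ResolventStep.

(** * Measurability of matrix operations *)

Section MeasurableMatrices.
Variables (R : realType) (d : measure_display) (X : measurableType d).

Definition mx_measurable m n (A : X -> 'M[R]_(m, n)) :=
  forall i j, measurable_fun setT (fun w => A w i j).

(** Inversion is continuous away from 0 and has the conventional value 0 at 0, so the two parts are
    treated separately. *)
Lemma measurable_inv (f : X -> R) : measurable_fun setT f -> measurable_fun setT (fun x => (f x)^-1).
Proof.
move=> mf; apply: (@measurableT_comp _ _ _ _ _ _ (fun x : R => x^-1)) mf.
have -> : (fun x : R => x^-1) = (fun x => if x == 0 then 0 else x^-1).
  by apply/funext => x; case: eqP => // ->; rewrite invr0.
apply: measurable_fun_if => //.
- by apply: (measurable_fun_bool true); rewrite setTI;
    have -> : (fun x : R => x == 0) @^-1` [set true] = [set 0] by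
      apply/seteqP; split=> x /=; [move/eqP | move=> ->; rewrite eqxx].
- have -> : setT `&` (fun x : R => x == 0) @^-1` [set false] = ~` [set 0].
    by apply/seteqP; split=> x /=; [case=> _ /eqP | move/eqP/negbTE].
  apply: open_continuous_measurable_fun; first by apply: closed_openC; apply: compact_closed => //; exact: compact_set1.
  by move=> x /set_mem /= /eqP x0; exact: inv_continuous.
Qed.

Lemma mx_measurable_cst m n (A : 'M[R]_(m, n)) : mx_measurable (cst A).
Proof. by move=> i j; exact: measurable_cst. Qed.

Lemma mx_measurableD m n (A B : X -> 'M[R]_(m, n)) :
  mx_measurable A -> mx_measurable B -> mx_measurable (fun w => A w + B w).
Proof.
by move=> mA mB i j; under eq_fun do rewrite mxE; apply: measurable_funD.
Qed.

Lemma mx_measurableZ m n (c : X -> R) (A : X -> 'M[R]_(m, n)) :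
  measurable_fun setT c -> mx_measurable A -> mx_measurable (fun w => c w *: A w).
Proof.
by move=> mc mA i j; under eq_fun do rewrite mxE; apply: measurable_funM.
Qed.

Lemma mx_measurableN m n (A : X -> 'M[R]_(m, n)) : mx_measurable A -> mx_measurable (fun w => - A w).
Proof. by move=> mA i j; under eq_fun do rewrite mxE; apply: measurableT_comp. Qed.

Lemma mx_measurableB m n (A B : X -> 'M[R]_(m, n)) :
  mx_measurable A -> mx_measurable B -> mx_measurable (fun w => A w - B w).
Proof. by move=> mA mB; apply: mx_measurableD => //; exact: mx_measurableN. Qed.

Lemma mx_measurableT m n (A : X -> 'M[R]_(m, n)) : mx_measurable A -> mx_measurable (fun w => (A w)^T).
Proof. by move=> mA i j; under eq_fun do rewrite mxE; exact: mA. Qed.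

Lemma mx_measurableM m n p (A : X -> 'M[R]_(m, n)) (B : X -> 'M[R]_(n, p)) :
  mx_measurable A -> mx_measurable B -> mx_measurable (fun w => A w *m B w).
Proof.
move=> mA mB i j; under eq_fun do rewrite mxE.
by apply: measurable_sum => k; apply: measurable_funM.
Qed.

Lemma measurable_det n (A : X -> 'M[R]_n) : mx_measurable A -> measurable_fun setT (fun w => \det (A w)).
Proof.
move=> mA; apply: measurable_sum => s; apply: measurable_funM; first exact: measurable_cst.
by apply: measurable_prod => i _; exact: mA.
Qed.

Lemma mx_measurable_adj n (A : X -> 'M[R]_n) : mx_measurable A -> mx_measurable (fun w => \adj (A w)).
Proof.
move=> mA i j; under eq_fun do rewrite mxE /cofactor.
apply: measurable_funM; first exact: measurable_cst.
by apply: measurable_det => k l; under eq_fun do rewrite !mxE; exact: mA.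
Qed.

(** Cramer's rule expresses the inverse through determinants, which are polynomials in the
    entries. *)
Lemma mx_measurable_inv n (A : X -> 'M[R]_n) : (forall w, A w \in unitmx) ->
  mx_measurable A -> mx_measurable (fun w => invmx (A w)).
Proof.
move=> uA mA; have -> : (fun w => invmx (A w)) = fun w => (\det (A w))^-1 *: \adj (A w).
  by apply/funext => w; rewrite /invmx uA.
by apply: mx_measurableZ; [apply: measurable_inv; exact: measurable_det | exact: mx_measurable_adj].
Qed.

End MeasurableMatrices.

(** * Independence and Gaussian increments *)

Section Independence.
Context {R : realType} {d : measure_display} {Omega : measurableType d}.
Variable (P : probability Omega R).

(** The restriction of [P] to [B] and the multiple of [P] by the probability of [B] are finite
    measures that agree on an intersection-stable generator. *)
Lemma g_sigma_algebra_indep (G0 : set (set Omega)) (B : set Omega) : setI_closed G0 -> G0 setT ->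
  G0 `<=` measurable -> measurable B ->
  (forall A, G0 A -> P (A `&` B) = (P A * P B)%E) ->
  forall A, <<s G0>> A -> P (A `&` B) = (P A * P B)%E.
Proof.
move=> GI GT Gm mB h A GA; have mA : measurable A by exact: (smallest_sub (@sigma_algebra_measurable _ Omega) Gm GA).
have fB : (0 <= fine (P B))%R by rewrite fine_ge0.
pose m1 := mrestr P mB; pose m2 := mscale (NngNum fB) P.
have e C : m2 C = (P C * P B)%E by rewrite /m2 /mscale /= muleC fineK ?fin_num_measure.
have -> : P (A `&` B) = m1 A by [].
rewrite -e.
apply: (g_sigma_algebra_measure_unique G0 Gm (fun=> setT) _ _ m1 m2) => //.
- by rewrite bigcup_const//; exists 0%N.
- by move=> C GC; exact: etrans (h _ GC) (esym (e C)).
- by move=> _; apply: (@le_lt_trans _ _ 1%E); [apply: probability_le1; exact: measurableI | exact: ltry].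
Qed.

Context {d1 : measure_display} {T1 : measurableType d1}.
Variables (p : Omega -> T1) (W : Omega -> R).
Hypotheses (mp : measurable_fun setT p) (mW : measurable_fun setT W).
Hypothesis indep : forall (A : set T1) (B : set (measurableTypeR R)), measurable A -> measurable B ->
  P (p @^-1` A `&` W @^-1` B) = (P (p @^-1` A) * P (W @^-1` B))%E.

(** By independence the joint law is a product measure, and Fubini integrates out the centred
    factor. The target of [p] is arbitrary so that [p] may be the identity onto [Omega] with a
    smaller sigma-algebra. *)
Lemma indep_integral_mul0 (Z : T1 -> R) : measurable_fun setT Z ->
  P.-integrable setT (EFin \o W) -> (\int[P]_w (W w)%:E = 0)%E ->
  P.-integrable setT (fun w => (Z (p w) * W w)%:E) ->
  (\int[P]_w (Z (p w) * W w)%:E = 0)%E.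
Proof.
move=> mZ iW W0 iZW.
pose p' : {mfun Omega >-> T1} := HB.pack p (isMeasurableFun.Build _ _ _ _ p mp).
have mWR : measurable_fun setT (W : Omega -> measurableTypeR R) := mW.
pose W' : {mfun Omega >-> measurableTypeR R} := HB.pack (W : Omega -> measurableTypeR R)
  (isMeasurableFun.Build _ _ _ (measurableTypeR R) W mWR).
pose m1 := distribution P p'; pose m2 := distribution P W'.
have mpW : measurable_fun setT (fun w => (p w, W w : measurableTypeR R)) by apply/measurable_fun_pairP.
pose m := measure_function_pushforward__canonical__measure_function_Measure P mpW.
have me X : measurable X -> (m1 \x m2)%E X = m X.
  by apply: (@product_measure_unique _ _ _ _ _ m1 m2 m) => A B mA mB; exact: indep.
pose f (z : T1 * measurableTypeR R) : \bar R := (Z z.1 * z.2)%:E.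
have mf : measurable_fun setT f.
  apply/measurable_EFinP; apply: measurable_funM; last exact: measurable_snd.
  by apply: measurableT_comp mZ _; exact: measurable_fst.
have im : m.-integrable setT f by apply: (integrable_pushforward mpW).
have ef (g : T1 * measurableTypeR R -> \bar R) : (\int[m]_z g z = \int[m1 \x m2]_z g z)%E.
  by apply: eq_measure_integral => X mX _; exact: esym (me X mX).
have im' : (m1 \x m2)%E.-integrable setT f.
  by case/integrableP: im => _ h; apply/integrableP; split=> //; rewrite -ef.
transitivity (\int[m]_z f z)%E.
  by rewrite (integral_pushforward mpW).
rewrite ef -(@integral12_prod_meas1 _ _ _ _ _ m1 m2 _ im').
apply: integral0_eq => x _; rewrite /fubini_F /f /=.
under eq_integral do rewrite EFinM.
have iid : m2.-integrable setT (fun y => y%:E).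
  by apply: (integrable_pushforward mWR) => //; apply/measurable_EFinP; exact: measurable_id.
rewrite integralZl//.
have -> : (\int[m2]_y y%:E = 0)%E.
  by rewrite /m2 (integral_pushforward mWR)//; apply/measurable_EFinP; exact: measurable_id.
by rewrite mule0.
Qed.

End Independence.

Section SigmaProcess.
Context {R : realType} {d : measure_display} {Omega : measurableType d}.
Implicit Types (X : R -> Omega -> R).

Definition generators X : set (set Omega) := [set G | exists t (A : set (measurableTypeR R)),
  [/\ 0 <= t, measurable A & G = X t @^-1` A]].

Lemma sigma_process_algebra X : sigma_algebra setT (sigma_process X).
Proof. exact: smallest_sigma_algebra. Qed.

Lemma sigma_processT X : sigma_process X setT.
Proof. by have [h0 hC _] := sigma_process_algebra X; rewrite -(setD0 setT); exact: hC. Qed.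

Lemma sigma_processI X A B : sigma_process X A -> sigma_process X B -> sigma_process X (A `&` B).
Proof. by move=> hA hB; apply: (@measurableI _ (g_sigma_algebraType (generators X))). Qed.

Lemma sigma_process_increment X s t (A : set (measurableTypeR R)) : 0 <= s -> 0 <= t -> measurable A ->
  sigma_process X ((fun w => X t w - X s w) @^-1` A).
Proof.
move=> s0 t0 mA.
have m r : 0 <= r -> measurable_fun setT (X r : g_sigma_algebraType (generators X) -> R).
  by move=> r0 _ B mB; rewrite setTI; apply: sub_gen_smallest; exists r, B.
by have := measurable_funB (m t t0) (m s s0) measurableT mA; rewrite setTI.
Qed.

End SigmaProcess.

(** * One Brownian motion up to time t, together with all the others *)

Section PastSigmaAlgebra.
Context {R : realType} {d : measure_display} {Omega : measurableType d}.
Variables (P : probability Omega R) (F : R -> set (set Omega)) (filtF : is_filtration F).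
Variables (I : choiceType) (X : I -> R -> Omega -> R).
Hypotheses (BM : forall j, is_BM P F (X j)) (indepX : independent_processes P X).
Variables (j0 : I) (t : R) (t0 : 0 <= t).

(* Events known without the increments of [X j0] after time [t], up to null sets. *)
Definition past : set (set Omega) := [set A | measurable A /\
  exists (s : seq I) (Aj : I -> set Omega) (C : set Omega),
  [/\ uniq s, j0 \notin s, forall j, j \in s -> sigma_process (X j) (Aj j),
      sigma_process (X j0) C /\ F t C &
      {ae P, forall w, A w <-> (\bigcap_(j in [set` s]) Aj j) w /\ C w}]].

Lemma BM_measurable j r : 0 <= r -> measurable_fun setT (X j r).
Proof.
move=> r0 _ A mA; rewrite setTI; have [_ _ h _ _] := BM j.
have [/(_ _ r0)[_ Fm] _] := filtF; apply: Fm; exact: h.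
Qed.

Lemma sigma_process_measurable j A : sigma_process (X j) A -> measurable A.
Proof.
apply: smallest_sub; first exact: sigma_algebra_measurable.
by move=> _ [r [B [r0 mB ->]]]; rewrite -[_ @^-1` _]setTI; exact: BM_measurable.
Qed.

Lemma filtration_measurable A : F t A -> measurable A.
Proof. by have [/(_ _ t0)[_ h] _] := filtF; exact: h. Qed.

Lemma filtrationT : F t setT.
Proof. by have [/(_ _ t0)[[h0 hC _] _] _] := filtF; rewrite -(setD0 setT); exact: hC. Qed.

Lemma filtrationI A B : F t A -> F t B -> F t (A `&` B).
Proof.
have [/(_ _ t0)[sF _] _] := filtF => FA FB.
have [h0 hC hU] := sF; have FAC := hC _ FA; have FBC := hC _ FB.
rewrite -[A `&` B]setCK setCI -[~` (_ `|` _)]setTD; apply: hC.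
by rewrite -bigcup2E; apply: hU => -[|[|n]] //=; rewrite -setTD.
Qed.

Lemma pastT : past setT.
Proof.
split=> //; exists [::], (fun=> setT), setT; split=> //.
  by split; [exact: sigma_processT | exact: filtrationT].
by apply: aeW => w /=; split.
Qed.

Lemma pastI : setI_closed past.
Proof.
move=> A B [mA [s [Aj [C [us js hs [hC FC] eA]]]]] [mB [s' [Bj [C' [us' js' hs' [hC' FC'] eB]]]]].
split; first exact: measurableI.
exists (undup (s ++ s')), (fun j => (if j \in s then Aj j else setT) `&` (if j \in s' then Bj j else setT)),
  (C `&` C'); split.
- exact: undup_uniq.
- by rewrite mem_undup mem_cat negb_or js.
- move=> j _; apply: sigma_processI; case: ifP => h; try exact: sigma_processT.
    exact: hs.
  exact: hs'.
- by split; [exact: sigma_processI | exact: filtrationI].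
apply: filterS2 eA eB => w eA eB; split.
  move=> [/eA[hA cw] /eB[hB cw']]; split=> //= j _ /=.
  by split; case: ifP => // h; [exact: hA | exact: hB].
move=> [/= h [cw cw']]; split.
  apply/eA; split=> // j /= js1; have /h[/= +] : j \in undup (s ++ s') by rewrite mem_undup mem_cat js1.
  by rewrite js1.
apply/eB; split=> // j /= js1; have /h[/= _] : j \in undup (s ++ s') by rewrite mem_undup mem_cat js1 orbT.
by rewrite js1.
Qed.

Lemma past_measurable : past `<=` measurable.
Proof. by move=> A []. Qed.

Lemma probability_ae_eq (A B : set Omega) : measurable A -> measurable B ->
  {ae P, forall w, A w <-> B w} -> P A = P B.
Proof.
move=> mA mB [N [mN PN hN]].
have e C : measurable C -> P C = P (C `\` N).
  move=> mC; rewrite (measureDI P mC mN) [X in (_ + X)%E](_ : _ = 0%E) ?adde0//.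
  by apply: (@subset_measure0 _ _ _ P _ N) => //; exact: measurableI.
rewrite (e A mA) (e B mB); congr (P _); apply/seteqP; split=> w [h nN]; split=> //.
  by have [/(_ h)] : A w <-> B w by apply: contrapT => /hN.
by have [_ /(_ h)] : A w <-> B w by apply: contrapT => /hN.
Qed.

(** Independence of the processes separates the events of the other motions from those of [X j0];
    among the latter, the increment is independent of the event in [F t]. The null sets allowed in
    [past] do not change probabilities. *)
Lemma past_indep r (E : set (measurableTypeR R)) : t < r -> measurable E ->
  forall A, past A -> P (A `&` (fun w => X j0 r w - X j0 t w) @^-1` E) =
    (P A * P ((fun w => X j0 r w - X j0 t w)%R @^-1` E))%E.
Proof.
move=> tr mE A [mA [s [Aj [C [us js hs [hC FC] eA]]]]].
set W := _ @^-1` E.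
have sW : sigma_process (X j0) W by apply: sigma_process_increment => //; exact: le_trans (ltW tr).
have mW := sigma_process_measurable sW; have mC := filtration_measurable FC.
have mS : measurable (\bigcap_(j in [set` s]) Aj j).
  by apply: fin_bigcap_measurable => // j /= /hs; exact: sigma_process_measurable.
have split D : sigma_process (X j0) D ->
    P ((\bigcap_(j in [set` s]) Aj j) `&` D) = (P D * \prod_(j <- s) P (Aj j))%E.
  move=> hD; have := indepX (s := j0 :: s) (A := fun j => if j == j0 then D else Aj j).
  rewrite /= js us big_cons eqxx => /(_ isT) h.
  have -> : (\bigcap_(j in [set` s]) Aj j) `&` D =
      \bigcap_(j in [set` j0 :: s]) (if j == j0 then D else Aj j).
    apply/seteqP; split=> w.
      move=> [h1 h2] j /=; rewrite inE; case: (eqVneq j j0) => [//|_ /= js1]; exact: h1.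
    move=> h1; split; last by have := h1 j0; rewrite /= inE eqxx; exact.
    move=> j /= js1; have := h1 j; rewrite /= inE js1 orbT => /(_ isT).
    by case: eqP js1 => // -> js1; rewrite js1 in js.
  rewrite h; last first.
    by move=> j; rewrite inE; case: (eqVneq j j0) => [-> //|_ /= js1]; exact: hs.
  congr (_ * _)%E; rewrite big_seq [in RHS]big_seq; apply: eq_bigr => j js1.
  by case: eqP js1 => // -> js1; rewrite js1 in js.
have [_ _ _ _ /(_ _ _ t0 tr E C mE FC) /= hind] := BM j0.
transitivity (P ((\bigcap_(j in [set` s]) Aj j) `&` (C `&` W))).
  apply: probability_ae_eq; [exact: measurableI | by apply: measurableI => //; exact: measurableI |].
  apply: filterS eA => w e; split=> [[/e[? ?] ?]|[? [? ?]]]; first by split.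
  by split=> //; apply/e.
rewrite split; last exact: sigma_processI.
have -> : P A = P ((\bigcap_(j in [set` s]) Aj j) `&` C).
  by apply: probability_ae_eq => //; exact: measurableI.
by rewrite split// hind muleAC.
Qed.

Definition past_type := g_sigma_algebraType past.

Definition past_fun (f : Omega -> R) := measurable_fun setT (f : past_type -> R).

(** Every measurable null event belongs to [past], being almost everywhere equal to the empty set; a
    modification adds and removes only such events. *)
Lemma past_ae (A B : set Omega) : <<s past>> A -> measurable B ->
  {ae P, forall w, A w <-> B w} -> <<s past>> B.
Proof.
move=> hA mB [N [mN PN hN]].
have mA : measurable A := smallest_sub (@sigma_algebra_measurable _ Omega) past_measurable hA.
have null C : measurable C -> C `<=` N -> <<s past>> C.
  move=> mC CN; apply: sub_gen_smallest; split=> //.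
  exists [::], (fun=> setT), set0; split=> //.
    split; first by have [] := sigma_process_algebra (X j0).
    by have [/(_ _ t0)[[]]] := filtF.
  exists N; split=> // w /=; apply: contra_notP => nN; split=> [/CN//|[]//].
have -> : B = (A `\` (A `\` B)) `|` (B `\` A).
  by rewrite setDD; apply/seteqP; split=> w /= => [hb|[[]|[]]//]; have [ha|ha] := pselect (A w); [left|right].
apply: (@measurableU _ past_type).
  apply: (@measurableD _ past_type) => //; apply: null; first exact: measurableD.
  by move=> w [Aw nB]; apply: hN => -[/(_ Aw)].
apply: null; first exact: measurableD.
by move=> w [Bw nA]; apply: hN => -[_ /(_ Bw)].
Qed.

Lemma past_fun_measurable f : past_fun f -> measurable_fun setT f.
Proof.
move=> hf _ A mA; have := hf measurableT A mA.
exact: (smallest_sub (@sigma_algebra_measurable _ Omega) past_measurable).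
Qed.

Lemma past_fun_ae f g : past_fun f -> measurable_fun setT g -> {ae P, forall w, f w = g w} -> past_fun g.
Proof.
move=> hf mg e _ A mA; apply: (past_ae (hf measurableT A mA)); first exact: mg.
by apply: filterS e => w ew; split=> -[_ h]; split=> //; move: h; rewrite /= ew.
Qed.

(** The exceptional null set is itself in the generated sigma-algebra, so cutting it off makes the
    convergence hold everywhere. *)
Lemma past_fun_cvg (f : nat -> Omega -> R) (g : Omega -> R) : (forall m, past_fun (f m)) -> measurable_fun setT g ->
  {ae P, forall w, f ^~ w @ \oo --> g w} -> past_fun g.
Proof.
move=> hf mg [N [mN PN hN]].
have hNp : <<s past>> N.
  apply: (@past_ae set0) => //; first by have [] := smallest_sigma_algebra setT past.
  by exists N; split=> // w /=; apply: contra_notP => nN; split.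
have i1 : past_fun (\1_(~` N)).
  by apply: (@measurable_indic _ past_type); apply: (@measurableC _ past_type).
have : past_fun (fun w => g w * \1_(~` N) w).
  apply: (@measurable_fun_cvg _ past_type R setT (fun m w => f m w * \1_(~` N) w)).
    by move=> m; apply: (@measurable_funM _ past_type) => //; exact: hf.
  move=> w _; rewrite indicE; case: (boolP (w \in ~` N)) => [/set_mem nN|_].
    rewrite mulr1; under eq_fun do rewrite mulr1; apply: contrapT => h; apply: nN; exact: hN.
  by rewrite mulr0; under eq_fun do rewrite mulr0; exact: cvg_cst.
move=> h; apply: (past_fun_ae h mg); exists N; split=> // w /=; apply: contra_notP => nN.
by rewrite indicE mem_set ?mulr1.
Qed.

Lemma past_fun_other j r : j != j0 -> 0 <= r -> past_fun (X j r).
Proof.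
move=> jj r0 _ A mA; rewrite setTI; apply: sub_gen_smallest.
have sA : sigma_process (X j) (X j r @^-1` A) by apply: sub_gen_smallest; exists r, A.
split; first exact: sigma_process_measurable sA.
exists [:: j], (fun=> X j r @^-1` A), setT; split=> //.
- by rewrite inE eq_sym.
- by move=> j' /[!inE] /eqP ->.
- by split; [exact: sigma_processT | exact: filtrationT].
apply: aeW => w; split=> [h|[h _]]; first by split=> // j' /=.
by apply: (h j); rewrite /= inE.
Qed.

Lemma past_fun_before r : 0 <= r -> r <= t -> past_fun (X j0 r).
Proof.
move=> r0 rt _ A mA; rewrite setTI; apply: sub_gen_smallest.
have sA : sigma_process (X j0) (X j0 r @^-1` A) by apply: sub_gen_smallest; exists r, A.
split; first exact: sigma_process_measurable sA.
exists [::], (fun=> setT), (X j0 r @^-1` A); split=> //.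
  split=> //; have [_ /(_ _ _ r0 rt)] := filtF; apply.
  by have [_ _ h _ _] := BM j0; exact: h.
by apply: aeW => w; split=> [h|[]//]; split.
Qed.

Lemma past_orthogonal r (Z : Omega -> R) : t < r -> past_fun Z ->
  P.-integrable setT (fun w => (X j0 r w - X j0 t w)%:E) ->
  (\int[P]_w (X j0 r w - X j0 t w)%R%:E = 0)%E ->
  P.-integrable setT (fun w => (Z w * (X j0 r w - X j0 t w))%:E) ->
  (\int[P]_w (Z w * (X j0 r w - X j0 t w))%R%:E = 0)%E.
Proof.
move=> tr mZ iW W0 iZW.
have mid : measurable_fun setT (idfun : Omega -> past_type).
  move=> _ A mA; rewrite setTI.
  exact: (smallest_sub (@sigma_algebra_measurable _ Omega) past_measurable mA).
have mW : measurable_fun setT (fun w => X j0 r w - X j0 t w).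
  by apply: measurable_funB; apply: BM_measurable => //; exact: le_trans (ltW tr).
apply: (indep_integral_mul0 mid mW _ mZ iW W0 iZW) => A B mA mB.
apply: (g_sigma_algebra_indep pastI pastT past_measurable _ _ mA); last exact: past_indep.
by rewrite -[_ @^-1` _]setTI; exact: mW.
Qed.

End PastSigmaAlgebra.

(** * Moments of Gaussian increments *)

Section GaussianMoments.
Context {R : realType}.
Notation mR := (measurableTypeR R).

Lemma ge0_integral_normal (s : R) (f : mR -> \bar R) : measurable_fun setT f -> (forall x, 0 <= f x)%E ->
  (\int[normal_prob 0 s]_x f x = \int[@lebesgue_measure R]_x (f x * (normal_pdf 0 s x)%:E))%E.
Proof.
move=> mf f0; have dom := normal_prob_dominates 0 s.
rewrite -(Radon_Nikodym_SigmaFinite.change_of_variables dom f0 measurableT mf).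
have ig := Radon_Nikodym_SigmaFinite.f_integrable dom.
have mp : measurable_fun setT (fun x : mR => (normal_pdf 0 s x)%:E).
  by apply/measurable_EFinP; exact: measurable_normal_pdf.
apply: ae_eq_integral => //.
- by apply: emeasurable_funM => //; exact: measurable_int ig.
- exact: emeasurable_funM.
apply: ae_eqe_mul2l; apply: integral_ae_eq => // A _ mA.
by rewrite -(Radon_Nikodym_SigmaFinite.f_integral dom mA).
Qed.

(** Half of the exponent absorbs the square: y <= exp y for y = x^2 / (4 s^2) costs a factor 4 s^2.
    The other half is at most the exponent for standard deviation 2 s, whose peak is half as high;
    this gives the 8. *)
Lemma normal_pdf_sqr_le (s x : R) : 0 < s -> x ^+ 2 * normal_pdf 0 s x <= 8 * s ^+ 2 * normal_pdf 0 (2 * s) x.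
Proof.
move=> s0; rewrite !normal_pdfE ?mulf_neq0 ?gt_eqF// /normal_fun subr0.
have -> : normal_peak (2 * s) = normal_peak s / 2.
  rewrite /normal_peak -invfM; congr (_^-1).
  have -> : (2 * s) ^+ 2 * pi *+ 2 = 2 ^+ 2 * (s ^+ 2 * pi *+ 2) by ring.
  by rewrite sqrtrM ?sqr_ge0// sqrtr_sqr ger0_norm// mulrC.
have p0 := normal_peak_ge0 s.
set a := - x ^+ 2 / (s ^+ 2 *+ 2); set b := - x ^+ 2 / ((2 * s) ^+ 2 *+ 2).
have s2 : 0 < s ^+ 2 by rewrite exprn_gt0.
have ab : a = (a / 2) + (a / 2) by field.
have ba : a / 2 <= b.
  have -> : b = a / 4 by rewrite /a /b; field; rewrite gt_eqF.
  have : a <= 0 by rewrite /a mulNr oppr_le0 divr_ge0 ?sqr_ge0// mulrn_wge0// ltW.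
  by lra.
have x2 : x ^+ 2 * expR (a / 2) <= 4 * s ^+ 2.
  have -> : a / 2 = - (x ^+ 2 / (4 * s ^+ 2)) by rewrite /a; field; rewrite gt_eqF.
  rewrite expRN ler_pdivrMr ?expR_gt0// mulrC -ler_pdivrMr ?mulr_gt0//.
  by apply: le_trans (expR_ge1Dx _); rewrite lerDr.
have e1 : expR a = expR (a / 2) * expR (a / 2) by rewrite {1}ab expRD.
have e2 : expR (a / 2) <= expR b by rewrite ler_expR.
rewrite e1; have ea := expR_ge0 (a / 2).
have -> : x ^+ 2 * (normal_peak s * (expR (a / 2) * expR (a / 2))) =
  normal_peak s * ((x ^+ 2 * expR (a / 2)) * expR (a / 2)) by ring.
have -> : 8 * s ^+ 2 * (normal_peak s / 2 * expR b) = normal_peak s * (4 * s ^+ 2 * expR b) by field.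
apply: ler_wpM2l => //; apply: le_trans (_ : _ <= 4 * s ^+ 2 * expR (a / 2)) _.
  exact: ler_wpM2r.
by apply: ler_wpM2l => //; rewrite mulr_ge0// ltW.
Qed.

Lemma normal_second_moment_le (s : R) : 0 < s ->
  (\int[normal_prob 0 s]_x (x ^+ 2)%:E <= (8 * s ^+ 2)%:E)%E.
Proof.
move=> s0; have m2 : measurable_fun setT (fun x : mR => (x ^+ 2)%:E).
  by apply/measurable_EFinP; apply: measurable_funX.
rewrite ge0_integral_normal//; last by move=> x; rewrite lee_fin sqr_ge0.
have mp t : measurable_fun setT (fun x : mR => (normal_pdf 0 t x)%:E).
  by apply/measurable_EFinP; exact: measurable_normal_pdf.
have c0 : (0 <= (8 * s ^+ 2)%:E)%E by rewrite lee_fin mulr_ge0 ?sqr_ge0.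
apply: (@le_trans _ _ (\int[@lebesgue_measure R]_x ((8 * s ^+ 2)%:E * (normal_pdf 0 (2 * s) x)%:E))%E).
  apply: le_ge0_integral.
  - by move=> x; rewrite mule_ge0// lee_fin ?sqr_ge0// normal_pdf_ge0.
  - exact: emeasurable_funM.
  - by apply: emeasurable_funM => //; exact: measurable_cst.
  - by move=> x; rewrite -!EFinM lee_fin; exact: normal_pdf_sqr_le.
rewrite ge0_integralZl//; first by rewrite integral_normal_pdf mule1.
by move=> x _; rewrite lee_fin normal_pdf_ge0.
Qed.

Lemma normal_prob_oppr (s : R) (A : set mR) : 0 < s -> measurable A ->
  normal_prob 0 s ((fun x : mR => - x : mR) @^-1` A) = normal_prob 0 s A.
Proof.
move=> s0 mA; rewrite /normal_prob integral_mkcond [RHS]integral_mkcond.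
have a0 : (- 1 : R) != 0 by rewrite oppr_eq0 oner_eq0.
have [_ _ h] := cov_affine1 0 a0.
rewrite [RHS]h; last 2 first.
- apply/(measurable_restrictT _ _).1 => //; apply: measurable_funTS.
  by apply/measurable_EFinP; exact: measurable_normal_pdf.
- by move=> x; rewrite patchE; case: ifP => // _; rewrite lee_fin normal_pdf_ge0.
rewrite normrN1 mul1e; apply: eq_integral => x _; rewrite !patchE mulN1r addr0.
have -> : ((- x : mR) \in A) = (x \in (fun x : mR => - x : mR) @^-1` A).
  by apply/idP/idP => /set_mem h1; exact: mem_set.
by case: ifP => // _; rewrite !normal_pdfE ?gt_eqF// /normal_fun !subr0 sqrrN.
Qed.

Context {d : measure_display} {Omega : measurableType d} (P : probability Omega R).
Variables (W : Omega -> R) (s : R).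
Hypotheses (mW : measurable_fun setT W) (s0 : 0 < s)
  (law : forall A : set mR, measurable A -> P (W @^-1` A) = normal_prob 0 s A).

Let mWR : measurable_fun setT (W : Omega -> mR) := mW.

Lemma gaussian_second_moment_le : (\int[P]_w (W w ^+ 2)%:E <= (8 * s ^+ 2)%:E)%E.
Proof.
apply: le_trans (normal_second_moment_le s0).
pose m := measure_function_pushforward__canonical__measure_function_Measure P mWR.
rewrite [leRHS](eq_measure_integral m); last by move=> A mA _; exact: esym (law mA).
rewrite ge0_integral_pushforward//; first by apply/measurable_EFinP; apply: measurable_funX.
by move=> y _; rewrite lee_fin sqr_ge0.
Qed.

Lemma sqi_gaussian : sqi P W.
Proof. by split=> //; apply: le_lt_trans gaussian_second_moment_le (ltry _). Qed.

Lemma sqi_cst (c : R) : sqi P (cst c).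
Proof. split; first exact: measurable_cst.
by under eq_integral do rewrite /cst; rewrite integral_cst//= [X in (_ * X)%E](_ : _ = 1%E) ?mule1 ?ltry//; exact: probability_setT. Qed.

Lemma sqi_integrable (f : Omega -> R) : sqi P f -> P.-integrable setT (EFin \o f).
Proof.
move=> sf; have := sqi_mul_integrable sf (sqi_cst 1); apply: eq_integrable => // x _.
by rewrite mulr1.
Qed.

(** The law is symmetric, so the mean equals its own negative; it is finite because the second
    moment is. *)
Lemma gaussian_mean0 : (\int[P]_w (W w)%:E = 0)%E.
Proof.
have iW := sqi_integrable sqi_gaussian.
pose m := measure_function_pushforward__canonical__measure_function_Measure P mWR.
have mN : measurable_fun setT (fun x : mR => - x : mR) by apply: measurableT_comp.
have mid : measurable_fun setT (fun x : mR => x%:E) by apply/measurable_EFinP.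
pose m' := measure_function_pushforward__canonical__measure_function_Measure m mN.
have im : m.-integrable setT (fun x => x%:E) by exact: (integrable_pushforward mWR).
have imN : m.-integrable setT (fun x : mR => (- x)%:E).
  by apply: eq_integrable (integrableN im).
have e : (\int[P]_w (W w)%:E = \int[m]_x x%:E)%E by rewrite (integral_pushforward mWR).
have e2 : (\int[m]_x x%:E = - \int[m]_x x%:E)%E.
  rewrite -[in RHS]integralN; last exact: integrable_add_def.
  transitivity (\int[m']_x x%:E)%E; last by rewrite (integral_pushforward mN).
  apply: eq_measure_integral => A mA _; rewrite /= /pushforward.
  have mA' : measurable ((fun x : mR => - x : mR) @^-1` A) by have := mN measurableT A mA; rewrite setTI.
  by rewrite (law mA) (law mA') normal_prob_oppr.
have : (\int[m]_x x%:E \is a fin_num)%E := integrable_fin_num measurableT im.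
rewrite e; move: e2; move: (\int[m]_x _)%E => [r||] //= /eqP; rewrite eqe => /eqP rr _.
by congr EFin; lra.
Qed.

End GaussianMoments.

(** * Expansion of the noise in eigenfunctions *)

Section Eigenfunctions.
Variables (R : realType) (D : cuboid R).
Implicit Types (f g : R3 R -> R).

Lemma eqD_ipL2 f f' g : L2 D f -> L2 D f' -> L2 D g -> eqD D f f' -> ipL2 D f g = ipL2 D f' g.
Proof.
move=> /L2P hf /L2P hf' /L2P hg e; rewrite /ipL2 /Rintegral; congr fine.
apply: ae_eq_integral => //.
- exact: measurable_int (sqi_mul_integrable hf hg).
- exact: measurable_int (sqi_mul_integrable hf' hg).
by apply: filterS e => x ex _; rewrite ex.
Qed.

Lemma ipL2_eq0 f : L2 D f -> ipL2 D f f = 0 -> eqD D f (cst 0).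
Proof.
move=> hf f0; have [mf _] := (L2P D f).1 hf.
have : (\int[lebD D]_x `|((f x) ^+ 2)%:E| = 0)%E.
  rewrite -[RHS](congr1 EFin f0) -(nsqL2E hf); apply: eq_integral => x _.
  by rewrite gee0_abs// lee_fin sqr_ge0.
move/(ae_eq_integral_abs _ measurableT (measurable_sqr mf)).1.
apply: filterS => x /(_ I) [] /eqP; rewrite sqrf_eq0 => /eqP; exact.
Qed.

(** Put r = sqrt eta and f = S q - r q; then S f = - r f. If r > 0, positivity of [S] forces f = 0;
    if r = 0, self-adjointness gives |S q|^2 = <S S q, q> = 0. *)
Lemma sqrt_op_eigen (Q S : (R3 R -> R) -> R3 R -> R) (q : R3 R -> R) (eta : R) :
  is_sqrt_op D S Q -> L2 D q -> 0 <= eta -> eqD D (Q q) (fun x => eta * q x) ->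
  L2 D (S q) /\ eqD D (S q) (fun x => Num.sqrt eta * q x).
Proof.
move=> [[[SL2 Slin _] Ssa Spos] SS] hq eta0 Qq.
have hSq := SL2 _ hq; split=> //.
set r := Num.sqrt eta; have r0 : 0 <= r := sqrtr_ge0 _.
have r2 : r * r = eta by rewrite -expr2 sqr_sqrtr.
pose f x := - r * q x + S q x.
have hf : L2 D f by apply: L2D => //; exact: L2Z.
have hSSq := SL2 _ hSq.
have SSq : eqD D (S (S q)) (fun x => eta * q x).
  by apply: filterS2 (SS _ hq) Qq => x -> ->.
have Sf : eqD D (S f) (fun x => - r * f x).
  apply: filterS2 (Slin (- r) q (S q) hq hSq) SSq => x -> ->.
  by rewrite /f -r2; ring.
have hrf : L2 D (fun x => - r * f x) by exact: L2Z.
have e1 : ipL2 D (S f) f = - r * ipL2 D f f.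
  by rewrite (eqD_ipL2 _ hrf hf Sf) ?ipL2Zl//; exact: SL2.
have f0 : ipL2 D f f = 0.
  have ff : 0 <= ipL2 D f f by exact: ipL2_ge0.
  have [rz|rnz] := eqVneq r 0.
    have fE : eqD D f (S q) by apply: aeW => x; rewrite /f rz oppr0 mul0r add0r.
    rewrite (eqD_ipL2 hf hSq hf fE) ipL2C (eqD_ipL2 hf hSq hSq fE) Ssa// ipL2C.
    have hz : L2 D (fun x => 0 * q x) by exact: L2Z.
    rewrite (eqD_ipL2 hSSq hz hq); last by apply: filterS SSq => x ->; rewrite -r2 rz mul0r.
    by rewrite ipL2Zl// mul0r.
  have := Spos f hf; rewrite e1 mulNr oppr_ge0 pmulr_rle0 ?lt_neqAle 1?eq_sym ?rnz//.
  by move=> h; apply/eqP; rewrite eq_le h ff.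
apply: filterS (ipL2_eq0 hf f0) => x; rewrite /f /= => h.
by apply/eqP; rewrite -subr_eq0 -h; apply/eqP; ring.
Qed.

Variable q : nat -> R3 R -> R.
Hypothesis onbq : onb D q.

Lemma onb_L2 k : L2 D (q k). Proof. by have [h _ _] := onbq. Qed.

Lemma onb_ip j k : ipL2 D (q j) (q k) = (j == k)%:R.
Proof. by have [_ h _] := onbq. Qed.

Lemma L2_partial_sum (c : nat -> R) n : L2 D (fun x => \sum_(k < n) c k * q k x).
Proof. by apply: L2_sumr => k; apply: L2Z; exact: onb_L2. Qed.

Lemma ip_partial_sum (c : nat -> R) n g : L2 D g ->
  ipL2 D (fun x => \sum_(k < n) c k * q k x) g = \sum_(k < n) c k * ipL2 D (q k) g.
Proof.
move=> hg; rewrite ipL2_suml//; last by move=> k; apply: L2Z; exact: onb_L2.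
by apply: eq_bigr => k _; rewrite ipL2Zl//; exact: onb_L2.
Qed.

Lemma ip_partial_sum_onb (c : nat -> R) n k : (k < n)%N ->
  ipL2 D (fun x => \sum_(k < n) c k * q k x) (q k) = c k.
Proof.
move=> kn; rewrite ip_partial_sum; last exact: onb_L2.
rewrite (bigD1 (Ordinal kn)) //= onb_ip eqxx mulr1 big1 ?addr0// => j jk.
by rewrite onb_ip (_ : (j == k :> nat) = false) ?mulr0//; apply: negbTE.
Qed.

Lemma partial_sum_sqr (c : nat -> R) n :
  ipL2 D (fun x => \sum_(k < n) c k * q k x) (fun x => \sum_(k < n) c k * q k x) = \sum_(k < n) c k ^+ 2.
Proof.
rewrite ip_partial_sum; last exact: L2_partial_sum.
by apply: eq_bigr => k _; rewrite ipL2C ip_partial_sum_onb// expr2.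
Qed.

(** Parseval's identity in polarised form: the remainder of the expansion of [f] tends to 0 in norm,
    and Cauchy-Schwarz pairs it with [g]. *)
Lemma onb_cvg f g : L2 D f -> L2 D g ->
  (fun n => \sum_(k < n) ipL2 D f (q k) * ipL2 D (q k) g) @ \oo --> ipL2 D f g.
Proof.
move=> hf hg; have [_ _ /(_ _ hf) h] := onbq.
pose S n x := \sum_(k < n) ipL2 D f (q k) * q k x.
have hS n : L2 D (S n) by exact: (L2_partial_sum (fun k => ipL2 D f (q k))).
have ipS n : ipL2 D (S n) g = \sum_(k < n) ipL2 D f (q k) * ipL2 D (q k) g.
  exact: (ip_partial_sum (fun k => ipL2 D f (q k))).

have hfS n : L2 D (fun x => f x - S n x) by exact: L2B.
pose e n := ipL2 D (fun x => f x - S n x) (fun x => f x - S n x).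
have e0 : e @ \oo --> 0.
  have -> : e = fine \o (fun n => nsqL2 D (fun x => f x - S n x)).
    by apply/funext => n /=; rewrite (nsqL2E (hfS n)).
  exact: fine_cvg.
have -> : (fun n => \sum_(k < n) ipL2 D f (q k) * ipL2 D (q k) g) =
    fun n => ipL2 D f g - ipL2 D (fun x => f x - S n x) g.
  apply/funext => n; rewrite ipL2Bl// opprB addrC subrK.
  by rewrite ipS.
rewrite -[X in _ --> X]subr0; apply: cvgB; first exact: cvg_cst.
apply/cvgr0Pnorm_lt => eps eps0.
have : \forall n \near \oo, `|e n| < eps ^+ 2 / (ipL2 D g g + 1).
  have g1 : 0 < ipL2 D g g + 1 by rewrite ltr_wpDl// ipL2_ge0.
  by move/cvgr0Pnorm_lt : e0; apply; rewrite divr_gt0// exprn_gt0.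
apply: filterS => n; have en : 0 <= e n by exact: ipL2_ge0.
have gg : 0 <= ipL2 D g g by exact: ipL2_ge0.
rewrite ger0_norm// ltr_pdivlMr ?ltr_wpDl// => hn.
rewrite -ltr_sqr ?nnegrE ?normr_ge0 ?(ltW eps0)// real_normK ?num_real//.
apply: le_lt_trans (ipL2_cauchy (hfS n) hg) _; rewrite -/(e n).
by apply: le_lt_trans hn; apply: ler_wpM2l => //; rewrite lerDl.
Unshelve. all: by end_near.
Qed.

End Eigenfunctions.

(** * Coefficients of random variables with values in L^2(D) *)

Section RandomCoefficients.
Context {R : realType} {d : measure_display} {Omega : measurableType d}.
Variables (P : probability Omega R) (D : cuboid R).
Implicit Types (X : Omega -> R3 R -> R) (f g : R3 R -> R).

Lemma L2_rv_L2 X w : L2_rv D X -> L2 D (X w).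
Proof. by case. Qed.

Lemma ipL2_polar f g : L2 D f -> L2 D g -> ipL2 D (fun x => f x - g x) (fun x => f x - g x) =
  ipL2 D f f - 2 * ipL2 D f g + ipL2 D g g.
Proof.
move=> hf hg; have hfg : L2 D (fun x => f x - g x) by exact: L2B.
rewrite ipL2Bl// (ipL2C D f) (ipL2C D g) !ipL2Bl// (ipL2C D g f).
by move: (ipL2 D f f) (ipL2 D f g) (ipL2 D g g) => *; ring.
Qed.

Lemma L2_rv_measurable_dist X f : L2_rv D X -> L2 D f ->
  measurable_fun setT (fun w => ipL2 D (fun x => X w x - f x) (fun x => X w x - f x)).
Proof.
move=> [hX mX] hf; apply: (measurability (@RGenInftyO.G R)); first exact: RGenInftyO.measurableE.
move=> _ [_ [r ->] <-]; rewrite setTI.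
rewrite (_ : _ @^-1` _ = [set w | (nsqL2 D (fun x => X w x - f x)%R < r%:E)%E]); first exact: mX.
by apply/seteqP; split=> w /=; rewrite in_itv /= (nsqL2E (L2B (hX w) hf)) lte_fin.
Qed.

(** Measurability is given for balls only, that is for distances; polarisation recovers scalar
    products. *)
Lemma L2_rv_measurable_ip X f : L2_rv D X -> L2 D f -> measurable_fun setT (fun w => ipL2 D (X w) f).
Proof.
move=> rX hf; have h0 : L2 D (cst 0) by exact: L2_cst.
have e w : ipL2 D (X w) f = 2^-1 * (ipL2 D (fun x => X w x - cst 0 x) (fun x => X w x - cst 0 x) +
    ipL2 D f f - ipL2 D (fun x => X w x - f x) (fun x => X w x - f x)).
  have -> : (fun x => X w x - cst 0 x) = X w by apply/funext => x; rewrite /= subr0.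
  rewrite (ipL2_polar (L2_rv_L2 w rX) hf).
  by move: (ipL2 D (X w) (X w)) (ipL2 D (X w) f) (ipL2 D f f) => *; field.
rewrite (funext e); apply: measurable_funM; first exact: measurable_cst.
apply: measurable_funB; last exact: L2_rv_measurable_dist.
by apply: measurable_funD; [exact: L2_rv_measurable_dist | exact: measurable_cst].
Qed.

Lemma L2_rv_measurable_sqr X : L2_rv D X -> measurable_fun setT (fun w => ipL2 D (X w) (X w)).
Proof.
move=> rX; have := L2_rv_measurable_dist rX (L2_cst D 0).
by apply: eq_measurable_fun => w _; rewrite (_ : (fun x => X w x - 0) = X w)//; apply/funext => x;
  rewrite subr0.
Qed.

Variable q : nat -> R3 R -> R.
Hypothesis onbq : onb D q.

(** Once n > k, the coefficient k of the partial sum no longer changes. Its squared distance to that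
    of [X] is at most the squared L^2 distance, whose expectation tends to 0. *)
Lemma L2_sum_coefficient X (c : nat -> Omega -> R) (f : nat -> R3 R -> R) (m : nat -> R) :
  L2_sum P D X c f -> (forall k, measurable_fun setT (c k)) -> (forall k, L2 D (f k)) ->
  (forall k, eqD D (f k) (fun x => m k * q k x)) ->
  {ae P, forall w k, ipL2 D (X w) (q k) = c k w * m k}.
Proof.
move=> [rX cv] mc hf fq; apply/ae_foralln => k.
have hq j : L2 D (q j) by exact: onb_L2.
have hX w : L2 D (X w) by exact: L2_rv_L2.
pose S n w x := \sum_(j < n) c j w * f j x.
have hS n w : L2 D (S n w) by apply: L2_sumr => j; exact: L2Z.
have hXS n w : L2 D (fun x => X w x - S n w x) by exact: L2B.
pose G n w := ipL2 D (fun x => X w x - S n w x) (fun x => X w x - S n w x).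
pose Dk w := ipL2 D (X w) (q k) - c k w * m k.
have ipS n w g : L2 D g -> ipL2 D (S n w) g = \sum_(j < n) c j w * ipL2 D (f j) g.
  move=> hg; rewrite ipL2_suml//; last by move=> j; exact: L2Z.
  by apply: eq_bigr => j _; rewrite ipL2Zl.
have mG n : measurable_fun setT (G n).
  have -> : G n = fun w => ipL2 D (X w) (X w) - 2 * (\sum_(j < n) c j w * ipL2 D (X w) (f j)) +
      \sum_(j < n) c j w * \sum_(i < n) c i w * ipL2 D (f i) (f j).
    apply/funext => w; rewrite /G ipL2_polar//; congr (_ - _ * _ + _).
      by rewrite ipL2C ipS//; apply: eq_bigr => j _; rewrite ipL2C.
    by rewrite ipS//; apply: eq_bigr => j _; rewrite ipL2C ipS.
  apply: measurable_funD; last first.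
    apply: measurable_sum => j; apply: measurable_funM => //.
    by apply: measurable_sum => i; apply: measurable_funM => //; exact: measurable_cst.
  apply: measurable_funB; first exact: L2_rv_measurable_sqr.
  apply: measurable_funM; first exact: measurable_cst.
  by apply: measurable_sum => j; apply: measurable_funM (mc j) (L2_rv_measurable_ip rX (hf j)).
have mD : measurable_fun setT Dk.
  apply: measurable_funB; first exact: L2_rv_measurable_ip.
  by apply: measurable_funM => //; exact: measurable_cst.
have DG n w : (k < n)%N -> Dk w ^+ 2 <= G n w.
  move=> kn; have -> : Dk w = ipL2 D (fun x => X w x - S n w x) (q k).
    rewrite ipL2Bl// ipS//; congr (_ - _).
    rewrite (bigD1 (Ordinal kn))//= big1 ?addr0; last first.
      move=> j jk; rewrite (eqD_ipL2 (hf j) (L2Z (m j) (hq j)) (hq k) (fq j)) ipL2Zl//.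
      by rewrite onb_ip// (_ : (j == k :> nat) = false) ?mulr0//; apply: negbTE.
    rewrite (eqD_ipL2 (hf k) (L2Z (m k) (hq k)) (hq k) (fq k)) ipL2Zl//.
    by rewrite onb_ip// eqxx mulr1.
  apply: le_trans (ipL2_cauchy (hXS n w) (hq k)) _.
  by rewrite onb_ip// eqxx mulr1.
have D0 : (\int[P]_w (Dk w ^+ 2)%:E = 0)%E.
  apply/eqP; rewrite eq_le; apply/andP; split; last first.
    by apply: integral_ge0 => w _; rewrite lee_fin sqr_ge0.
  apply: (cvge_ge _ cv); near=> n.
  apply: le_ge0_integral.
  - by move=> w; rewrite lee_fin sqr_ge0.
  - exact: measurable_sqr.
  - by under eq_fun do rewrite (nsqL2E (hXS n _)); apply/measurable_EFinP; exact: mG.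
  - by move=> w; rewrite (nsqL2E (hXS n w)) lee_fin; apply: DG; near: n; exact: nbhs_infty_gt.
have : (\int[P]_w `|(Dk w ^+ 2)%:E| = 0)%E.
  by rewrite -[RHS]D0; apply: eq_integral => w _; rewrite gee0_abs// lee_fin sqr_ge0.
move/(ae_eq_integral_abs _ measurableT (measurable_sqr mD)).1.
apply: filterS => w /(_ I) [] /eqP; rewrite sqrf_eq0 subr_eq0 => /eqP; exact.
Unshelve. all: by end_near.
Qed.

End RandomCoefficients.

(** * Test functions *)

Section FlatFunctions.
Variable R : realType.
Implicit Types (p : {poly R}) (t y : R) (f g : R -> R).

Lemma poly_le_expR p : exists2 C, 0 <= C & forall y, 0 <= y -> `|p.[y]| <= C * expR y.
Proof.
exists (\sum_(i < size p) `|p`_i| * i`!%:R); first by apply: sumr_ge0 => i _; rewrite mulr_ge0.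
move=> y y0; rewrite horner_coef mulr_suml; apply: le_trans (ler_norm_sum _ _ _) _.
apply: ler_sum => i _; rewrite normrM -mulrA; apply: ler_wpM2l => //.
rewrite ger0_norm ?exprn_ge0//; case: (nat_of_ord i) => [|n].
  by rewrite expr0 mul1r; apply: le_trans (expR_ge1Dx y); rewrite lerDl.
rewrite mulrC -ler_pdivrMr ?ltr0n ?fact_gt0//; apply: le_trans (expR_ge1Dxn n y0).
by rewrite lerDr.
Qed.

(** The family p(1/t) exp(-1/t), extended by 0, is closed under differentiation, which sends p to
    X^2 (p - p'). Hence the point 0 needs only one argument for derivatives of all orders. *)
Definition flat p t : R := if 0 < t then p.[t^-1] * expR (- t^-1) else 0.

(** A quadratic bound is enough for the difference quotient at 0 to tend to 0. It comes from the
    domination of the polynomial p X^2 by the exponential, at 1/t. *)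
Lemma flat_bound p : exists2 C, 0 <= C & forall t, `|flat p t| <= C * t ^+ 2.
Proof.
have [C C0 hC] := poly_le_expR (p * 'X^2); exists C => // t.
rewrite /flat; case: ifP => t0; last by rewrite normr0 mulr_ge0// sqr_ge0.
have y0 : 0 < t^-1 by rewrite invr_gt0.
have := hC _ (ltW y0); rewrite hornerM hornerXn normrM (ger0_norm (exprn_ge0 _ (ltW y0))).
rewrite exprVn ler_pdivrMr ?exprn_gt0// => h.
by rewrite normrM expRN (ger0_norm (_ : 0 <= (expR t^-1)^-1)) ?invr_ge0 ?expR_ge0// ler_pdivrMr ?expR_gt0//
  mulrAC.
Qed.

Lemma is_derive_flat p t : is_derive t 1 (flat p) (flat ('X^2 * (p - p^`())) t).
Proof.
have [t0|t0|->] := ltgtP t 0.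
- apply: (@near_eq_is_derive _ _ _ (cst 0)).
    near=> s; rewrite /flat ltNge (_ : s <= 0)//; apply: ltW; near: s; exact: lt_nbhsl.
  by rewrite /flat ltNge (ltW t0); exact: is_derive_cst.
- apply: (@near_eq_is_derive R R^o R^o (fun s : R => p.[s^-1] * expR (- s^-1))).
    by near=> s; rewrite /flat (_ : 0 < s)//; near: s; exact: lt_nbhsr.
  have t1 : t != 0 by rewrite gt_eqF.
  have d1 : is_derive t 1 (fun s : R => s^-1) (- t ^- 2).
    by have h := @is_deriveV R id t 1 1 t1 (is_derive_id t 1); rewrite -[X in is_derive _ _ _ X]scaler1; exact: h.
  have d2 := @is_derive1_comp R (horner p) (fun s => s^-1) t _ _ (is_derive_poly p t^-1) d1.
  have d3 : is_derive t 1 (fun s : R => - s^-1) (t ^- 2) by rewrite -[t ^- 2]opprK; exact: is_deriveN.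
  have d4 := @is_derive1_comp R expR (fun s => - s^-1) t _ _ (is_derive_expR _) d3.
  have := is_deriveM d2 d4; set v := (X in is_derive _ _ _ X) => d5.
  suff -> : flat ('X^2 * (p - p^`())) t = v by exact: d5.
  rewrite /v.
  rewrite /flat t0 /= !hornerE /GRing.scale /=.
  by rewrite -!exprVn; move: (t^-1) (p.[_]) (p^`().[_]) (expR _) => y a b c; ring.
have -> : flat ('X^2 * (p - p^`())) 0 = 0 by rewrite /flat ltxx.
have [C C0 hC] := flat_bound p; have C1 : 0 < C + 1 by rewrite ltr_wpDl.
have cv : h^-1 *: ((flat p \o shift (0 : R)) (h *: (1 : R)) - flat p 0) @[h --> 0^'] --> (0 : R).
  apply/cvgr0Pnorm_lt => e e0; near=> h.
  have h0 : h != 0 by near: h; exact: nbhs_dnbhs_neq.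
  rewrite /= addr0 {2}/flat ltxx subr0 scaler1 /GRing.scale /= normrM normfV mulrC.
  rewrite ltr_pdivrMr ?normr_gt0//; apply: le_lt_trans (hC h) _.
  rewrite -real_normK ?num_real// expr2 mulrA ltr_pM2r ?normr_gt0//.
  have : `|h| < e / (C + 1) by near: h; apply: dnbhs0_lt; rewrite divr_gt0.
  rewrite ltr_pdivlMr// mulrC => /le_lt_trans; apply.
  by apply: ler_wpM2r => //; rewrite lerDl.
by apply: DeriveDef; [apply/cvg_ex; exists 0 | exact: cvg_lim].
Unshelve. all: by end_near.
Qed.

(* A class of smooth functions of one variable that contains bumps. *)
Inductive flatgen : (R -> R) -> Prop :=
| flatgen_base p a b : flatgen (fun t => flat p (a * t + b))
| flatgenD f g : flatgen f -> flatgen g -> flatgen (fun t => f t + g t)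
| flatgenM f g : flatgen f -> flatgen g -> flatgen (fun t => f t * g t).

Lemma flatgen_derive f : flatgen f -> exists2 f', flatgen f' & forall t, is_derive t 1 f (f' t).
Proof.
elim=> [p a b | f1 g1 _ [f1' hf1 df1] _ [g1' hg1 dg1] | f1 g1 hf [f1' hf1 df1] hg [g1' hg1 dg1]].
- exists (fun t => flat (a *: ('X^2 * (p - p^`()))) (a * t + b)); first exact: flatgen_base.
  move=> t; have da : is_derive t 1 (fun s : R => a * s + b) a.
    by apply: is_derive_eq; rewrite addr0 /GRing.scale /= mulr1.
  have := @is_derive1_comp R (flat p) (fun s => a * s + b) t _ _ (is_derive_flat p _) da.
  rewrite /comp => h; apply: is_derive_eq; rewrite /flat; case: ifP => _; last by rewrite mul0r.
  by rewrite hornerZ mulrC mulrA.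
- by exists (fun t => f1' t + g1' t); [exact: flatgenD | move=> t; exact: is_deriveD].
exists (fun t => f1 t * g1' t + g1 t * f1' t); first by apply: flatgenD; exact: flatgenM.
by move=> t; exact: is_deriveM.
Qed.

Lemma flatgen_continuous f : flatgen f -> continuous f.
Proof.
move=> /flatgen_derive[f' _ df] t; apply: differentiable_continuous; apply/derivable1_diffP.
by have [] := df t.
Qed.

End FlatFunctions.

Section TensorTestFunctions.
Variable R : realType.
Implicit Types (f g : R -> R) (x : R3 R).

(** A directional derivative sees the function along a line only, which reduces partial derivatives
    of tensor products to one variable. *)
Lemma is_derive_line (F : R * R * R -> R^o) g (x v : R * R * R) (t l : R) :
  (forall h : R, F (h *: v + x) = g (h + t)) -> is_derive t 1 g l -> is_derive x v F l.
Proof.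
move=> FG [dg vg]; have F0 : F x = g t by have := FG 0; rewrite scale0r !add0r.
have e : (fun h : R => h^-1 *: ((F \o shift x) (h *: v) - F x)) =
    (fun h : R => h^-1 *: ((g \o shift t) (h *: (1 : R)) - g t)).
  by apply/funext => h /=; rewrite FG F0 /GRing.scale /= mulr1.
by split; rewrite /derivable /derive e.
Qed.

Definition tensor f1 f2 f3 x : R := f1 x.1.1 * f2 x.1.2 * f3 x.2.

Lemma tensor_derive (i : 'I_3) f1 f2 f3 : flatgen f1 -> flatgen f2 -> flatgen f3 ->
  exists g1 g2 g3, [/\ flatgen g1, flatgen g2, flatgen g3 &
    forall x : R * R * R, is_derive x (dirv R i) (tensor f1 f2 f3 : R * R * R -> R^o) (tensor g1 g2 g3 x)].
Proof.
move=> h1 h2 h3; have [g1 hg1 d1] := flatgen_derive h1.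
have [g2 hg2 d2] := flatgen_derive h2; have [g3 hg3 d3] := flatgen_derive h3.
case: i => [[|[|[|//]]] lt].
- exists g1, f2, f3; split=> // -[[a b] c]; rewrite /tensor /=.
  apply: (@is_derive_line _ (fun t => (f2 b * f3 c) * f1 t) _ _ a) => [h|].
    by rewrite /dirv /pt !mxE /= /GRing.scale /= !mulr0 !add0r mulr1; ring.
  have h := d1 a; have := @is_deriveZ _ _ _ f1 (f2 b * f3 c) a 1 (g1 a) h.
  by rewrite /GRing.scale /= => k; apply: is_derive_eq; ring.
- exists f1, g2, f3; split=> // -[[a b] c]; rewrite /tensor /=.
  apply: (@is_derive_line _ (fun t => (f1 a * f3 c) * f2 t) _ _ b) => [h|].
    by rewrite /dirv /pt !mxE /= /GRing.scale /= !mulr0 !add0r mulr1; ring.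
  have h := d2 b; have := @is_deriveZ _ _ _ f2 (f1 a * f3 c) b 1 (g2 b) h.
  by rewrite /GRing.scale /= => k; apply: is_derive_eq; ring.
- exists f1, f2, g3; split=> // -[[a b] c]; rewrite /tensor /=.
  apply: (@is_derive_line _ (fun t => (f1 a * f2 b) * f3 t) _ _ c) => h.
  by rewrite /dirv /pt !mxE /= /GRing.scale /= !mulr0 !add0r mulr1; ring.
Qed.

Lemma tensor_continuous f1 f2 f3 : flatgen f1 -> flatgen f2 -> flatgen f3 ->
  continuous (tensor f1 f2 f3 : R * R * R -> R^o).
Proof.
move=> /flatgen_continuous c1 /flatgen_continuous c2 /flatgen_continuous c3 x.
apply: cvgM; first apply: cvgM.
- apply: (@continuous_comp _ _ _ (fun y : R * R * R => y.1.1) f1 x _ (c1 _)).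
  by apply: (@continuous_comp _ _ _ fst fst x); exact: cvg_fst.
- apply: (@continuous_comp _ _ _ (fun y : R * R * R => y.1.2) f2 x _ (c2 _)).
  by apply: (@continuous_comp _ _ _ fst snd x); [exact: cvg_fst | exact: cvg_snd].
- by apply: (@continuous_comp _ _ _ snd f3 x _ (c3 _)); exact: cvg_snd.
Qed.

Lemma smooth_tensor f1 f2 f3 : flatgen f1 -> flatgen f2 -> flatgen f3 -> smooth (tensor f1 f2 f3).
Proof.
move=> h1 h2 h3 s.
suff [g1 [g2 [g3 [k1 k2 k3 ->]]]] : exists g1 g2 g3, [/\ flatgen g1, flatgen g2, flatgen g3 &
    foldr (@pd R) (tensor f1 f2 f3) s = tensor g1 g2 g3].
  split; first exact: tensor_continuous.
  by move=> i x; have [? [? [? [_ _ _ /(_ x)[]]]]] := tensor_derive i k1 k2 k3.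
elim: s => [|i s [g1 [g2 [g3 [k1 k2 k3 /= ->]]]]]; first by exists f1, f2, f3.
have [l1 [l2 [l3 [m1 m2 m3 dl]]]] := tensor_derive i k1 k2 k3.
by exists l1, l2, l3; split=> //; apply/funext => x; have [_] := dl x.
Qed.

(* Positive exactly on ]a + 1/m, b - 1/m[, and tends to 1 on ]a, b[ as m grows. *)
Definition plateau (a b : R) (m : nat) (t : R) : R :=
  flat 1 (m%:R * t + - (m%:R * a + 1)) * flat 1 (- m%:R * t + (m%:R * b - 1)).

Lemma flatgen_plateau a b m : flatgen (plateau a b m).
Proof. by apply: flatgenM; exact: flatgen_base. Qed.

Lemma flat1_ge0 t : 0 <= flat 1 t :> R.
Proof. by rewrite /flat; case: ifP => // _; rewrite hornerE mul1r expR_ge0. Qed.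

Lemma flat1_le1 t : flat 1 t <= 1 :> R.
Proof.
by rewrite /flat; case: ifP => // t0; rewrite hornerE mul1r -expR0 ler_expR oppr_le0 invr_ge0 ltW.
Qed.

Lemma plateau_bound a b m t : `|plateau a b m t| <= 1.
Proof.
rewrite /plateau normrM !ger0_norm ?flat1_ge0// -[X in _ <= X]mulr1.
by apply: ler_pM; rewrite ?flat1_ge0 ?flat1_le1.
Qed.

Lemma flat1_cvg (s : R) : 0 < s -> (fun m : nat => flat 1 (m%:R * s - 1)) @ \oo --> (1 : R).
Proof.
move=> s0; pose u (m : nat) := m%:R * s - 1.
have uoo : u @ \oo --> +oo.
  apply/cvgryPge => A; near=> m; rewrite lerBrDr -ler_pdivrMr//.
  by near: m; exact: nbhs_infty_ger.
have i0 : (fun m => (u m)^-1) @ \oo --> (0 : R).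
  by apply/gtr0_cvgV0 => //; move/cvgryPgt : uoo; exact.
have : (fun m => expR (- (u m)^-1)) @ \oo --> (1 : R).
  rewrite -expR0 -oppr0; apply: (@continuous_cvg _ _ _ _ _ _ (@expR R)); first exact: continuous_expR.
  exact: cvgN.
apply: cvg_trans; apply: near_eq_cvg; near=> m.
rewrite /flat (_ : 0 < m%:R * s - 1) ?hornerE ?mul1r//.
by rewrite -/(u m); near: m; move/cvgryPgt : uoo; exact.
Unshelve. all: by end_near.
Qed.

Lemma plateau_cvg a b t : (plateau a b) ^~ t @ \oo --> (\1_(`]a, b[%classic) t : R).
Proof.
have [/andP[at_ tb]|tab] := boolP (a < t < b).
  rewrite indicE mem_set /= ?in_itv /= ?at_// -[1%:R]mulr1; apply: cvgM.
    have h : 0 < t - a by rewrite subr_gt0.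
    have e (m : nat) : m%:R * t + - (m%:R * a + 1) = m%:R * (t - a) - 1 by ring.
    by under eq_fun do rewrite e; exact: flat1_cvg.
  have h : 0 < b - t by rewrite subr_gt0.
  have e (m : nat) : - m%:R * t + (m%:R * b - 1) = m%:R * (b - t) - 1 by ring.
  by under eq_fun do rewrite e; exact: flat1_cvg.
rewrite indicE memNset /= ?in_itv /=; last by apply/negP.
rewrite (_ : (fun m => plateau a b m t) = cst 0); first exact: cvg_cst.
apply/funext => m; rewrite /plateau /flat.
case: ifP => [h1|_]; last by rewrite mul0r.
case: ifP => [h2|_]; last by rewrite mulr0.
exfalso; move/negP: tab; apply; have m0 : 0 <= m%:R :> R by [].
have [m1|m1] := ltP 0 (m%:R : R); last first.
  move: h1; have -> : m%:R = 0 :> R by apply/eqP; rewrite eq_le m1.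
  by rewrite !mul0r !add0r ltrNr oppr0 ltNge ler01.
by apply/andP; split; rewrite -(ltr_pM2l m1); lra.
Qed.

Variable (D : cuboid R).

Lemma plateau_support a b (m : nat) t : ~ `[a + m%:R^-1, b - m%:R^-1]%classic t -> plateau a b m t = 0.
Proof.
rewrite /= in_itv /= => /negP h; rewrite /plateau /flat.
case: ifP => [h1|_]; last by rewrite mul0r.
case: ifP => [h2|_]; last by rewrite mulr0.
exfalso; move/negP: h; apply; have m0 : 0 <= m%:R :> R by [].
have [m1|m1] := ltP 0 (m%:R : R); last first.
  move: h1; have -> : m%:R = 0 :> R by apply/eqP; rewrite eq_le m1.
  by rewrite !mul0r !add0r ltrNr oppr0 ltNge ler01.
have mi : m%:R * m%:R^-1 = 1 :> R by rewrite divff ?gt_eqF.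
by apply/andP; split; rewrite -(ler_pM2l m1) ?mulrBr ?mulrDr mi; lra.
Qed.

Lemma testfun_plateau (a1 b1 a2 b2 a3 b3 : R) m : (0 < m)%N ->
  xL D <= a1 -> b1 <= xR D -> yL D <= a2 -> b2 <= yR D -> zL D <= a3 -> b3 <= zR D ->
  testfun D (tensor (plateau a1 b1 m) (plateau a2 b2 m) (plateau a3 b3 m)).
Proof.
move=> m0 hx1 hx2 hy1 hy2 hz1 hz2; split; first by apply: smooth_tensor; exact: flatgen_plateau.
have i0 : 0 < m%:R^-1 :> R by rewrite invr_gt0 ltr0n.
exists ((`[a1 + m%:R^-1, b1 - m%:R^-1]%classic `*` `[a2 + m%:R^-1, b2 - m%:R^-1]%classic) `*`
  `[a3 + m%:R^-1, b3 - m%:R^-1]%classic); split.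
- by apply: compact_setX; [apply: compact_setX|]; exact: segment_compact.
- move=> [[u v] w]; rewrite /dom /= !in_itv /= => -[[/andP[? ?] /andP[? ?]] /andP[? ?]].
  by do !split; apply/andP; split; lra.
move=> [[u v] w] h; rewrite /tensor /=.
have [h1|h1] := pselect (`[a1 + m%:R^-1, b1 - m%:R^-1]%classic u); last first.
  by rewrite (plateau_support h1) !mul0r.
have [h2|h2] := pselect (`[a2 + m%:R^-1, b2 - m%:R^-1]%classic v); last first.
  by rewrite (plateau_support h2) mulr0 mul0r.
have [h3|h3] := pselect (`[a3 + m%:R^-1, b3 - m%:R^-1]%classic w); last first.
  by rewrite (plateau_support h3) mulr0.
by exfalso; apply: h.
Qed.

End TensorTestFunctions.

(** * Test functions separate L^2(D) *)

Section TestFunctionsSeparate.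
Variables (R : realType) (D : cuboid R).
Notation mR := (measurableTypeR R).
Implicit Types (f g w : R3 R -> R).

(** Chosen as a generator of the Borel sets that is stable under intersection and meets [D] in
    boxes, whose indicators are limits of plateaus. *)
Definition orthant (a : R3 R) : set (R3 R) :=
  [set x | [/\ (a.1.1 : R) < x.1.1, (a.1.2 : R) < x.1.2 & (a.2 : R) < x.2]].

Lemma orthantE a : orthant a = (`]a.1.1 : R, +oo[%classic `*` `](a.1.2 : R), +oo[%classic) `*` `](a.2 : R), +oo[%classic.
Proof.
apply/seteqP; split=> x; rewrite /orthant /= !in_itv /= !andbT.
  by case.
by case=> -[].
Qed.

Lemma measurable_orthant a : measurable (orthant a).
Proof. by rewrite orthantE; apply: measurableX; [apply: measurableX|]; exact: measurable_itv. Qed.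

Lemma measurable_R3E : @measurable _ (R3 R) = <<s range orthant >>.
Proof.
pose T' := g_sigma_algebraType (range orthant).
apply/seteqP; split; last first.
  by apply: smallest_sub; [exact: sigma_algebra_measurable | move=> _ [a _ <-]; exact: measurable_orthant].
have cover (r : R) : exists n : nat, - n%:R < r.
  exists (Num.truncn `|r|).+1; rewrite ltrNl; apply: le_lt_trans (_ : `|r| < _).
    by rewrite -normrN ler_norm.
  exact: truncnS_gt.
have mgen (p : R3 R -> mR) (o : R -> nat -> R3 R) :
    (forall r, p @^-1` `]r, +oo[ = \bigcup_n orthant (o r n)) ->
    measurable_fun setT (p : T' -> mR).
  move=> h; apply: (measurability (@RGenOInfty.G R)); first exact: RGenOInfty.measurableE.
  move=> _ [_ [r ->] <-]; rewrite setTI h; apply: bigcupT_measurable => n.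
  by apply: sub_gen_smallest; exists (o r n).
have m1 : measurable_fun setT ((fun x => x.1.1) : T' -> mR).
  apply: (mgen _ (fun r n => ((r, - n%:R), - n%:R))) => r; apply/seteqP; split=> [x|x [n _ []]] /=.
    rewrite in_itv /= andbT => h; have [n hn] := cover x.1.2; have [m hm] := cover x.2.
    exists (n + m)%N => //; split=> //=; [apply: le_lt_trans hn | apply: le_lt_trans hm];
      by rewrite lerN2 ler_nat ?leq_addr ?leq_addl.
  by rewrite in_itv /= andbT.
have m2 : measurable_fun setT ((fun x => x.1.2) : T' -> mR).
  apply: (mgen _ (fun r n => ((- n%:R, r), - n%:R))) => r; apply/seteqP; split=> [x|x [n _ []]] /=.
    rewrite in_itv /= andbT => h; have [n hn] := cover x.1.1; have [m hm] := cover x.2.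
    exists (n + m)%N => //; split=> //=; [apply: le_lt_trans hn | apply: le_lt_trans hm];
      by rewrite lerN2 ler_nat ?leq_addr ?leq_addl.
  by rewrite in_itv /= andbT.
have m3 : measurable_fun setT ((fun x => x.2) : T' -> mR).
  apply: (mgen _ (fun r n => ((- n%:R, - n%:R), r))) => r; apply/seteqP; split=> [x|x [n _ []]] /=.
    rewrite in_itv /= andbT => h; have [n hn] := cover x.1.1; have [m hm] := cover x.1.2.
    exists (n + m)%N => //; split=> //=; [apply: le_lt_trans hn | apply: le_lt_trans hm];
      by rewrite lerN2 ler_nat ?leq_addr ?leq_addl.
  by rewrite in_itv /= andbT.
have mid : measurable_fun setT (idfun : T' -> R3 R).
  have -> : (idfun : T' -> R3 R) = fun x => ((x.1.1, x.1.2), x.2) by apply/funext => -[[? ?] ?].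
  by apply/measurable_fun_pairP; split => //=; apply/measurable_fun_pairP.
by move=> A mA; have := mid measurableT A mA; rewrite setTI.
Qed.

Lemma orthant_setI : setI_closed (range orthant).
Proof.
move=> _ _ [a _ <-] [b _ <-].
exists ((Num.max (a.1.1 : R) b.1.1, Num.max (a.1.2 : R) b.1.2), Num.max (a.2 : R) b.2) => //.
apply/seteqP; split=> x; rewrite /orthant /= !gt_max.
  by move=> [/andP[? ?] /andP[? ?] /andP[? ?]].
by move=> [[-> -> ->] [-> -> ->]].
Qed.

Lemma L2_integrable w : L2 D w -> (lebD D).-integrable setT (EFin \o w).
Proof.
move=> /L2P hw; have := sqi_mul_integrable hw ((L2P D (fun=> 1)).1 (L2_cst D 1)).
by apply: eq_integrable => // x _; rewrite /= mulr1.
Qed.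

(** Plateau test functions bounded by 1 converge to the indicator of the orthant on [D]; dominated
    convergence applies with the absolute value of [w] as majorant. *)
Lemma orthogonal_testfun_orthant w a : L2 D w -> (forall phi, testfun D phi -> L2 D phi -> ipL2 D w phi = 0) ->
  (\int[lebD D]_(x in orthant a) (w x)%:E = 0)%E.
Proof.
move=> hw w0; have iw := L2_integrable hw; have mw : measurable_fun setT w by have [] := (L2P D w).1 hw.
pose phi (m : nat) := tensor (plateau (Num.max (a.1.1 : R) (xL D)) (xR D) m)
  (plateau (Num.max (a.1.2 : R) (yL D)) (yR D) m) (plateau (Num.max (a.2 : R) (zL D)) (zR D) m).
(* The shift to [m.+1] provides the positive index that [testfun_plateau] asks for. *)
have tphi m : testfun D (phi m.+1).
  by apply: testfun_plateau => //; rewrite le_max lexx orbT.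
have mfl (f : R -> R) : flatgen f -> measurable_fun setT (f : mR -> R).
  by move=> /flatgen_continuous; exact: continuous_measurable_fun.
have mphi m : measurable_fun setT (phi m).
  apply: measurable_funM; first apply: measurable_funM.
  - by apply: measurableT_comp (mfl _ (flatgen_plateau _ _ _)) _; apply: measurableT_comp;
      [exact: measurable_fst | exact: measurable_fst].
  - by apply: measurableT_comp (mfl _ (flatgen_plateau _ _ _)) _; apply: measurableT_comp;
      [exact: measurable_snd | exact: measurable_fst].
  - by apply: measurableT_comp (mfl _ (flatgen_plateau _ _ _)) _; exact: measurable_snd.
have bphi m x : `|phi m x| <= 1.
  rewrite /phi /tensor 2!normrM.
  by do 2?[apply: mulr_ile1; rewrite ?mulr_ge0 ?normr_ge0 ?plateau_bound//].
have mo := measurable_orthant a.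
have mwo : measurable_fun setT (fun x => (w x * \1_(orthant a) x)%:E).
  by apply/measurable_EFinP; apply: measurable_funM => //; exact: measurable_indic.
have iwphi m : (lebD D).-integrable setT (fun x => (w x * phi m x)%:E).
  apply: (le_integrable measurableT _ _ iw).
    by apply/measurable_EFinP; apply: measurable_funM.
  by move=> x _; rewrite /= lee_fin normrM ler_piMr.
have z m : (\int[lebD D]_x (w x * phi m.+1 x)%:E = 0)%E.
  have hphi : L2 D (phi m.+1).
    apply/L2P; split=> //; apply: le_lt_trans (_ : (\int[lebD D]_x 1 < +oo)%E); last first.
      by rewrite integral_cst// mul1e lebD_fin.
    apply: le_ge0_integral => // [x||x].
    - by rewrite lee_fin sqr_ge0.
    - exact: measurable_sqr.
    - by rewrite lee_fin -real_normK ?num_real// exprn_ile1.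
  have := w0 _ (tphi m) hphi; rewrite /ipL2 /Rintegral => h.
  by rewrite -[LHS]fineK ?h//; exact: integrable_fin_num.
have -> : (\int[lebD D]_(x in orthant a) (w x)%:E = \int[lebD D]_x (w x * \1_(orthant a) x)%:E)%E.
  rewrite integral_mkcond; apply: eq_integral => x _; rewrite patchE indicE.
  by case: ifP => _; rewrite ?mulr1 ?mulr0.
have cv : {ae lebD D, forall x, setT x -> (fun m => (w x * phi m.+1 x)%:E) @ \oo --> (w x * \1_(orthant a) x)%:E}.
  apply: filterS (ae_dom D) => x Dx _; apply: cvg_EFin; first by near=> m.
  apply: cvgM; first exact: cvg_cst.
  have -> : \1_(orthant a) x = \1_(`]Num.max (a.1.1 : R) (xL D), xR D[%classic) (x.1.1 : R) *
      \1_(`]Num.max (a.1.2 : R) (yL D), yR D[%classic) (x.1.2 : R) *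
      \1_(`]Num.max (a.2 : R) (zL D), zR D[%classic) (x.2 : R) :> R.
    have ind (u l r t : R) : l < t -> t < r -> \1_(`]Num.max u l, r[%classic) t = (u < t)%R%:R :> R.
      move=> lt tr; rewrite indicE; congr (nat_of_bool _)%:R; apply/idP/idP => [/set_mem|ut].
        by rewrite /= in_itv /= gt_max => /andP[/andP[]].
      by apply/mem_set; rewrite /= in_itv /= gt_max ut lt tr.
    move: Dx; rewrite /dom /= !in_itv /= => -[[/andP[? ?] /andP[? ?]] /andP[? ?]].
    rewrite !ind// -!natrM !mulnb indicE; congr (nat_of_bool _)%:R.
    apply/idP/idP => [/set_mem[-> -> ->]//|/andP[/andP[? ?] ?]]; exact/mem_set.
  have c (f : nat -> R) (l : R) : f @ \oo --> l -> (fun m : nat => f m.+1) @ \oo --> l by rewrite (cvg_shiftS f).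
  by apply: (c (fun m => phi m x)); apply: cvgM; [apply: cvgM|]; exact: plateau_cvg.
have bd : {ae lebD D, forall x (m : nat), setT x -> (`|(w x * phi m.+1 x)%:E| <= `|(w x)%:E|)%E}.
  by apply: aeW => x m _; rewrite /= lee_fin normrM; exact: ler_piMr.
have mf m : measurable_fun setT (fun x => (w x * phi m.+1 x)%:E) by exact: measurable_int (iwphi m.+1).
have [_ _ /=] := dominated_convergence measurableT mf mwo cv (integrable_abse iw) bd.
under eq_fun do rewrite z.
by move=> h; apply/esym; apply: (cvg_unique _ (cvg_cst _) h).
Unshelve. all: by end_near.
Qed.

(** The sets over which the integral of [w] vanishes form a Dynkin class containing the orthants.
    The whole space is included because the orthant based at the lower corner contains [D], outside
    of which [lebD D] has no mass. *)
Lemma orthogonal_testfun w : L2 D w -> (forall phi, testfun D phi -> L2 D phi -> ipL2 D w phi = 0) -> eqD D w (cst 0).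
Proof.
move=> hw w0; have iw := L2_integrable hw; have ho a := orthogonal_testfun_orthant a hw w0.
have zT : (\int[lebD D]_x (w x)%:E = 0)%E.
  rewrite -(ho ((xL D, yL D), zL D)) [RHS]integral_mkcond.
  apply: ae_eq_integral => //.
  - exact: measurable_int iw.
  - apply: (measurable_restrictT _ (measurable_orthant _)).1; apply: measurable_funTS.
    exact: measurable_int iw.
  apply: filterS (ae_dom D) => x Dx _; rewrite patchE mem_set//.
  by move: Dx; rewrite /dom /orthant /= !in_itv /= => -[[/andP[? _] /andP[? _]] /andP[? _]].
have zA A : measurable A -> (\int[lebD D]_(x in A) (w x)%:E = 0)%E.
  rewrite measurable_R3E; apply: (@dynkin_induction _ _ (range orthant) (fun A => \int[lebD D]_(x in A) (w x)%:E = 0)%E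
    measurable_R3E orthant_setI) => //.
  - by move=> _ [a _ <-]; exact: ho.
  - move=> S mS zS; have := @integral_setU _ _ _ (lebD D) S (~` S) (fun x => (w x)%:E) mS (measurableC mS).
    rewrite setUCr zT zS add0e => -> //.
      exact: measurable_int iw.
    exact/disj_setPCl.
  - move=> S mS tS zS; rewrite integral_bigcup//.
      by rewrite eseries0// => i _ _; exact: zS.
    by apply: integrableS iw => //; exact: bigcupT_measurable.
have := @integral_ae_eq _ _ _ (lebD D) setT measurableT (cst 0%E) (EFin \o w) iw (measurable_cst _).
move=> /(_ _)[]; first by move=> E _ mE; rewrite zA// integral0.
move=> N [mN N0 hN]; exists N; split=> //; apply: subset_trans hN => x /= h1 h2; apply: h1.
by have [] := h2 I.
Qed.

End TestFunctionsSeparate.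

(** * Sobolev norms and the trace of the covariance *)

Section SobolevNorm.
Variables (R : realType) (D : cuboid R).

Lemma nsqL2_ge0 (f : R3 R -> R) : (0 <= nsqL2 D f)%E.
Proof. by apply: integral_ge0 => x _; rewrite lee_fin sqr_ge0. Qed.

(** [f] is a weak derivative of order 0 of itself, so [xget] does not fall back on its default;
    whatever it picks acts on test functions as [f] does. *)
Lemma weakD0 (a : 'I_3 -> nat) (f : R3 R -> R) : (forall i, a i = 0%N) -> L2 D f -> eqD D f (weakD D a f).
Proof.
move=> a0 hf; have self : is_weakD D a f f.
  by split=> // phi _; rewrite /dmulti !a0 big1// expr0 mul1r.
have [hg hw] : is_weakD D a f (weakD D a f) := xgetPex (cst 0) (ex_intro _ f self).
have h : forall phi, testfun D phi -> L2 D phi -> ipL2 D (fun x => f x - weakD D a f x) phi = 0.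
  move=> phi tphi hphi; rewrite ipL2Bl//; have := hw phi tphi.
  by rewrite /dmulti !a0 big1// expr0 mul1r /= => ->; rewrite subrr.
apply: filterS (orthogonal_testfun (L2B hf hg) h) => x /eqP.
by rewrite subr_eq0 => /eqP.
Qed.

Lemma nsqL2_le_nsqH s (f : R3 R -> R) : L2 D f -> (nsqL2 D f <= nsqH D s f)%E.
Proof.
move=> hf; rewrite /nsqH; set G := (if _ then _ else _).
have G0 : (0 <= G)%E.
  rewrite /G; case: ifP => // _; apply: sume_ge0 => a _; apply: integral_ge0 => x _.
  apply: integral_ge0 => y _; by rewrite lee_fin divr_ge0 ?sqr_ge0// powR_ge0.
apply: (@le_trans _ _ (\sum_(a : {ffun 'I_3 -> 'I_(sobolev_order s).+1} | (\sum_i a i <= sobolev_order s)%N)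
      nsqL2 D (weakD D (fun i => a i : nat) f))%E); last by rewrite leeDl.
pose z : {ffun 'I_3 -> 'I_(sobolev_order s).+1} := [ffun=> ord0].
rewrite (bigD1 z) /=; last by rewrite big1// => i _; rewrite ffunE.
have z0 i : (z i : nat) = 0%N by rewrite ffunE.
have ef := weakD0 z0 hf.
have -> : nsqL2 D f = nsqL2 D (weakD D (fun i => z i : nat) f).
  have self : is_weakD D (fun i => z i : nat) f f.
    by split=> // phi _; rewrite /dmulti !z0 big1// expr0 mul1r.
  have [hg _] : is_weakD D (fun i => z i : nat) f (weakD D (fun i => z i : nat) f) :=
    xgetPex (cst 0) (ex_intro _ f self).
  apply: ae_eq_integral => //.
  - by apply: measurable_sqr; have [] := (L2P D f).1 hf.
  - by apply: measurable_sqr; have [] := (L2P D _).1 hg.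
  by apply: filterS ef => x ex _; rewrite -ex.
by rewrite leeDl//; apply: sume_ge0 => a _; exact: nsqL2_ge0.
Qed.

(* eta k = |Q^(1/2) q_k|^2 is at most the squared H^s norm of Q^(1/2) q_k. *)
Lemma trace_le_normHS (q : nat -> R3 R -> R) (eta : nat -> R) (Q S : (R3 R -> R) -> R3 R -> R) s N :
  onb D q -> is_sqrt_op D S Q -> (forall k, 0 <= eta k /\ eqD D (Q (q k)) (fun x => eta k * q k x)) ->
  normHS D q s S = N%:E -> forall m, \sum_(k < m) eta k <= N ^+ 2.
Proof.
move=> onbq SQ heta hN m.
have e k : (eta k)%:E = nsqL2 D (S (q k)).
  have hq := onb_L2 onbq k; have [eta0 Qq] := heta k.
  have [hS Sq] := sqrt_op_eigen SQ hq eta0 Qq.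
  have hr : L2 D (fun x => Num.sqrt (eta k) * q k x) by exact: L2Z.
  rewrite (nsqL2E hS) (eqD_ipL2 hS hr hS Sq) ipL2Zl// ipL2C (eqD_ipL2 hS hr hq Sq) ipL2Zl//.
  by rewrite (onb_ip onbq) eqxx mulr1 -expr2 sqr_sqrtr.
have hL k : L2 D (S (q k)).
  by have [eta0 Qq] := heta k; have [] := sqrt_op_eigen SQ (onb_L2 onbq k) eta0 Qq.
have H0 k : (0 <= nsqH D s (S (q k)))%E := le_trans (nsqL2_ge0 _) (nsqL2_le_nsqH s (hL k)).
have sumE : (\sum_(k <oo) nsqH D s (S (q k)) = (N ^+ 2)%:E)%E.
  have s0 : (0 <= \sum_(k <oo) nsqH D s (S (q k)))%E by apply: nneseries_ge0.
  move: hN s0; rewrite /normHS; case: (limn _) => [r||] //= [<-] r0; rewrite ?sqr_sqrtr//.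
rewrite -lee_fin -sumE -sumEFin.
apply: (@le_trans _ _ (\sum_(k < m) nsqH D s (S (q k)))%E).
  by apply: lee_sum => k _; rewrite e; exact: nsqL2_le_nsqH.
rewrite -(big_mkord xpredT (fun k => nsqH D s (S (q k)))).
by apply: nneseries_lim_ge => k _ _; exact: H0.
Qed.

End SobolevNorm.

(** * Energy estimate for the scheme *)

Section SchemeCoordinates.
Variables (R : realType) (D : cuboid R) (T : mesh D) (dt lambda1 : R) (l : 'rV[R]_(3 + 3)).
Hypothesis dt0 : 0 < dt.
Implicit Types (W : R3 R -> R) (u v : dG T) (x y z : 'rV[R]_(dGdim T)).
Notation G := (Gmx T).
Notation qf := (mxform G).

Definition step_mx W : 'M[R]_(dGdim T) := form_mx (step_form (T := T) dt lambda1 W).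

Definition load_row W : 'rV[R]_(dGdim T) := \row_k load_form l W (dbasis k).

Lemma gram_qf u v : gram u v = qf (crd u) (crd v).
Proof. exact: gramE. Qed.

Lemma Gmx_ge0 x : 0 <= qf x x.
Proof. by rewrite -[x]ofcK -gram_qf; exact: gram_ge0. Qed.

Lemma Gmx_def x : qf x x = 0 -> x = 0.
Proof.
rewrite -{1 2}[x]ofcK -gram_qf => /gram_eq0 h; rewrite -[x]ofcK h.
by apply/rowP => k; rewrite !mxE !ffunE mxE.
Qed.

Lemma step_form_mx W u v : L2 D W -> step_form dt lambda1 W u v = mxform (step_mx W) (crd u) (crd v).
Proof. by move=> hW; apply: form_mxE; exact: step_bilinear. Qed.

Lemma step_mx_le0 W x : L2 D W -> mxform (step_mx W) x x <= 0.
Proof. by move=> hW; rewrite -[x]ofcK -step_form_mx//; exact: step_form_le0. Qed.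

Lemma load_rowE W v : L2 D W -> (load_row W *m (crd v)^T) 0 0 = load_form l W v.
Proof.
move=> hW; have lf : linear_form (load_form (T := T) l W).
  move=> c u u'; rewrite !load_formE; exact: (ipHH_embed_lin (HH_load l hW)).
rewrite (linear_formE v lf) mxE; apply: eq_bigr => k _.
by rewrite !mxE mulrC.
Qed.

Lemma crd_dbasis k : crd (dbasis k) = delta_mx 0 k :> 'rV[R]_(dGdim T).
Proof. exact: ofcK. Qed.

Lemma mxform_delta (A : 'M[R]_(dGdim T)) x k : mxform A x (delta_mx 0 k) = (x *m A) 0 k.
Proof. by rewrite /mxform trmx_delta -colE mxE. Qed.

Lemma scheme_coordinates e W1 W2 u u' : L2 D W1 -> L2 D W2 ->
  u' - e *: u = (dt / 2) *: (Mh u' + e *: Mh u)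
      + (lambda1 / 2) *: pih T (fun x : R3 R => W1 x *: Jmap (embed (u' + e *: u) x))
      + pih T (fun x : R3 R => W2 x *: l) ->
  crd u' *m (G - step_mx W1) = e *: crd u *m (G + step_mx W1) + load_row W2.
Proof.
move=> h1 h2 /(scheme_form h1 h2) h; apply/rowP => k; have := h (dbasis k).
have -> : load_form l W2 (dbasis k) = load_row W2 0 k by rewrite mxE.
rewrite !gram_qf !step_form_mx// crd_dbasis !mxform_delta.
rewrite mulmxBr -scalemxAl mulmxDr; move: (crd u' *m G) (crd u' *m step_mx W1) (crd u *m G) (crd u *m step_mx W1) (load_row W2).
by move=> a b c f r h'; rewrite !mxE; lra.
Qed.

Lemma noise_formE W u v : noise_form W u v = ipL2 D W (fun x : R3 R => dot (Jmap (embed u x)) (embed v x)).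
Proof. by apply: eq_Rintegral => x _; rewrite dotZl. Qed.

Lemma L2_noise_weight u v : L2 D (fun x : R3 R => dot (Jmap (embed u x)) (embed v x)).
Proof.
apply: L2_lbm; apply: lbm_dot; last exact: lbmv_embed.
rewrite /Jmap => i; have le := lbmv_embed u; case: (split_ordP i) => j ->.
  by under eq_fun do rewrite row_mxEl !mxE; apply: lbmN; exact: le.
by under eq_fun do rewrite row_mxEr !mxE; exact: le.
Qed.

Lemma L2_load_weight v : L2 D (fun x : R3 R => dot l (embed v x)).
Proof. by apply: L2_lbm; exact: lbm_dot_embed. Qed.

Lemma load_row_bound W z : L2 D W -> (load_row W *m z^T) 0 0 ^+ 2 <= ipL2 D W W * dot l l * qf z z.
Proof. by move=> hW; rewrite -[z]ofcK load_rowE// -gram_qf; exact: load_form_bound. Qed.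

Definition step_inv W : 'M[R]_(dGdim T) := invmx (G - step_mx W).

Lemma step_unit W : L2 D W -> G - step_mx W \in unitmx.
Proof.
move=> hW; apply: (resolvent_unit Gmx_ge0 Gmx_def) => x; exact: step_mx_le0.
Qed.

Lemma step_contraction W x : L2 D W -> qf (x *m (G + step_mx W) *m step_inv W) (x *m (G + step_mx W) *m step_inv W) <= qf x x.
Proof.
move=> hW; apply: (resolvent_contraction (Gmx_sym T) (fun x => step_mx_le0 x hW)).
by rewrite mulmxKV// step_unit.
Qed.

Lemma step_load_bound W1 W2 : L2 D W1 -> L2 D W2 ->
  qf (load_row W2 *m step_inv W1) (load_row W2 *m step_inv W1) <= ipL2 D W2 W2 * dot l l.
Proof.
move=> h1 h2; apply: (@resolvent_bound _ _ G (step_mx W1) Gmx_ge0 _ (load_row W2)).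
- by move=> x; exact: step_mx_le0.
- by rewrite mulr_ge0 ?ipL2_ge0 ?dot_ge0.
- by rewrite mulmxKV// step_unit.
- by move=> z; exact: load_row_bound.
Qed.

Lemma qfZ c x : qf (c *: x) (c *: x) = c ^+ 2 * qf x x.
Proof. by rewrite mxformZl (mxformC (Gmx_sym T)) mxformZl mulrA expr2. Qed.

End SchemeCoordinates.

(* Coordinates of the solution with zero initial value. *)
Fixpoint zero_start (R : realType) (D : cuboid R) (T : mesh D) (dt lambda1 : R) (l : 'rV[R]_(3 + 3)) (e : R)
    (X : Type) (W1 W2 : nat -> X -> R3 R -> R) (n : nat) (w : X) : 'rV[R]_(dGdim T) :=
  if n is m.+1 then (e *: zero_start T dt lambda1 l e W1 W2 m w *m (Gmx T + step_mx T dt lambda1 (W1 m w))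
      + load_row T l (W2 m w)) *m step_inv T dt lambda1 (W1 m w)
  else 0.

Section ScalarMeasurability.
Context {R : realType} {d : measure_display} {X : measurableType d}.
Variables (D : cuboid R) (T : mesh D) (dt lambda1 : R) (l : 'rV[R]_(3 + 3)).

(** Step matrices and loads contain the noise only through scalar products with fixed functions.
    Since the space is arbitrary, the notion also applies to [Omega] with the sigma-algebra
    generated by [past]. *)
Definition weakly_measurable (W : X -> R3 R -> R) :=
  forall f, L2 D f -> measurable_fun setT (fun w => ipL2 D (W w) f).

Lemma step_mx_measurable (W : X -> R3 R -> R) : weakly_measurable W ->
  mx_measurable (fun w => step_mx T dt lambda1 (W w)).
Proof.
move=> mW i j; under eq_fun do rewrite mxE /step_form noise_formE.
apply: measurable_funD; first exact: measurable_cst.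
by apply: measurable_funM; [exact: measurable_cst | apply: mW; exact: L2_noise_weight].
Qed.

Lemma load_row_measurable (W : X -> R3 R -> R) : weakly_measurable W ->
  mx_measurable (fun w => load_row T l (W w)).
Proof. by move=> mW i j; under eq_fun do rewrite mxE; apply: mW; exact: L2_load_weight. Qed.

Lemma mxform_measurable n (A : 'M[R]_n) (x y : X -> 'rV[R]_n) :
  mx_measurable x -> mx_measurable y -> measurable_fun setT (fun w => mxform A (x w) (y w)).
Proof.
move=> mx my; apply: mx_measurableM; last exact: mx_measurableT.
by apply: mx_measurableM => //; exact: mx_measurable_cst.
Qed.

Variables (e : R) (W1 W2 : nat -> X -> R3 R -> R).

(** Measurability of the noise is required before step [n] only, so the statement also applies to
    the past of a mode at time t_n. *)
Lemma zero_start_measurable n : 0 < dt -> (forall m w, L2 D (W1 m w)) ->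
  (forall m, (m < n)%N -> weakly_measurable (W1 m)) ->
  (forall m, (m < n)%N -> weakly_measurable (W2 m)) -> mx_measurable (zero_start T dt lambda1 l e W1 W2 n).
Proof.
move=> dt0 hW1 m1 m2; elim: n m1 m2 => [|n IH] m1 m2 /=; first exact: mx_measurable_cst.
have mS := step_mx_measurable (m1 n (ltnSn n)).
apply: mx_measurableM; last first.
  apply: mx_measurable_inv; first by move=> w; exact: step_unit.
  by apply: mx_measurableB => //; exact: mx_measurable_cst.
apply: mx_measurableD; last exact: load_row_measurable (m2 n (ltnSn n)).
apply: mx_measurableM; last by apply: mx_measurableD => //; exact: mx_measurable_cst.
apply: mx_measurableZ; first exact: measurable_cst.
by apply: IH => m mn; [apply: m1 | apply: m2]; exact: ltnW.
Qed.

End ScalarMeasurability.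

Section PathwiseComparison.
Variables (R : realType) (D : cuboid R) (T : mesh D) (dt lambda1 e : R) (l : 'rV[R]_(3 + 3)).
Hypotheses (dt0 : 0 < dt) (e01 : 0 <= e <= 1).
Variables (X : Type) (W1 W2 : nat -> X -> R3 R -> R) (w : X) (u : nat -> dG T) (u0 : vfield R).
Hypotheses (hW1 : forall n, L2 D (W1 n w)) (hW2 : forall n, L2 D (W2 n w)) (hu0 : HH D u0).
Notation qf := (mxform (Gmx T)).

(** The squared norm of the projection is its scalar product with [u0], so Cauchy-Schwarz
    applies. *)
Lemma gram_pih_le : gram (pih T u0) (pih T u0) <= ipHH D u0 u0.
Proof.
have := ipHH_cauchy hu0 (HH_embed (pih T u0)); rewrite -(pihP hu0) -/(gram _ _).
have := gram_ge0 (pih T u0); have := ipHH_ge0 D u0.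
move: (gram _ _) (ipHH _ _ _) => g i i0 g0; rewrite expr2.
have [->//|gn] := eqVneq g 0; rewrite ler_pM2r// lt_neqAle eq_sym gn; exact: g0.
Qed.

(** The loads cancel in the difference, which is therefore propagated by [e] times a contraction. *)
Lemma zero_start_distance : u 0%N = pih T u0 ->
  (forall n, u n.+1 - e *: u n = (dt / 2) *: (Mh (u n.+1) + e *: Mh (u n))
      + (lambda1 / 2) *: pih T (fun x : R3 R => W1 n w x *: Jmap (embed (u n.+1 + e *: u n) x))
      + pih T (fun x : R3 R => W2 n w x *: l)) ->
  forall n, let z := crd (u n) - zero_start T dt lambda1 l e W1 W2 n w in qf z z <= ipHH D u0 u0.
Proof.
move=> hi hs; elim=> [|n IH] /=.
  by rewrite subr0 -gram_qf hi; exact: gram_pih_le.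
set z := crd (u n) - _ in IH; have h1 := hW1 n; have h2 := hW2 n.
have uS := step_unit T lambda1 dt0 h1.
have -> : crd (u n.+1) - (e *: zero_start T dt lambda1 l e W1 W2 n w *m (Gmx T + step_mx T dt lambda1 (W1 n w)) +
    load_row T l (W2 n w)) *m step_inv T dt lambda1 (W1 n w) =
    (e *: z) *m (Gmx T + step_mx T dt lambda1 (W1 n w)) *m step_inv T dt lambda1 (W1 n w).
  rewrite -[crd _](mulmxK uS) (scheme_coordinates h1 h2 (hs n)) -/(step_inv _ _ _ _) -mulmxBl; congr (_ *m _).
  by rewrite /z scalerBr mulmxBl opprD addrACA subrr addr0.
apply: le_trans (step_contraction lambda1 dt0 _ h1) _; rewrite qfZ; apply: le_trans _ IH.
have [e0 e1] := andP e01; rewrite -[X in _ <= X]mul1r ler_wpM2r ?Gmx_ge0// exprn_ile1//.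
Qed.

End PathwiseComparison.

(** * Measurability of the noise with respect to the past *)

Section PastNoise.
Context {R : realType} {d : measure_display} {Omega : measurableType d}.
Variables (P : probability Omega R) (F : R -> set (set Omega)) (filtF : is_filtration F).
Variables (I : choiceType) (B : I -> R -> Omega -> R) (BM : forall j, is_BM P F (B j)).
Variables (j0 : I) (t : R) (t0 : 0 <= t).
Variables (D : cuboid R) (q : nat -> R3 R -> R) (onbq : onb D q).
Notation pfun := (past_fun P F B j0 t).

(** By Parseval the scalar product is almost surely the limit of sums over modes; as [past] absorbs
    null sets, measurability passes to the limit. *)
Lemma past_fun_L2_sum (W : Omega -> R3 R -> R) (c : nat -> Omega -> R) (f : nat -> R3 R -> R) (m : nat -> R) :
  L2_sum P D W c f -> (forall k, pfun (c k)) -> (forall k, L2 D (f k)) ->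
  (forall k, eqD D (f k) (fun x => m k * q k x)) ->
  forall g, L2 D g -> pfun (fun w => ipL2 D (W w) g).
Proof.
move=> sW pc hf fq g hg; have mc k : measurable_fun setT (c k) by exact: past_fun_measurable (pc k).
apply: (past_fun_cvg filtF t0 (f := fun M w => \sum_(k < M) (c k w * m k) * ipL2 D (q k) g)).
- move=> M; apply: (@measurable_sum _ (past_type P F B j0 t)) => k.
  apply: (@measurable_funM _ (past_type P F B j0 t)); last exact: measurable_cst.
  by apply: (@measurable_funM _ (past_type P F B j0 t)); [exact: pc | exact: measurable_cst].
- by case: sW => rW _; exact: L2_rv_measurable_ip.
apply: filterS (L2_sum_coefficient onbq sW mc hf fq) => w hw.
have hWw : L2 D (W w) by case: sW => rW _; exact: L2_rv_L2.
by have := onb_cvg onbq hWw hg; under eq_fun do under eq_bigr do rewrite hw.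
Qed.

Lemma past_funM f g : pfun f -> pfun g -> pfun (fun w => f w * g w).
Proof. by move=> hf hg; apply: (@measurable_funM _ (past_type P F B j0 t)). Qed.

Lemma past_funB f g : pfun f -> pfun g -> pfun (fun w => f w - g w).
Proof. by move=> hf hg; apply: (@measurable_funB _ (past_type P F B j0 t)). Qed.

Lemma past_fun_cst (c : R) : pfun (fun=> c).
Proof. exact: (@measurable_cst _ _ (past_type P F B j0 t)). Qed.

Lemma past_fun_zeta (b dt : R) (beta : nat -> R -> Omega -> R) n k :
  (forall r, 0 <= r -> pfun (beta k r)) -> 0 < dt -> pfun (zeta b dt beta n k).
Proof.
move=> hb dt0; rewrite /zeta.
apply: (@measurable_maxr _ (past_type P F B j0 t)); first exact: past_fun_cst.
apply: (@measurable_minr _ (past_type P F B j0 t)); last exact: past_fun_cst.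
apply: past_funM; last exact: past_fun_cst.
by apply: past_funB; apply: hb; rewrite mulr_ge0// ltW.
Qed.

End PastNoise.

Section FatouBound.
Context {R : realType} {d : measure_display} {X : measurableType d}.
Variable mu : {measure set X -> \bar R}.

Lemma limn_einf_le (u : (\bar R)^nat) (c : \bar R) : (forall n, u n <= c)%E -> (limn_einf u <= c)%E.
Proof.
move=> h; apply: le_trans (limn_einf_sup _) _.
rewrite /limn_esup /limf_esup; apply: (@le_trans _ _ (ereal_sup (u @` setT))).
  by apply: ereal_inf_lbound; exists setT => //; exact: filterT.
by apply: ge_ereal_sup => _ [n _ <-].
Qed.

(** Fatou's lemma after multiplication by the indicator of a set of full measure on which
    convergence holds. *)
Lemma ae_cvg_integral_le (f : nat -> X -> R) (g : X -> R) (c : \bar R) :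
  (forall m, measurable_fun setT (f m)) -> measurable_fun setT g ->
  (forall m x, 0 <= f m x) -> (forall x, 0 <= g x) ->
  {ae mu, forall x, f ^~ x @ \oo --> g x} ->
  (forall m, \int[mu]_x (f m x)%:E <= c)%E -> (\int[mu]_x (g x)%:E <= c)%E.
Proof.
move=> mf mg f0 g0 [N [mN N0 hN]] h.
pose ind x : R := \1_(~` N) x.
have mi : measurable_fun setT ind by apply: measurable_indic; exact: measurableC.
have ind01 x : 0 <= ind x <= 1 by rewrite /ind indicE; case: (_ \in _); rewrite ?lexx ?ler01.
have mfi m : measurable_fun setT (fun x => (f m x * ind x)%:E).
  by apply/measurable_EFinP; exact: measurable_funM.
have -> : (\int[mu]_x (g x)%:E = \int[mu]_x limn_einf (fun m => (f m x * ind x)%:E))%E.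
  transitivity (\int[mu]_x (g x * ind x)%:E)%E.
    apply: ae_eq_integral => //; [by apply/measurable_EFinP |
      by apply/measurable_EFinP; exact: measurable_funM |].
    exists N; split=> // x /=; apply: contra_notP => nN _.
    by rewrite /ind indicE mem_set ?mulr1.
  apply: eq_integral => x _; apply/esym; apply: (cvg_limn_einf_sup _).1; apply: cvg_EFin.
    by near=> m.
  rewrite /ind indicE; case: (boolP (x \in ~` N)) => [/set_mem nN|_].
    rewrite mulr1; under eq_fun do rewrite mulr1; apply: contrapT => nc; exact: nN (hN _ nc).
  by rewrite mulr0; under eq_fun do rewrite mulr0; exact: cvg_cst.
apply: le_trans (fatou mu measurableT mfi _) _.
  by move=> m x _; rewrite lee_fin mulr_ge0//; case/andP: (ind01 x).
apply: limn_einf_le => m; apply: le_trans (h m); apply: le_ge0_integral => //.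
- by move=> x; rewrite lee_fin mulr_ge0//; case/andP: (ind01 x).
- by apply/measurable_EFinP.
- by move=> x; rewrite lee_fin ler_piMr//; case/andP: (ind01 x).
Unshelve. all: by end_near.
Qed.

End FatouBound.

Section EntrywiseLimits.
Variable R : realType.

Lemma cvg_bigsum (I : finType) (f : I -> nat -> R) (l : I -> R) :
  (forall i, f i @ \oo --> l i) -> (fun n => \sum_i f i n) @ \oo --> \sum_i l i.
Proof.
move=> h; elim: (index_enum I) => [|i s IH].
  by rewrite big_nil; under eq_fun do rewrite big_nil; exact: cvg_cst.
by rewrite big_cons; under eq_fun do rewrite big_cons; apply: cvgD.
Qed.

Lemma mulmx_cvg m n p (x : nat -> 'M[R]_(m, n)) (y : 'M[R]_(m, n)) (A : 'M[R]_(n, p)) :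
  (forall i j, (fun k => x k i j) @ \oo --> y i j) ->
  forall i j, (fun k => (x k *m A) i j) @ \oo --> (y *m A) i j.
Proof.
move=> h i j; rewrite mxE; under eq_fun do rewrite mxE.
by apply: cvg_bigsum => k; apply: cvgM; [exact: h | exact: cvg_cst].
Qed.

Lemma mxform_cvg n (A : 'M[R]_n) (x : nat -> 'rV[R]_n) (y : 'rV[R]_n) :
  (forall i j, (fun k => x k i j) @ \oo --> y i j) ->
  (fun k => mxform A (x k) (x k)) @ \oo --> mxform A y y.
Proof.
move=> h; rewrite /mxform mxE; under eq_fun do rewrite mxE.
apply: cvg_bigsum => k; apply: cvgM; first exact: mulmx_cvg.
by rewrite mxE; under eq_fun do rewrite mxE; exact: h.
Qed.

End EntrywiseLimits.

(** * Energy estimate for a single step *)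

Section EnergyStep.
Context {R : realType} {d : measure_display} {Omega : measurableType d}.
Variables (P : probability Omega R) (F : R -> set (set Omega)) (filtF : is_filtration F).
Variables (I : choiceType) (B : I -> R -> Omega -> R) (BM : forall j, is_BM P F (B j)).
Hypothesis indepB : independent_processes P B.
Variables (j : nat -> I) (t r : R) (t0 : 0 <= t) (tr : t < r).
Variables (D : cuboid R) (T : mesh D) (dt lambda1 e K S : R) (l : 'rV[R]_(3 + 3)) (dt0 : 0 < dt).
Variables (q : nat -> R3 R -> R) (onbq : onb D q) (eta : nat -> R).
Hypotheses (eta0 : forall k, 0 <= eta k) (etaS : forall m, \sum_(k < m) eta k <= S).
Variables (V W : Omega -> R3 R -> R) (z : Omega -> 'rV[R]_(dGdim T)).
Notation past_type k := (past_type P F B (j k) t).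
Notation G := (Gmx T).
Notation qf := (mxform G).
Hypotheses (hV : forall w, L2 D (V w)) (hW : forall w, L2 D (W w)).
Hypotheses (mV : forall k, weakly_measurable D (V : past_type k -> R3 R -> R)) (mW : weakly_measurable D W).
Hypothesis mz : forall k, mx_measurable (z : past_type k -> 'rV[R]_(dGdim T)).
Let Delta k w := B (j k) r w - B (j k) t w.
Hypothesis coefW : {ae P, forall w k, ipL2 D (W w) (q k) = Num.sqrt (eta k) * Delta k w}.
Hypothesis Kz : (\int[P]_w (qf (z w) (z w))%:E <= K%:E)%E.

(** [Xp] is the propagated part of the new state, [load m] the load of the first m modes, and [Z k]
    the factor of [Delta k] in their scalar product, up to the square root of [eta k]. *)
Let A w := step_inv T dt lambda1 (V w).
Let Xp w := e *: z w *m (G + step_mx T dt lambda1 (V w)) *m A w.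
Let a k := load_row T l (q k).
Let load m w := \sum_(k < m) (Num.sqrt (eta k) * Delta k w) *: a k.
Let Z k w := qf (Xp w) (a k *m A w).

(** Measurability for the past of one mode, here mode 0, already implies ordinary measurability. *)
Let mVO : weakly_measurable D V.
Proof. move=> f hf; have h : past_fun P F B (j 0%N) t (fun w => ipL2 D (V w) f) := @mV 0%N f hf.
by have := past_fun_measurable h. Qed.

Let mzO : mx_measurable z.
Proof. move=> i k; have h : past_fun P F B (j 0%N) t (fun w => z w i k) := @mz 0%N i k.
by have := past_fun_measurable h. Qed.

(** The space [Y] is general because both [Omega] and its pasts are substituted for it. *)
Let mA_gen d' (Y : measurableType d') (V' : Y -> R3 R -> R) : (forall w, L2 D (V' w)) -> weakly_measurable D V' ->
  mx_measurable (fun w => step_inv T dt lambda1 (V' w)).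
Proof.
move=> hV' mV'; apply: mx_measurable_inv; first by move=> w; exact: step_unit.
by apply: mx_measurableB; [exact: mx_measurable_cst | exact: step_mx_measurable].
Qed.

Let mX_gen d' (Y : measurableType d') (V' : Y -> R3 R -> R) (z' : Y -> 'rV[R]_(dGdim T)) :
  (forall w, L2 D (V' w)) -> weakly_measurable D V' -> mx_measurable z' ->
  mx_measurable (fun w => e *: z' w *m (G + step_mx T dt lambda1 (V' w)) *m step_inv T dt lambda1 (V' w)).
Proof.
move=> hV' mV' mz'; apply: mx_measurableM; last exact: mA_gen.
apply: mx_measurableM; first by apply: mx_measurableZ => //; exact: measurable_cst.
by apply: mx_measurableD; [exact: mx_measurable_cst | exact: step_mx_measurable].
Qed.

Let mA : mx_measurable A. Proof. exact: (mA_gen hV mVO). Qed.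
Let mXp : mx_measurable Xp. Proof. exact: (mX_gen hV mVO mzO). Qed.

Let mDelta k : measurable_fun setT (Delta k).
Proof.
by apply: measurable_funB; apply: (BM_measurable filtF BM) => //; exact: le_trans (ltW tr).
Qed.

Let mload m : mx_measurable (load m).
Proof.
move=> i k; rewrite /load; under eq_fun do rewrite summxE.
apply: measurable_sum => k'; under eq_fun do rewrite mxE.
apply: measurable_funM; last exact: measurable_cst.
by apply: measurable_funM; [exact: measurable_cst | exact: mDelta].
Qed.

Let s := Num.sqrt (r - t).
Let s0 : 0 < s. Proof. by rewrite sqrtr_gt0 subr_gt0. Qed.
Let s2 : s ^+ 2 = r - t. Proof. by rewrite sqr_sqrtr// subr_ge0 ltW. Qed.

Let law k (E : set (measurableTypeR R)) : measurable E -> P (Delta k @^-1` E) = normal_prob 0 s E.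
Proof. by move=> mE; have [_ _ _ h _] := BM (j k); exact: h. Qed.

Let sqi_Delta k : sqi P (Delta k). Proof. exact: sqi_gaussian (mDelta k) s0 (law k). Qed.

Let secondD k : (\int[P]_w (Delta k w ^+ 2)%:E <= (8 * (r - t))%:E)%E.
Proof. by rewrite -s2; exact: gaussian_second_moment_le (mDelta k) s0 (law k). Qed.

Let qz_ge0 w : 0 <= qf (z w) (z w). Proof. exact: Gmx_ge0. Qed.

Let mqz : measurable_fun setT (fun w => qf (z w) (z w)).
Proof. exact: mxform_measurable. Qed.

Let X_le w : qf (Xp w) (Xp w) <= e ^+ 2 * qf (z w) (z w).
Proof. by rewrite -qfZ; exact: step_contraction. Qed.

Let a_le k w : qf (a k *m A w) (a k *m A w) <= dot l l.
Proof.
have := step_load_bound T lambda1 l dt0 (hV w) (onb_L2 onbq k).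
by rewrite (onb_ip onbq) eqxx mul1r.
Qed.

Let load_row_sum m w : load m w = load_row T l (fun x => \sum_(k < m) (Num.sqrt (eta k) * Delta k w) * q k x).
Proof.
apply/rowP => i; rewrite summxE mxE /load_form (ip_partial_sum onbq (fun k => Num.sqrt (eta k) * Delta k w));
  last exact: L2_load_weight.
by apply: eq_bigr => k _; rewrite !mxE.
Qed.

(** By orthonormality the squared norm of the truncated noise is a sum of squared increments, whose
    expectation is controlled by a partial trace of the covariance. *)
Let Y_le m w : qf (load m w *m A w) (load m w *m A w) <= dot l l * \sum_(k < m) eta k * Delta k w ^+ 2.
Proof.
have hS := L2_partial_sum onbq (fun k => Num.sqrt (eta k) * Delta k w) m.
have := step_load_bound T lambda1 l dt0 (hV w) hS.
rewrite -load_row_sum (partial_sum_sqr onbq (fun k => Num.sqrt (eta k) * Delta k w)) mulrC.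
by under [X in _ <= _ * X -> _]eq_bigr do rewrite exprMn sqr_sqrtr//.
Qed.

Let integral_qz_fin : (\int[P]_w (qf (z w) (z w))%:E < +oo)%E.
Proof. exact: le_lt_trans Kz (ltry _). Qed.

Let integral_scale (c : R) (f : Omega -> R) : 0 <= c -> measurable_fun setT f -> (forall w, 0 <= f w) ->
  (\int[P]_w (c * f w)%:E = c%:E * \int[P]_w (f w)%:E)%E.
Proof.
move=> c0 mf f0; under eq_integral do rewrite EFinM.
by rewrite ge0_integralZl//; [apply/measurable_EFinP | move=> w _; rewrite lee_fin].
Qed.

(** Cauchy-Schwarz for the Gram matrix: the propagated state is controlled by [z], and the resolvent
    of the mode by a constant. *)
Let sqi_Z k : sqi P (Z k).
Proof.
have mZ : measurable_fun setT (Z k).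
  by apply: mxform_measurable => //; apply: mx_measurableM => //; exact: mx_measurable_cst.
split=> //; have c0 : 0 <= e ^+ 2 * dot l l by rewrite mulr_ge0 ?sqr_ge0 ?dot_ge0.
apply: (@le_lt_trans _ _ (\int[P]_w (e ^+ 2 * dot l l * qf (z w) (z w))%:E)%E); last first.
  by rewrite (integral_scale c0 mqz qz_ge0) lte_mul_pinfty.
apply: le_ge0_integral.
- by move=> w; rewrite lee_fin sqr_ge0.
- exact: measurable_sqr.
- by apply/measurable_EFinP; apply: measurable_funM => //; exact: measurable_cst.
move=> w; rewrite lee_fin; apply: le_trans (mxform_cauchy (Gmx_sym T) (@Gmx_ge0 _ _ T) _ _) _.
rewrite -mulrA (mulrC (dot l l)) mulrA.
by apply: ler_pM; [exact: Gmx_ge0 | exact: Gmx_ge0 | exact: X_le | exact: a_le].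
Qed.

(** Here the dependence of the past on the mode is used: [V] and [z], hence [Z k], are known to the
    past of mode [k]. *)
Let orthZ k : (\int[P]_w (Z k w * Delta k w)%:E = 0)%E.
Proof.
apply: (past_orthogonal filtF BM indepB t0 tr).
- apply: (@mxform_measurable _ _ (past_type k)); first exact: (@mX_gen _ (past_type k) V z hV (@mV k) (@mz k)).
  by apply: (@mx_measurableM _ _ (past_type k)); [exact: mx_measurable_cst | exact: (@mA_gen _ (past_type k) V hV (@mV k))].
- exact: sqi_integrable (sqi_Delta k).
- exact: gaussian_mean0 (mDelta k) s0 (law k).
- exact: sqi_mul_integrable (sqi_Z _) (sqi_Delta _).
Qed.

Let cross m w := qf (Xp w) (load m w *m A w).

Let cross_sum m w : cross m w = \sum_(k < m) Num.sqrt (eta k) * (Z k w * Delta k w).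
Proof.
rewrite /cross /load mulmx_suml (mxformC (Gmx_sym T)).
have sumE (f : 'I_m -> 'rV[R]_(dGdim T)) y : qf (\sum_(k < m) f k) y = \sum_(k < m) qf (f k) y.
  by rewrite /mxform !mulmx_suml summxE.
rewrite sumE; apply: eq_bigr => k _; rewrite -scalemxAl mxformZl (mxformC (Gmx_sym T)) /Z.
by rewrite -mulrA (mulrC (Delta k w)).
Qed.

Let icross m : P.-integrable setT (fun w => (cross m w)%:E).
Proof.
under eq_fun do rewrite cross_sum -sumEFin.
apply: (@integrable_sum _ _ _ P) => // k _.
under eq_fun do rewrite EFinM; apply: integrableZl => //.
exact: sqi_mul_integrable (sqi_Z _) (sqi_Delta _).
Qed.

Let integral_cross m : (\int[P]_w (cross m w)%:E = 0)%E.
Proof.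
under eq_integral do rewrite cross_sum -sumEFin.
rewrite (integral_sum measurableT) ?big1// => k.
  move=> _; under eq_integral do rewrite EFinM.
  by rewrite integralZl ?orthZ ?mule0//; exact: sqi_mul_integrable (sqi_Z _) (sqi_Delta _).
by under eq_fun do rewrite EFinM; apply: integrableZl => //; exact: sqi_mul_integrable (sqi_Z _) (sqi_Delta _).
Qed.

Let ge0_integrable (f : Omega -> R) (c : R) : measurable_fun setT f -> (forall w, 0 <= f w) ->
  (\int[P]_w (f w)%:E <= c%:E)%E -> P.-integrable setT (EFin \o f).
Proof.
move=> mf f0 h; apply/integrableP; split; first by apply/measurable_EFinP.
under eq_integral do rewrite /= ger0_norm//.
exact: le_lt_trans h (ltry _).
Qed.

Let integral_X : (\int[P]_w (qf (Xp w) (Xp w))%:E <= (e ^+ 2 * K)%:E)%E.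
Proof.
apply: (@le_trans _ _ (\int[P]_w (e ^+ 2 * qf (z w) (z w))%:E)%E).
  apply: le_ge0_integral.
  - by move=> w; rewrite lee_fin Gmx_ge0.
  - by apply/measurable_EFinP; exact: mxform_measurable.
  - by apply/measurable_EFinP; apply: measurable_funM => //; exact: measurable_cst.
  - by move=> w; rewrite lee_fin X_le.
by rewrite integral_scale ?sqr_ge0// [leRHS]EFinM; apply: lee_wpmul2l => //; rewrite lee_fin sqr_ge0.
Qed.

Let integral_Y m : (\int[P]_w (qf (load m w *m A w) (load m w *m A w))%:E <= (8 * (r - t) * S * dot l l)%:E)%E.
Proof.
have msum : measurable_fun setT (fun w => \sum_(k < m) eta k * Delta k w ^+ 2).
  apply: measurable_sum => k; apply: measurable_funM; first exact: measurable_cst.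
  by apply: measurable_funX; exact: mDelta.
have sum0 w : 0 <= \sum_(k < m) eta k * Delta k w ^+ 2.
  by apply: sumr_ge0 => k _; rewrite mulr_ge0 ?sqr_ge0.
apply: (@le_trans _ _ (\int[P]_w (dot l l * \sum_(k < m) eta k * Delta k w ^+ 2)%:E)%E).
  apply: le_ge0_integral.
  - by move=> w; rewrite lee_fin Gmx_ge0.
  - by apply/measurable_EFinP; apply: mxform_measurable; apply: mx_measurableM.
  - by apply/measurable_EFinP; apply: measurable_funM => //; exact: measurable_cst.
  - by move=> w; rewrite lee_fin Y_le.
rewrite integral_scale ?dot_ge0//.
under eq_integral do rewrite -sumEFin.
rewrite ge0_integral_sum//; last 2 first.
- move=> k; apply/measurable_EFinP; apply: measurable_funM; first exact: measurable_cst.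
  by apply: measurable_funX; exact: mDelta.
- by move=> k w _; rewrite lee_fin mulr_ge0 ?sqr_ge0.
have rt : 0 <= 8 * (r - t) by rewrite mulr_ge0// subr_ge0 ltW.
apply: (@le_trans _ _ ((dot l l)%:E * \sum_(k < m) (eta k * (8 * (r - t)))%:E)%E).
  apply: lee_wpmul2l; first by rewrite lee_fin dot_ge0.
  apply: lee_sum => k _; rewrite integral_scale//; last first.
  - by move=> w; exact: sqr_ge0.
  - by apply: measurable_funX; exact: mDelta.
  by rewrite EFinM; apply: lee_wpmul2l => //; rewrite lee_fin.
rewrite sumEFin -EFinM lee_fin -mulr_suml mulrC; apply: ler_wpM2r; first exact: dot_ge0.
by rewrite mulrC; apply: ler_wpM2l.
Qed.

Let integral_approx m : (\int[P]_w (qf (Xp w + load m w *m A w) (Xp w + load m w *m A w))%:E <=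
  (e ^+ 2 * K + 8 * (r - t) * S * dot l l)%:E)%E.
Proof.
have mX : measurable_fun setT (fun w => qf (Xp w) (Xp w)) by exact: mxform_measurable.
have mY : measurable_fun setT (fun w => qf (load m w *m A w) (load m w *m A w)).
  by apply: mxform_measurable; apply: mx_measurableM.
have iX := ge0_integrable mX (fun w => Gmx_ge0 (Xp w)) integral_X.
have iY := ge0_integrable mY (fun w => Gmx_ge0 (load m w *m A w)) (integral_Y m).
have i2 : P.-integrable setT (fun w => 2%:E * (cross m w)%:E)%E by exact: integrableZl.
have expand w : (qf (Xp w + load m w *m A w) (Xp w + load m w *m A w))%:E =
    ((qf (Xp w) (Xp w))%:E + (qf (load m w *m A w) (load m w *m A w))%:E + 2%:E * (cross m w)%:E)%E.
  rewrite mxformDl !(mxformDr (Gmx_sym T)) (mxformC (Gmx_sym T) (load m w *m A w) (Xp w)) -/(cross m w).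
  by rewrite -EFinM -!EFinD; congr EFin; move: (qf _ _) (qf _ _) (cross m w) => *; ring.
under eq_integral do rewrite expand.
rewrite integralD//; last exact: integrableD.
rewrite integralD// integralZl// integral_cross mule0 adde0 EFinD.
by apply: leeD; [exact: integral_X | exact: integral_Y].
Qed.

(** The bound for truncated loads is uniform in the number of modes. Truncated states converge
    entrywise almost surely by Parseval, so Fatou's lemma carries the bound over. *)
Lemma energy_step (z' : Omega -> 'rV[R]_(dGdim T)) :
  (forall w, z' w = (e *: z w *m (G + step_mx T dt lambda1 (V w)) + load_row T l (W w)) *m step_inv T dt lambda1 (V w)) ->
  (\int[P]_w (qf (z' w) (z' w))%:E <= (e ^+ 2 * K + 8 * (r - t) * S * dot l l)%:E)%E.
Proof.
move=> hz'; have z'E w : z' w = Xp w + load_row T l (W w) *m A w by rewrite hz' mulmxDl.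
have mz' : mx_measurable z'.
  have -> : z' = fun w => Xp w + load_row T l (W w) *m A w by exact/funext.
  by apply: mx_measurableD => //; apply: mx_measurableM => //; exact: load_row_measurable.
apply: (@ae_cvg_integral_le _ _ _ P (fun m w => qf (Xp w + load m w *m A w) (Xp w + load m w *m A w))) => //.
- move=> m; apply: mxform_measurable; apply: mx_measurableD => //; exact: mx_measurableM.
- exact: mxform_measurable.
- by move=> m w; exact: Gmx_ge0.
- by move=> w; exact: Gmx_ge0.
apply: filterS coefW => w hw; apply: mxform_cvg => i k; rewrite z'E [X in _ --> X]mxE.
under eq_fun do rewrite mxE; apply: cvgD; first exact: cvg_cst.
apply: mulmx_cvg => {}i {}k; rewrite ord1 [X in _ --> X]mxE.
have := onb_cvg onbq (hW w) (L2_load_weight l (dbasis k)).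
apply: cvg_trans; apply: near_eq_cvg; near=> m.
rewrite summxE; apply: eq_bigr => k' _; rewrite hw !mxE; congr (_ * _).
Unshelve. all: by end_near.
Qed.

End EnergyStep.

(** As e^2 = exp(-2 sigma dt) is at most 1 / (1 + 2 sigma dt), the quotient is at most (1 + 2 sigma
    dt) / (2 sigma); dt < 1 removes the remaining dt. *)
Lemma contraction_rate (R : realType) (sigma dt : R) : 0 < sigma -> 0 < dt -> dt < 1 ->
  let e := expR (- sigma * dt) in
  [/\ 0 <= e <= 1, e ^+ 2 < 1 & dt / (1 - e ^+ 2) <= (1 + 2 * sigma) / (2 * sigma)].
Proof.
move=> s0 d0 d1 e; have a0 : 0 < 2 * sigma * dt by rewrite !mulr_gt0.
have e2 : e ^+ 2 = (expR (2 * sigma * dt))^-1.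
  by rewrite -expRN expr2 -expRD; congr expR; ring.
have ea := expR_ge1Dx (2 * sigma * dt).
have ep : 0 < expR (2 * sigma * dt) by exact: expR_gt0.
have e2le : e ^+ 2 <= (1 + 2 * sigma * dt)^-1.
  by rewrite e2 lef_pV2 ?posrE// ltr_wpDr// ltW.
have lt1 : (1 + 2 * sigma * dt)^-1 < 1 by rewrite invf_lt1 ?ltrDl// ltr_wpDr// ltW.
split.
- by rewrite expR_ge0 -expR0 ler_expR mulNr oppr_le0 mulr_ge0// ltW.
- exact: le_lt_trans e2le lt1.
rewrite ler_pdivrMr ?subr_gt0 ?(le_lt_trans e2le lt1)//.
have : 1 - e ^+ 2 >= 2 * sigma * dt / (1 + 2 * sigma * dt).
  have -> : 2 * sigma * dt / (1 + 2 * sigma * dt) = 1 - (1 + 2 * sigma * dt)^-1.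
    by field; rewrite gt_eqF// ltr_wpDr// ltW.
  by rewrite lerD2l lerN2.
move=> h; apply: le_trans (_ : (1 + 2 * sigma) / (2 * sigma) * (2 * sigma * dt / (1 + 2 * sigma * dt)) <= _); last first.
  by apply: ler_wpM2l => //; rewrite divr_ge0 ?addr_ge0 ?mulr_ge0// ltW.
have -> : (1 + 2 * sigma) / (2 * sigma) * (2 * sigma * dt / (1 + 2 * sigma * dt)) =
    dt * ((1 + 2 * sigma) / (1 + 2 * sigma * dt)).
  by field; rewrite !gt_eqF// ltr_wpDr// ltW.
rewrite -{1}[dt]mulr1 ler_pM2l// ler_pdivlMr ?ltr_wpDr ?(ltW a0)// mul1r lerD2l.
by rewrite ler_piMr ?mulr_ge0// ltW.
Qed.

(** * Uniform energy bound for the solution started at zero *)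

Section SchemeEnergy.
Context {R : realType} {d : measure_display} {Omega : measurableType d}.
Variables (P : probability Omega R) (F : R -> set (set Omega)) (filtF : is_filtration F).
Variables (beta1 beta2 : nat -> R -> Omega -> R).
Hypotheses (BM1 : forall k, is_BM P F (beta1 k)) (BM2 : forall k, is_BM P F (beta2 k)).
Let B (ik : bool * nat) := if ik.1 then beta1 ik.2 else beta2 ik.2.
Hypothesis indepB : independent_processes P B.
Variables (D : cuboid R) (q : nat -> R3 R -> R) (onbq : onb D q).
Variables (Q1 Q1h : (R3 R -> R) -> R3 R -> R) (eta1 eta2 : nat -> R).
Hypotheses (heta1 : forall k, 0 <= eta1 k /\ eqD D (Q1 (q k)) (fun x => eta1 k * q k x)).
Hypothesis sqrtQ1 : is_sqrt_op D Q1h Q1.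
Hypotheses (eta2_ge0 : forall k, 0 <= eta2 k).
Variables (W2 : R -> Omega -> R3 R -> R) (expW2 : wiener_expansion P D W2 eta2 q beta2).
Variables (b dt : R) (dt0 : 0 < dt) (dW1 : nat -> Omega -> R3 R -> R).
Hypothesis incW1 : forall n, truncated_increment P D b dt beta1 Q1h q n (dW1 n).
Let dW2 (n : nat) w x := W2 (n.+1%:R * dt) w x - W2 (n%:R * dt) w x.
Let time (n : nat) : R := n%:R * dt.

Let time_ge0 n : 0 <= time n. Proof. by rewrite mulr_ge0// ltW. Qed.

Let BM ik : is_BM P F (B ik). Proof. by rewrite /B; case: ifP. Qed.

Lemma dW1_L2 n w : L2 D (dW1 n w).
Proof. by have [rW _] := incW1 n; exact: L2_rv_L2. Qed.

Lemma W2_L2 s w : 0 <= s -> L2 D (W2 s w).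
Proof. by move=> s0; have [rW _] := expW2 s0; exact: L2_rv_L2. Qed.

Lemma dW2_L2 n w : L2 D (dW2 n w).
Proof. by apply: L2B; apply: W2_L2; exact: time_ge0. Qed.

Lemma dW2_measurable n : weakly_measurable D (dW2 n).
Proof.
move=> f hf; have m s : 0 <= s -> measurable_fun setT (fun w => ipL2 D (W2 s w) f).
  by move=> s0; have [rW _] := expW2 s0; exact: L2_rv_measurable_ip.
have -> : (fun w => ipL2 D (dW2 n w) f) = fun w => ipL2 D (W2 (time n.+1) w) f - ipL2 D (W2 (time n) w) f.
  by apply/funext => w; rewrite ipL2Bl//; apply: W2_L2; exact: time_ge0.
by apply: measurable_funB; apply: m; exact: time_ge0.
Qed.

Let coef_W2 s : 0 <= s -> {ae P, forall w k, ipL2 D (W2 s w) (q k) = Num.sqrt (eta2 k) * beta2 k s w}.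
Proof.
move=> s0; have h := L2_sum_coefficient onbq (m := fun=> 1) (expW2 s0).
have : {ae P, forall w k, ipL2 D (W2 s w) (q k) = Num.sqrt (eta2 k) * beta2 k s w * 1}.
  apply: h => k; [|exact: onb_L2|by apply: aeW => x; rewrite mul1r].
  by apply: measurable_funM; [exact: measurable_cst | exact: (BM_measurable filtF BM (false, k))].
by apply: filterS => w hw k; rewrite hw mulr1.
Qed.

Lemma dW2_coefficient n : {ae P, forall w k, ipL2 D (dW2 n w) (q k) =
  Num.sqrt (eta2 k) * (B (false, k) (time n.+1) w - B (false, k) (time n) w)}.
Proof.
apply: filterS2 (coef_W2 (time_ge0 n.+1)) (coef_W2 (time_ge0 n)) => w h1 h2 k.
by rewrite ipL2Bl ?h1 ?h2 ?mulrBr//; [apply: W2_L2; exact: time_ge0 .. | exact: onb_L2].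
Qed.

Notation past_type k n := (past_type P F B (false, k) (time n)).

(** The motions of the first noise all differ from the one indexed by [(false, k)], so even their
    increments after t_n are known to this past; hence no relation between [m] and [n]. *)
Lemma dW1_past k n m : weakly_measurable D (dW1 m : past_type k n -> R3 R -> R).
Proof.
move=> f hf; apply: (past_fun_L2_sum filtF (time_ge0 n) onbq (incW1 m) (m := fun k => Num.sqrt (eta1 k))) => //.
- move=> k'; apply: past_funM; first exact: past_fun_cst.
  apply: past_fun_zeta => // r r0; exact: (past_fun_other filtF BM (time_ge0 n) (j := (true, k'))).
- by move=> k'; have [e0 e1] := heta1 k'; have [] := sqrt_op_eigen sqrtQ1 (onb_L2 onbq k') e0 e1.
- by move=> k'; have [e0 e1] := heta1 k'; have [] := sqrt_op_eigen sqrtQ1 (onb_L2 onbq k') e0 e1.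
Qed.

(** The restriction on [s] concerns the mode [k] itself; the other modes are known at all times. *)
Lemma W2_past k n s f : 0 <= s -> s <= time n -> L2 D f ->
  past_fun P F B (false, k) (time n) (fun w => ipL2 D (W2 s w) f).
Proof.
move=> s0 st hf; apply: (past_fun_L2_sum filtF (time_ge0 n) onbq (expW2 s0) (m := fun=> 1)) => //.
- move=> k'; apply: past_funM; first exact: past_fun_cst.
  have [->|kk] := eqVneq k' k.
    by have := past_fun_before filtF BM (j0 := (false, k)) s0 st.
  apply: (past_fun_other filtF BM (time_ge0 n) (j := (false, k'))) => //.
- by move=> k'; exact: onb_L2.
- by move=> k'; apply: aeW => x; rewrite mul1r.
Qed.

Let time_le m n : (m <= n)%N -> time m <= time n.
Proof. by move=> mn; rewrite ler_wpM2r ?ler_nat// ltW. Qed.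

Lemma dW2_past k n m : (m < n)%N -> weakly_measurable D (dW2 m : past_type k n -> R3 R -> R).
Proof.
move=> mn f hf.
have -> : (fun w => ipL2 D (dW2 m w) f) = fun w => ipL2 D (W2 (time m.+1) w) f - ipL2 D (W2 (time m) w) f.
  by apply/funext => w; rewrite ipL2Bl//; apply: W2_L2; exact: time_ge0.
apply: past_funB; apply: W2_past => //; apply: time_le => //; exact: ltnW.
Qed.

Variables (T : mesh D) (lambda1 e S : R) (l : 'rV[R]_(3 + 3)).
Hypotheses (e2 : e ^+ 2 < 1) (etaS : forall m, \sum_(k < m) eta2 k <= S).
Notation zs := (zero_start T dt lambda1 l e dW1 dW2).

(** The bound is the fixed point of K |-> e^2 K + 8 dt S |l|^2, the recursion of [energy_step], so
    each step preserves it. *)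
Lemma zero_start_energy n :
  (\int[P]_w (mxform (Gmx T) (zs n w) (zs n w))%:E <= (8 * S * dot l l * (dt / (1 - e ^+ 2)))%:E)%E.
Proof.
have S0 : 0 <= S by have := etaS 0; rewrite big_ord0.
have K0 : 0 <= 8 * S * dot l l * (dt / (1 - e ^+ 2)).
  apply: mulr_ge0; first by rewrite !mulr_ge0 ?dot_ge0.
  by rewrite divr_ge0 ?subr_ge0// ltW.
elim: n => [|n IH].
  rewrite integral0_eq ?lee_fin// => w _ /=.
  by rewrite /mxform !mul0mx mxE.
have tt : time n < time n.+1 by rewrite ltr_pM2r// ltr_nat.
have dtE : time n.+1 - time n = dt by rewrite /time -mulrBl -natrB// subSnn mul1r.
have := energy_step filtF BM indepB (time_ge0 n) tt dt0 onbq eta2_ge0 etaS (dW1_L2 n) (dW2_L2 n)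
  (fun k => @dW1_past k n n) (@dW2_measurable n) _ (dW2_coefficient n) IH.
move=> /(_ lambda1 e l _ (zs n.+1)) h; apply: le_trans (h _ _) _ => //.
  move=> k; apply: (@zero_start_measurable _ _ (past_type k n)) => //.
  - by move=> m w; exact: dW1_L2.
  - by move=> m _; exact: dW1_past.
  - by move=> m mn; exact: dW2_past.
rewrite lee_fin dtE.
have e1 : 1 - e ^+ 2 != 0 by rewrite gt_eqF// subr_gt0.
by rewrite le_eqVlt; apply/orP; left; apply/eqP; field.
Qed.

End SchemeEnergy.

(** Nonnegativity of the form at (x - z) - z bounds the mixed term of (x - z) + z. *)
Lemma Gmx_split_le (R : realType) (D : cuboid R) (T : mesh D) (x z : 'rV[R]_(dGdim T)) :
  mxform (Gmx T) x x <= 2 * mxform (Gmx T) (x - z) (x - z) + 2 * mxform (Gmx T) z z.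
Proof.
have -> : x = (x - z) + z by rewrite subrK.
rewrite addrK; move: (x - z) => y; have := Gmx_ge0 (y + (- 1) *: z).
rewrite !mxformDl !(mxformDr (Gmx_sym T)) !mxformZl !(mxformC (Gmx_sym T) _ (_ *: z)) !mxformZl.
rewrite (mxformC (Gmx_sym T) z y).
by move: (mxform _ y y) (mxform _ y z) (mxform _ z z) => *; lra.
Qed.

Lemma HH_rv_measurable (R : realType) d (Omega : measurableType d) (D : cuboid R) (X : Omega -> vfield R) :
  HH_rv D X -> measurable_fun setT (fun w => ipHH D (X w) (X w)).
Proof.
move=> [hX mX]; apply: (measurability (@RGenInftyO.G R)); first exact: RGenInftyO.measurableE.
have h0 : HH D (fun=> 0) by move=> i; under eq_fun do rewrite mxE; exact: L2_cst.
move=> _ [_ [r ->] <-]; rewrite setTI.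
rewrite (_ : _ @^-1` _ = [set w | (nsqHH D (fun x => X w x - (fun=> 0) x)%R < r%:E)%E]); first exact: mX.
apply/seteqP; split=> w /=; under [fun x => X w x - 0]eq_fun do rewrite subr0;
  by rewrite in_itv /= (nsqHHE (hX w)) lte_fin.
Qed.

Theorem proposition4p2 (R : realType) (D : cuboid R)
    (rho1 rho2 gamma1 gamma2 b : R)
    (rho1_gt0 : 0 < rho1) (rho2_gt0 : 0 < rho2)
    (gamma1_ge1 : 1 <= gamma1) (gamma2_ge1 : 1 <= gamma2) (b_ge4 : 4 <= b)
    (sigma0 N1 N2 N0 lambda1 : R) (lambda2 : 'rV[R]_3) (sigma0_gt0 : 0 < sigma0) :
  exists2 C11 : R, 0 < C11 &
  exists2 dt0 : R, 0 < dt0 &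
  forall dt : R, 0 < dt -> dt < dt0 ->
  forall T : mesh D, shape_contact_regular rho1 rho2 T ->
  forall (d : measure_display) (Omega : measurableType d) (P : probability Omega R)
    (F : R -> set (set Omega)),
  is_filtration F ->
  forall (beta1 beta2 : nat -> R -> Omega -> R),
  (forall k, is_BM P F (beta1 k)) -> (forall k, is_BM P F (beta2 k)) ->
  independent_processes P
    (fun ik : bool * nat => if ik.1 then beta1 ik.2 else beta2 ik.2) ->
  forall (q : nat -> R3 R -> R) (Q1 Q2 Q1h Q2h : (R3 R -> R) -> R3 R -> R)
    (eta1 eta2 : nat -> R),
  onb D q ->
  nonneg_selfadjoint D Q1 -> nonneg_selfadjoint D Q2 ->
  (forall k, 0 <= eta1 k /\ eqD D (Q1 (q k)) (fun x => eta1 k * q k x)) ->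
  (forall k, 0 <= eta2 k /\ eqD D (Q2 (q k)) (fun x => eta2 k * q k x)) ->
  is_sqrt_op D Q1h Q1 -> is_sqrt_op D Q2h Q2 ->
  HS D q gamma1 (Hs D gamma1) Q1h -> normHS D q gamma1 Q1h = N1%:E ->
  HS D q gamma2 (Hs0 D gamma2) Q2h -> normHS D q gamma2 Q2h = N2%:E ->
  forall W1 W2 : R -> Omega -> R3 R -> R,
  wiener_expansion P D W1 eta1 q beta1 -> wiener_expansion P D W2 eta2 q beta2 ->
  forall u0 : Omega -> vfield R,
  HH_rv D u0 -> (\int[P]_w nsqHH D (u0 w))%E = N0%:E ->
  forall dW1 : nat -> Omega -> R3 R -> R,
  (forall n, truncated_increment P D b dt beta1 Q1h q n (dW1 n)) ->
  forall u : nat -> Omega -> dG T,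
  dG_scheme P sigma0 dt lambda1 lambda2 dW1
    (fun n w x => W2 (n.+1%:R * dt) w x - W2 (n%:R * dt) w x) u0 u ->
  (ereal_sup [set (\int[P]_w nsqHH D (embed (u n w)))%E | n in [set: nat]]
     <= C11%:E)%E.
Proof.
pose l := row_mx lambda2 lambda2.
(* Energy bound for the solution with zero start: [N2 ^+ 2] majorises the trace of Q2, and the last
   factor majorises dt / (1 - e^2) for dt < 1. *)
pose C := 8 * N2 ^+ 2 * dot l l * ((1 + 2 * sigma0) / (2 * sigma0)).
have c0 : 0 <= 8 * N2 ^+ 2 * dot l l.
  by apply: mulr_ge0; [apply: mulr_ge0 => //; exact: sqr_ge0 | exact: dot_ge0].
have C0 : 0 <= C.
  by apply: mulr_ge0 => //; rewrite divr_ge0 ?addr_ge0 ?mulr_ge0// ltW.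
(* The factors 2 come from [Gmx_split_le]. The absolute value and the summand 1 make the constant
   positive while nothing is known yet about [N0]. *)
exists (2 * `|N0| + 2 * C + 1); first by rewrite ltr_wpDl// addr_ge0// mulr_ge0.
exists 1 => // dt dt0 dt1 T _ d Omega P F filtF beta1 beta2 BM1 BM2 indepB.
move=> q Q1 Q2 Q1h Q2h eta1 eta2 onbq _ _ heta1 heta2 sqrtQ1 sqrtQ2 _ _ _ hN2.
move=> W1 W2 _ expW2 u0 ru0 hN0 dW1 incW1 u [ru hinit hstep].
have [e01 e2 erate] := contraction_rate sigma0_gt0 dt0 dt1; set e := expR (- sigma0 * dt) in e01 e2 erate.
have etaS := trace_le_normHS onbq sqrtQ2 heta2 hN2.
pose dW2 (n : nat) w x := W2 (n.+1%:R * dt) w x - W2 (n%:R * dt) w x.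
pose zs := zero_start T dt lambda1 l e dW1 dW2.
have hW1 := dW1_L2 incW1; have hW2 := dW2_L2 expW2 dt0.
have [hu0 _] := ru0.
have mzs n : mx_measurable (zs n).
  have m1 m : weakly_measurable D (dW1 m).
    by move=> f hf; have [rW _] := incW1 m; exact: L2_rv_measurable_ip.
  have m2 m : weakly_measurable D (dW2 m) by exact: (@dW2_measurable _ _ _ P _ _ _ _ _ expW2 _ dt0 m).
  by apply: zero_start_measurable.
have energy n : (\int[P]_w (mxform (Gmx T) (zs n w) (zs n w))%:E <= C%:E)%E.
  apply: le_trans (zero_start_energy filtF BM1 BM2 indepB onbq heta1 sqrtQ1 (fun k => (heta2 k).1)
    expW2 dt0 incW1 T lambda1 l e2 etaS n) _.
  by rewrite lee_fin; exact: ler_wpM2l.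
have mu0 := HH_rv_measurable ru0.
have mcrd n : mx_measurable (fun w => crd (u n w)).
  by move=> i j; under eq_fun do rewrite mxE; exact: ru.
have mdiff n : measurable_fun setT (fun w => mxform (Gmx T) (crd (u n w) - zs n w) (crd (u n w) - zs n w)).
  by apply: mxform_measurable; exact: mx_measurableB.
have mzq n : measurable_fun setT (fun w => mxform (Gmx T) (zs n w) (zs n w)) by exact: mxform_measurable.
have mcq n : measurable_fun setT (fun w => mxform (Gmx T) (crd (u n w)) (crd (u n w))).
  exact: mxform_measurable.
have dist : {ae P, forall w n,
    mxform (Gmx T) (crd (u n w) - zs n w) (crd (u n w) - zs n w) <= ipHH D (u0 w) (u0 w)}.
  (* The steps are countably many, so one null set serves all of them and the comparison is
     pathwise. *)
  move: hstep => /ae_foralln; apply: filterS2 hinit => w hi hs n.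
  exact: (zero_start_distance dt0 e01 (w := w) (fun n => hW1 n w) (fun n => hW2 n w) (hu0 w) hi hs n).
apply: ge_ereal_sup => _ [n _ <-].
have -> : (\int[P]_w nsqHH D (embed (u n w)) =
    \int[P]_w (mxform (Gmx T) (crd (u n w)) (crd (u n w)))%:E)%E.
  by apply: eq_integral => w _; rewrite nsqHHE -?gram_qf.
have hN0' : (\int[P]_w (ipHH D (u0 w) (u0 w))%:E = N0%:E)%E.
  by rewrite -hN0; apply: eq_integral => w _; rewrite nsqHHE.
apply: (@le_trans _ _ (\int[P]_w (2 * (ipHH D (u0 w) (u0 w)) + 2 * mxform (Gmx T) (zs n w) (zs n w))%:E)%E).
  apply: ae_ge0_le_integral => //.
  - by move=> w _; rewrite lee_fin Gmx_ge0.
  - by apply/measurable_EFinP.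
  - by move=> w _; rewrite lee_fin addr_ge0 ?mulr_ge0 ?Gmx_ge0 ?ipHH_ge0.
  - by apply/measurable_EFinP; apply: measurable_funD; apply: measurable_funM => //; exact: measurable_cst.
  apply: filterS dist => w hw _; rewrite lee_fin.
  apply: le_trans (Gmx_split_le _ (zs n w)) _.
  by rewrite lerD2r ler_pM2l.
under eq_integral do rewrite EFinD !EFinM.
have m2 (f : Omega -> R) : measurable_fun setT f -> measurable_fun setT (fun w => 2%:E * (f w)%:E)%E.
  by move=> mf; apply: emeasurable_funM; [exact: measurable_cst | apply/measurable_EFinP].
rewrite ge0_integralD//; [|by move=> w _; rewrite mule_ge0// lee_fin ipHH_ge0|exact: m2
  |by move=> w _; rewrite mule_ge0// lee_fin Gmx_ge0|exact: m2].
rewrite !ge0_integralZl//; try by [apply/measurable_EFinP | move=> w _; rewrite lee_fin ?ipHH_ge0 ?Gmx_ge0].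
rewrite hN0'; apply: (@le_trans _ _ (2%:E * N0%:E + 2%:E * C%:E)%E).
  by rewrite leeD2l//; apply: lee_wpmul2l.
rewrite -!EFinM -EFinD lee_fin; apply: (@le_trans _ _ (2 * `|N0| + 2 * C)); last by rewrite lerDl.
by rewrite lerD2r ler_pM2l// ler_norm.
Qed.
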